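(* Let $M$ be a smooth closed Riemannian manifold. Let $K$ be a compact set (with respect to the weak-* topology) in the space of Borel probability measures on $\mathrm{Homeo}(M)$ such that: (1) for every $\mu\in K$, $\mathrm{supp}(\mu)\subset \mathrm{Hol}(M)$; (2) there exist $\beta>0$ and $C_0$ such that $\int_{\mathrm{Hol}(M)}\Lambda(f)^\beta\,d\mu(f)<C_0$ for every $\mu\in K$; (3) for every $\mu\in K$ there are no Borel probability measures $m_1,m_2$ on $M$ such that $f_*m_1=m_2$ for $\mu$-a.e. $f$. Then there exist $\alpha>0$, $C$ and $\kappa>1$ such that for every initial Borel probability measure $\nu_0$ on $M$, every sequence $\mu_1,\mu_2,\ldots\in K$, every $n\in\mathbb{N}$, and every $x\in M$ one has: if $r>e^{-\kappa^n}$, then $$[\mu_n*\mu_{n-1}*\cdots*\mu_1*\nu_0](B_r(x))<C|\log r|^{-\alpha}.$$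
   Context: $d$ is the Riemannian distance on $M$, $B_r(x)$ the ball of radius $r$ centered at $x$. $\mathrm{Homeo}(M)$ is the set of homeomorphisms of $M$ with the topology of uniform convergence; $\mathrm{Hol}(M)\subset\mathrm{Homeo}(M)$ is the set of bi-Hölder homeomorphisms ($f$ and $f^{-1}$ both Hölder continuous for some exponent). For a homeomorphism $f$ and $\gamma>0$ put $H_\gamma(f)=\sup_{x\ne y}\frac{d(f(x),f(y))}{d(x,y)^\gamma}\in[0,\infty]$ and $H'_\gamma(f)=\max(H_\gamma(f),H_\gamma(f^{-1}))$. For $f\in\mathrm{Hol}(M)$: $\gamma(f)=\sup\{\gamma>0: H'_\gamma(f)<\infty\}$, $L(f)=H'_{\gamma(f)/2}(f)$, and $\Lambda(f)=2\cdot\frac{1+\log L(f)}{\gamma(f)}$. For a probability measure $\mu$ on $\mathrm{Homeo}(M)$ and a Borel probability measure $\nu$ on $M$, $\mu*\nu=\int (f_*\nu)\,d\mu(f)$; iterated expressions are $\mu_n*(\mu_{n-1}*(\cdots*(\mu_1*\nu_0)))$. The weak-* topology on measures on $\mathrm{Homeo}(M)$ is that of convergence against bounded continuous functions.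
   Formalization: Adds r<1 (the bound is undefined at r=1, false for large r) and, for some c>0, 1+log L(f)≥c for μ-a.e. f and all μ∈K (automatic if diam M>1/e; for small diameter Λ(f)^β may be undefined and the claim can fail); M is taken connected. *)

(* Defs.v *)
From HB Require Import structures.
From mathcomp Require Import all_boot all_order all_algebra.
From mathcomp Require Import all_classical all_reals all_analysis.

Set Implicit Arguments.
Unset Strict Implicit.
Unset Printing Implicit Defensive.

Import Order.TTheory GRing.Theory Num.Theory.
Import numFieldNormedType.Exports.

Local Open Scope classical_set_scope.
Local Open Scope ring_scope.

(* Only meaningful for U open: every derivative is a full two-sided one. *)
Fixpoint Ck_on {R : realType} {V W : normedModType R} (k : nat)
    (U : set V) (f : V -> W) : Prop :=
  match k with
  | 0%N => forall x, U x -> {for x, continuous f}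
  | k'.+1 => (forall x, U x -> differentiable f x) /\
             (forall v, Ck_on k' U (fun x => 'D_v f x))
  end.

Definition smooth_on {R : realType} {V W : normedModType R}
    (U : set V) (f : V -> W) : Prop := forall k, Ck_on k U f.

Definition bilin {R : realType} {n : nat} (g : 'M[R]_n) (v w : 'rV[R]_n) : R :=
  (v *m g *m w^T) 0 0.

(* A smooth n-manifold without boundary, given by a smooth atlas, together
   with a smooth Riemannian metric given by its Gram matrices in the charts.
   The i-th chart is coord i : dom i -> 'rV_n, with inverse param i; both are
   total functions, whose values off dom i, resp. coord i @` dom i, are junk.
   The base point of the carrier is the default element that the library asks
   of every measurable space; it plays no other role. *)
Record riemannian_manifold (R : realType) (n : nat) := RiemannianManifold {
  carrier :> ptopologicalType;
  rm_hausdorff : hausdorff_space carrier;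
  rm_second_countable : @second_countable carrier;
  chart : Type;
  dom : chart -> set carrier;
  coord : chart -> carrier -> 'rV[R]_n;
  param : chart -> 'rV[R]_n -> carrier;
  chart_at : carrier -> chart;
  chart_at_dom : forall x, dom (chart_at x) x;
  dom_open : forall i, open (dom i);
  codom_open : forall i, open (coord i @` dom i);
  coordK : forall i x, dom i x -> param i (coord i x) = x;
  coord_continuous : forall i x, dom i x -> {for x, continuous (coord i)};
  param_continuous : forall i u, (coord i @` dom i) u ->
    {for u, continuous (param i)};
  transition_smooth : forall i j,
    smooth_on (coord i @` (dom i `&` dom j)) (coord j \o param i);
  gram : chart -> 'rV[R]_n -> 'M[R]_n;
  gram_smooth : forall i, smooth_on (coord i @` dom i) (gram i);
  gram_sym : forall i u, (coord i @` dom i) u -> (gram i u)^T = gram i u;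
  gram_pos : forall i u v, (coord i @` dom i) u -> v != 0 ->
    0 < bilin (gram i u) v v;
  gram_compat : forall i j x v w, dom i x -> dom j x ->
    bilin (gram i (coord i x)) v w =
    bilin (gram j (coord j x)) ('D_v (coord j \o param i) (coord i x))
                               ('D_w (coord j \o param i) (coord i x))
}.

Section RiemannianDistance.
Context {R : realType} {n : nat} (M : riemannian_manifold R n).

Definition C1_curve (c : R -> M) : Prop :=
  continuous c /\
  forall i : chart M, Ck_on 1 (c @^-1` dom i) (fun t => coord i (c t)).

Definition speed (c : R -> M) (t : R) : R :=
  let i := chart_at (c t) in
  let v := 'D_1 (fun s => coord i (c s)) t in
  Num.sqrt (bilin (gram i (coord i (c t))) v v).

(* Only the restriction of each C^1 arc to `[0, 1] counts. *)
Fixpoint piecewise_C1 (x y : M) (s : seq (R -> M)) : Prop :=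
  match s with
  | [::] => x = y
  | c :: s' => [/\ C1_curve c, c 0 = x & piecewise_C1 (c 1) y s']
  end.

Definition curve_length (s : seq (R -> M)) : R :=
  \sum_(c <- s) \int[lebesgue_measure]_(t in `[0, 1]) speed c t.

(* For M connected the set is nonempty, so this is a genuine infimum. *)
Definition rdist (x y : M) : R :=
  inf [set curve_length s | s in [set s | piecewise_C1 x y s]].

Definition rball (x : M) (r : R) : set M := [set y | rdist x y < r].

End RiemannianDistance.

Section Homeomorphisms.
Context {R : realType} {n : nat} (M : riemannian_manifold R n).

Record homeo := Homeo {
  homeo_fun :> M -> M;
  homeo_invfun : M -> M;
  homeo_funK : cancel homeo_fun homeo_invfun;
  homeo_invK : cancel homeo_invfun homeo_fun;
  homeo_cont : continuous homeo_fun;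
  homeo_inv_cont : continuous homeo_invfun
}.

Definition homeo_inv (f : homeo) : homeo :=
  Homeo (homeo_invK f) (homeo_funK f) (homeo_inv_cont (h := f))
        (homeo_cont (h := f)).

Definition homeo_id : homeo :=
  @Homeo idfun idfun (fun=> erefl) (fun=> erefl)
    (fun x => @cvg_id _ (nbhs x)) (fun x => @cvg_id _ (nbhs x)).

HB.instance Definition _ := gen_eqMixin homeo.
HB.instance Definition _ := gen_choiceMixin homeo.
HB.instance Definition _ := isPointed.Build homeo homeo_id.

Definition unif_open : set (set homeo) :=
  [set U : set homeo | forall f : homeo, U f -> exists2 e : R, 0 < e &
    forall g : homeo, (forall x, rdist (f x) (g x) < e) -> U g].

Let unif_openT : unif_open setT.
Proof. by move=> f _; exists 1. Qed.

Let unif_openI : setI_closed unif_open.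
Proof.
move=> U V oU oV f [/oU [e e0 eU] /oV [e' e'0 eV]].
exists (Num.min e e'); first by rewrite lt_min e0.
move=> g fg; split.
  by apply: eU => x; have := fg x; rewrite lt_min => /andP[].
by apply: eV => x; have := fg x; rewrite lt_min => /andP[].
Qed.

Let unif_open_bigU (I : Type) (F : I -> set homeo) :
  (forall i, unif_open (F i)) -> unif_open (\bigcup_i F i).
Proof.
move=> oF f [i _ /oF [e e0 eF]]; exists e => // g fg.
by exists i => //; apply: eF.
Qed.

HB.instance Definition _ :=
  isOpenTopological.Build homeo unif_openT unif_openI unif_open_bigU.

Local Open Scope ereal_scope.

Definition holder_const (g : R) (f : homeo) : \bar R :=
  ereal_sup [set h | exists x y : M, x <> y /\
    h = (rdist (f x) (f y) / rdist x y `^ g)%:E].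

Definition holder_const2 (g : R) (f : homeo) : \bar R :=
  maxe (holder_const g f) (holder_const g (homeo_inv f)).

Definition Hol : set homeo := [set f |
  (exists2 g : R, (0 < g)%R & holder_const g f < +oo) /\
  (exists2 g : R, (0 < g)%R & holder_const g (homeo_inv f) < +oo)].

(* On Hol the sup is finite and positive as soon as M is compact, connected
   and has more than one point; fine then loses nothing. *)
Definition holder_exp (f : homeo) : R :=
  fine (ereal_sup [set g%:E | g in
    [set g : R | (0 < g)%R /\ holder_const2 g f < +oo]]).

Definition holder_L (f : homeo) : R := fine (holder_const2 (holder_exp f / 2) f).

Definition holder_Lambda (f : homeo) : R :=
  (2 * ((1 + ln (holder_L f)) / holder_exp f))%R.

End Homeomorphisms.

Section BorelMeasures.
Context (T : ptopologicalType) (R : realType).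

Definition borel : measurableType (sigma_display (@open T)) :=
  g_sigma_algebraType (@open T).

Definition msupport (mu : probability borel R) : set T :=
  [set x | forall U : set T, open U -> U x -> (0 < mu U)%E].

Definition Cb := {phi : T -> R | continuous phi /\ bounded_fun phi}.

Definition weak_star : topologicalType :=
  initial_topology (fun mu : probability borel R =>
    (fun phi : Cb => \int[mu]_x sval phi x) : {ptws Cb -> R}).

Definition weak_star_compact (K : set (probability borel R)) : Prop :=
  compact (K : set weak_star).

End BorelMeasures.

Section Convolution.
Context {R : realType} {n : nat} (M : riemannian_manifold R n).
Local Open Scope ereal_scope.

Definition conv (mu : probability (borel (homeo M)) R)
    (nu : set (borel M) -> \bar R) : set (borel M) -> \bar R :=
  fun A => \int[mu]_f pushforward nu (homeo_fun f : borel M -> borel M) A.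

(* mu_k * (mu_{k-1} * ( ... * (mu_1 * nu))); mu 0 is not used. *)
Fixpoint iter_conv (mu : nat -> probability (borel (homeo M)) R)
    (nu : set (borel M) -> \bar R) (k : nat) : set (borel M) -> \bar R :=
  match k with
  | 0%N => nu
  | k'.+1 => conv (mu k) (iter_conv mu nu k')
  end.

End Convolution.

(* Main.v *)
From Pilot Require Import Defs.
From HB Require Import structures.
From mathcomp Require Import all_boot all_order all_algebra.
From mathcomp Require Import all_classical all_reals all_analysis.
From mathcomp Require Import measurable_realfun ring lra zify.

Set Implicit Arguments.
Unset Strict Implicit.
Unset Printing Implicit Defensive.

Import Pilot.Defs.
Import Order.TTheory GRing.Theory Num.Theory.
Import numFieldNormedType.Exports.

Local Open Scope classical_set_scope.
Local Open Scope ring_scope.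

(* The idea is to follow, instead of measures of balls, the energies
   [energy j S = sum_i S (U j i) ^+ 2], where the squares of the functions [U j i]
   form a partition of unity at the doubly exponential scale
   [scale j = expR (- (n + 3)%:R ^+ j)]: up to an error [O(4^-j)] the energy of index
   [j] bounds the square of the mass of balls of radius [scale j.+2].
   If [f] satisfies [min (d x y) e^-1 `^ ((n + 3) ^ t) <= d (f x) (f y)], then pushing
   forward by [f] shifts the energies by at most [t + 2] indices, and the moment
   condition makes the probability that [f] is not of this kind geometrically small
   in [t]. Hence the total energy with weights [(1 + del) ^+ j] grows on average by a
   factor at most [1 + O(del)] under push-forward, while the energy of the average of
   the push-forwards is smaller than the average energy by exactly the variance.
   If for every small [del] the total energy failed to decrease by the factor
   [1 - del] for some measure in [K] and some initial condition, then all variances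
   would be negligible and, by compactness, the normalized energy densities before
   and after averaging would converge to two probability measures [m1] and [m2] with
   [f_* m1 = m2] on the support of a limit point of the measures, which is excluded.
   For a suitable [del] the total energy thus contracts up to an additive constant,
   and after [k] steps [energy j] is [O((1 + del) ^- j)] for all [j <= k]. *)

(** * The Riemannian distance *)

(** The normalisation makes [x -> (U j i x)_i] a map into a unit sphere, and [energy j S] is the
    squared length of the mean of this map under [S]. Pointwise comparisons of the kernel
    [sum_i U j i x * U j i y] thus integrate to comparisons of energies, while averaging
    push-forwards averages vectors, whose loss of squared length is a variance; a supremum of ball
    masses has no such identity. A bi-Hoelder map turns a scale [r] into a power of [r], so it
    translates [ln (- ln r)]: hence the doubly exponential scales. Exponential weights survive such
    translations only if their tails are geometric, and polynomial decay of the law of [Lambda] is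
    geometric decay in the index. The growth estimate alone never gives a decrease; the gain must
    come from the variance, and as the third condition is purely qualitative, [del] is obtained by
    contradiction and compactness. The final exponent is [ln (1 + del) / (2 * ln (n + 3))], where
    the 2 reflects that energies are squares of masses. *)

Lemma for_continuous_sum (T : topologicalType) (R : realType) (I : Type)
    (r : seq I) (P : pred I) (F : I -> T -> R) (t : T) :
  (forall i, P i -> {for t, continuous (F i)}) ->
  {for t, continuous (fun x => \sum_(i <- r | P i) F i x)}.
Proof.
move=> cF; elim: r => [|i r IHr].
  rewrite (_ : (fun _ => _) = fun=> 0); first exact: cvg_cst.
  by apply/funext => x; rewrite big_nil.
have [Pi|nPi] := boolP (P i); last first.
  rewrite (_ : (fun _ => _) = fun x => \sum_(i <- r | P i) F i x) //.
  by apply/funext => x; rewrite big_cons (negbTE nPi).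
rewrite (_ : (fun _ => _) = fun x => F i x + \sum_(i <- r | P i) F i x).
  by apply: cvgD => //; exact: cF.
by apply/funext => x; rewrite big_cons Pi.
Qed.

Lemma near_eq_for_continuous (T U : topologicalType) (f g : T -> U) (t : T) :
  (\forall s \near t, f s = g s) -> {for t, continuous f} -> {for t, continuous g}.
Proof.
move=> fg cf; have e := nbhs_singleton fg; rewrite /= in e; rewrite /prop_for /continuous_at -e.
by apply: cvg_trans; [exact: near_eq_cvg fg|exact: cf].
Qed.

Section Curves.
Context {R : realType} {n : nat} (M : riemannian_manifold R n).
Implicit Types (c : R -> M) (i j : chart M).

Lemma preimage_dom_open c i : continuous c -> open (c @^-1` dom i).
Proof. by move=> cc; apply: open_comp => [t _|]; [exact: cc|exact: dom_open]. Qed.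

Lemma transition_differentiable i j (x : M) : dom i x -> dom j x ->
  differentiable (coord j \o param i) (coord i x).
Proof.
move=> ix jx; have [+ _] := @transition_smooth _ _ M i j 1%N.
by apply; exists x.
Qed.

(** [speed] uses the chart [chart_at (c t)], which may change abruptly with [t]. The chain rule for
    the transition map and [gram_compat] allow any chart containing [c t], so near a given time one
    fixed chart serves; continuity of the speed rests on this. *)
Lemma speedE c i t : C1_curve c -> dom i (c t) ->
  speed c t = Num.sqrt (bilin (gram i (coord i (c t)))
    ('D_1 (fun s => coord i (c s)) t) ('D_1 (fun s => coord i (c s)) t)).
Proof.
move=> [cc c1] it; set vi := 'D_1 _ t.
have jt : dom (chart_at (c t)) (c t) := chart_at_dom _.
have E : 'D_vi (coord (chart_at (c t)) \o param i) (coord i (c t)) =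
    'D_1 (fun s => coord (chart_at (c t)) (c s)) t.
  set j := chart_at (c t) in jt *.
  have -> : 'D_(1 : R) (fun s => coord j (c s)) t =
      'D_1 ((coord j \o param i) \o (fun s => coord i (c s))) t.
    apply: near_eq_derive; near=> s; rewrite /= coordK//.
    near: s; apply: open_nbhs_nbhs; split => //; exact: preimage_dom_open.
  have [di _] := c1 i; have dct := di t it.
  have dT := transition_differentiable it jt.
  by rewrite /vi [RHS]deriveE ?diff_comp// ?deriveE//; exact: differentiable_comp.
by rewrite (gram_compat vi vi it jt) E.
Unshelve. all: by end_near. Qed.

Lemma bilinE (g : 'M[R]_n) (v w : 'rV[R]_n) :
  bilin g v w = \sum_k \sum_l v 0 l * g l k * w 0 k.
Proof.
rewrite /bilin mxE; apply: eq_bigr => k _; rewrite !mxE mulr_suml.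
by apply: eq_bigr.
Qed.

Lemma mx_entry_continuous (T : topologicalType) p q (A : T -> 'M[R]_(p, q)) (t : T) a b :
  {for t, continuous A} -> {for t, continuous (fun s => A s a b)}.
Proof.
move=> cA; apply: (@continuous_comp _ _ _ A (fun B : 'M[R]_(p, q) => B a b)) => //.
exact: mathcomp.analysis.normedtype_theory.matrix_normedtype.coord_continuous.
Qed.

Lemma bilin_continuous (T : topologicalType) (g : T -> 'M[R]_n) (v w : T -> 'rV[R]_n)
    (t : T) :
  {for t, continuous g} -> {for t, continuous v} -> {for t, continuous w} ->
  {for t, continuous (fun s => bilin (g s) (v s) (w s))}.
Proof.
move=> cg cv cw; rewrite (_ : (fun s => _) = fun s => 
  \sum_k \sum_l v s 0 l * g s l k * w s 0 k); last first.
  by apply/funext => s; rewrite bilinE.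
apply: for_continuous_sum => k _; apply: for_continuous_sum => l _.
by apply: cvgM; [apply: cvgM|]; exact: mx_entry_continuous.
Qed.

Lemma gram_continuous i (x : M) : dom i x -> {for coord i x, continuous (gram i)}.
Proof. by move=> ix; apply: (@gram_smooth _ _ M i 0%N); exists x. Qed.

Lemma speed_continuous c : C1_curve c -> continuous (speed c).
Proof.
move=> hc t; have [cc c1] := hc; pose i := chart_at (c t).
have it : dom i (c t) := chart_at_dom _.
have cic : {for t, continuous (fun s => coord i (c s))}.
  by apply: continuous_comp; [exact: cc|exact: coord_continuous].
have [_ /(_ 1) d1] := c1 i.
pose F s := Num.sqrt (bilin (gram i (coord i (c s)))
    ('D_1 (fun s => coord i (c s)) s) ('D_1 (fun s => coord i (c s)) s)).
have eF : \near t, F t = speed c t.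
  near=> s; rewrite /F -speedE//.
  near: s; apply: open_nbhs_nbhs; split => //; exact: preimage_dom_open.
have cF : {for t, continuous F}.
  apply: continuous_comp; last exact: sqrt_continuous.
  apply: bilin_continuous; [|exact: d1|exact: d1].
  by apply: (@continuous_comp _ _ _ _ (gram i)) => //; exact: gram_continuous.
rewrite /continuous_at (speedE hc it) -/(F t).
apply: cvg_trans; last exact: cF.
apply: near_eq_cvg.
exact: eF.
Unshelve. all: by end_near. Qed.

Lemma speed_ge0 c t : 0 <= speed c t.
Proof. exact: sqrtr_ge0. Qed.

End Curves.
Lemma derive_onem (R : realType) (V : normedModType R) (f : R -> V) (v t : R) :
  differentiable f (1 - t) ->
  differentiable (f \o (fun t => 1 - t)) t /\
  'D_v (f \o (fun t => 1 - t)) t = - 'D_v f (1 - t).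
Proof.
move=> df.
have d1 : is_diff t (fun t : R => 1 - t) (fun t => - t).
  have -> : (fun t : R => - t) = 0 - id by rewrite sub0r.
  exact: is_diffB.
have dd : differentiable (fun t : R => 1 - t) t by [].
have dfc : differentiable (f \o (fun t => 1 - t)) t by exact: differentiable_comp.
split => //.
apply: (eq_trans (deriveE v dfc)).
have E := diff_comp dd df.
apply: (eq_trans (congr1 (fun h : R -> V => h v) E)).
have E2 := deriveE v df.
rewrite E2.
have E3 : 'd (fun t0 : R => 1 - t0) t = (fun t => - t) :> (R -> R) by exact: diff_val.
apply: (eq_trans (congr1 (fun h : R -> R => 'd f (1 - t) (h v)) E3)).
exact: linearN.
Qed.

Section Lengths.
Context {R : realType} {n : nat} (M : riemannian_manifold R n).
Implicit Types (c : R -> M) (i j : chart M) (s : seq (R -> M)).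

Definition revc c : R -> M := c \o (fun t => 1 - t).

Lemma C1_revc c : C1_curve c -> C1_curve (revc c).
Proof.
move=> [cc c1]; have co : continuous (fun t : R => 1 - t).
  by move=> t; apply: cvgB; [exact: cvg_cst|exact: cvg_id].
split; first by move=> t; apply: continuous_comp; [exact: co|exact: cc].
move=> i; have [di Di] := c1 i; split.
  by move=> t /di /(derive_onem 1)[].
move=> v t it.
have it1 : dom i (c (1 - t)) by [].
pose F (u : R) : 'rV[R]_n := - 'D_v (fun u => coord i (c u)) (1 - u).
suff cF : {for t, continuous F}.
  refine (near_eq_for_continuous _ cF).
  near=> u; apply: esym; apply: (derive_onem v (di (1 - u) _)).2.
  near: u; have : open (revc c @^-1` dom i).
    by apply: preimage_dom_open => u; apply: continuous_comp; [exact: co|exact: cc].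
  by move=> oi; apply: open_nbhs_nbhs.
pose D (u : R) : 'rV[R]_n := 'D_v (fun u => coord i (c u)) u.
have cD : {for t, continuous (D \o (fun u : R => 1 - u))}.
  by apply: continuous_comp; [exact: co|exact: Di].
exact: cvgN cD.
Unshelve. all: by end_near. Qed.

Lemma bilinN (g : 'M[R]_n) v : bilin g (- v) (- v) = bilin g v v.
Proof.
by rewrite !bilinE; apply: eq_bigr => k _; apply: eq_bigr => l _; rewrite !mxE; ring.
Qed.

Lemma speed_revc c t : C1_curve c -> speed (revc c) t = speed c (1 - t).
Proof.
move=> hc; have [_ c1] := hc; have [di _] := c1 (chart_at (c (1 - t))).
by rewrite /speed /= (derive_onem 1 (di _ (chart_at_dom _))).2 bilinN.
Qed.

Definition arc_length c : R := \int[lebesgue_measure]_(t in `[0, 1]) speed c t.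

Lemma arc_length_ge0 c : 0 <= arc_length c.
Proof. by apply: Rintegral_ge0 => t _; exact: speed_ge0. Qed.

Lemma arc_length_revc c : C1_curve c -> arc_length (revc c) = arc_length c.
Proof.
move=> hc; have i01 : 0 <= (1 : R) <= 1 by rewrite ler01 lexx.
have cs : {within `[0, 1 : R], continuous (speed c)}.
  by apply: continuous_subspaceT; exact: speed_continuous.
apply: esym; apply: (eq_trans (Rintegration_by_substitution_onem i01 cs)).
rewrite {1}/unstable.onem subrr; apply: eq_Rintegral => t _.
by apply: esym; exact: speed_revc.
Qed.

Lemma curve_lengthE s : curve_length s = \sum_(c <- s) arc_length c.
Proof. by []. Qed.

Lemma curve_length_cat s s' :
  curve_length (s ++ s') = curve_length s + curve_length s'.
Proof. by rewrite !curve_lengthE big_cat. Qed.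

Lemma curve_length_cons c s : curve_length (c :: s) = arc_length c + curve_length s.
Proof. by rewrite !curve_lengthE big_cons. Qed.

Lemma curve_length_nil : curve_length (Nil (R -> M)) = 0.
Proof. by rewrite curve_lengthE big_nil. Qed.

Lemma curve_length_ge0 s : 0 <= curve_length s.
Proof. by rewrite curve_lengthE; apply: sumr_ge0 => c _; exact: arc_length_ge0. Qed.

Lemma piecewise_C1_cat x y z s s' :
  piecewise_C1 x y s -> piecewise_C1 y z s' -> piecewise_C1 x z (s ++ s').
Proof.
elim: s x => [x -> //|c s IH x [hc c0 cs] ys'] /=.
by split => //; exact: IH.
Qed.

Lemma piecewise_C1_rev x y s : piecewise_C1 x y s ->
  exists2 s', piecewise_C1 y x s' & curve_length s' = curve_length s.
Proof.
elim: s x => [x ->|c s IH x [hc c0 /IH [s' ps' ls']]]; first by exists [::].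
exists (s' ++ [:: revc c]).
  apply: piecewise_C1_cat ps' _; split; first exact: C1_revc.
    by rewrite /revc /= subr0.
  by rewrite /= /revc /= subrr.
by rewrite curve_length_cat !curve_length_cons curve_length_nil arc_length_revc// addr0 addrC ls'.
Qed.

Lemma rdist_le x y s : piecewise_C1 x y s -> rdist x y <= curve_length s.
Proof.
move=> ps; apply: ge_inf; last by exists s.
by exists 0 => _ [s' _ <-]; exact: curve_length_ge0.
Qed.

Lemma rdist_ge0 (x y : M) : 0 <= rdist x y.
Proof.
have [[s ps]|nps] := pselect (exists s, piecewise_C1 x y s).
  by apply: lb_le_inf; [exists (curve_length s), s|move=> _ [s' _ <-]; exact: curve_length_ge0].
rewrite /rdist (_ : [set _ | _ in _] = set0) ?inf0//.
by apply/seteqP; split => // z [s ps _]; apply: nps; exists s.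
Qed.

Lemma rdistxx (x : M) : rdist x x = 0.
Proof.
apply/le_anti; rewrite rdist_ge0 andbT.
by apply: le_trans (@rdist_le x x [::] erefl) _; rewrite curve_length_nil.
Qed.

Lemma rdistC (x y : M) : rdist x y = rdist y x.
Proof.
rewrite /rdist; congr inf; apply/seteqP; split => _ [s ps <-];
  by have [s' ps' <-] := piecewise_C1_rev ps; exists s'.
Qed.

Hypothesis path_connected : forall x y : M, exists s, piecewise_C1 x y s.

Lemma rdist_adherent (x y : M) e : 0 < e ->
  exists2 s, piecewise_C1 x y s & curve_length s < rdist x y + e.
Proof.
move=> e0; have [s0 ps0] := path_connected x y.
have : has_inf [set curve_length s | s in [set s | piecewise_C1 x y s]].
  split; first by exists (curve_length s0), s0.
  by exists 0 => _ [s' _ <-]; exact: curve_length_ge0.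
by move=> /(inf_adherent e0)[_ [s ps <-] lt]; exists s.
Qed.

Lemma rdist_triangle (x y z : M) : rdist x z <= rdist x y + rdist y z.
Proof.
apply/ler_addgt0Pr => e e0.
have e20 : 0 < e / 2 by rewrite divr_gt0.
have [s ps ls] := rdist_adherent x y e20.
have [s' ps' ls'] := rdist_adherent y z e20.
apply: le_trans (rdist_le (piecewise_C1_cat ps ps')) _.
rewrite curve_length_cat.
have := ltW (ltrD ls ls'); lra.
Qed.

End Lengths.

(** * Local comparison of lengths with the coordinate norm *)

Section GramBounds.
Context {R : realType} {n : nat}.
Implicit Types (v : 'rV[R]_n) (g : 'M[R]_n).

Lemma rV_entry_le v k : `|v 0 k| <= `|v|.
Proof.
rewrite [leRHS]/Num.norm /= mx_normrE.
exact: (le_bigmax _ (fun ij : 'I_1 * 'I_n => `|v ij.1 ij.2|) (0, k)).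
Qed.

Lemma bilin_le g v : bilin g v v <= (\sum_k \sum_l `|g l k|) * `|v| ^+ 2.
Proof.
rewrite bilinE mulr_suml; apply: ler_sum => k _.
rewrite mulr_suml; apply: ler_sum => l _.
apply: le_trans (ler_norm _) _; rewrite !normrM expr2 mulrAC mulrC.
apply: ler_wpM2l => //; apply: ler_pM => //; exact: rV_entry_le.
Qed.

Lemma bilinZ g (a : R) v : bilin g (a *: v) (a *: v) = a ^+ 2 * bilin g v v.
Proof.
rewrite !bilinE mulr_sumr; apply: eq_bigr => k _; rewrite mulr_sumr.
by apply: eq_bigr => l _; rewrite !mxE; ring.
Qed.

Lemma bilin0 g : bilin g 0 0 = 0.
Proof. by rewrite -(scale0r (0 : 'rV[R]_n)) bilinZ expr0n mul0r. Qed.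

Lemma unit_sphere_compact : compact [set v : 'rV[R]_n | `|v| = 1].
Proof.
apply: bounded_closed_compact.
  by exists 1; split => // x x1 v /= ->; exact: ltW.
apply: (@closed_comp _ _ (fun v : 'rV[R]_n => `|v|) [set 1]); last exact: closed_eq.
by move=> v _; exact: norm_continuous.
Qed.

Lemma gram_upper (G : 'rV[R]_n -> 'M[R]_n) (u0 : 'rV[R]_n) :
  {for u0, continuous G} ->
  exists2 B : R, 0 < B & \forall u \near u0, forall v, bilin (G u) v v <= B * `|v| ^+ 2.
Proof.
move=> cG; pose N (u : 'rV[R]_n) : R := \sum_k \sum_l `|G u l k|.
have cN : {for u0, continuous N}.
  apply: for_continuous_sum => k _; apply: for_continuous_sum => l _.
  apply: continuous_comp; last exact: norm_continuous.
  exact: mx_entry_continuous.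
exists (N u0 + 1).
  by rewrite ltr_wpDl// /N; apply: sumr_ge0 => k _; apply: sumr_ge0.
have : \forall u \near u0, N u < N u0 + 1.
  by apply: (cvgr_lt (N u0) cN); rewrite ltrDl ltr01.
apply: filterS => u Nu v; apply: le_trans (bilin_le _ _) _.
by apply: ler_wpM2r; [exact: exprn_ge0|exact: ltW].
Qed.

(** Positivity at [u0] is uniform over the compact unit sphere and persists for [u] near [u0];
    homogeneity of degree 2 extends it from unit vectors to all vectors. *)
Lemma gram_lower (G : 'rV[R]_n -> 'M[R]_n) (u0 : 'rV[R]_n) :
  {for u0, continuous G} -> (forall v, v != 0 -> 0 < bilin (G u0) v v) ->
  exists2 b : R, 0 < b & \forall u \near u0, forall v, b * `|v| ^+ 2 <= bilin (G u) v v.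
Proof.
move=> cG Gpos.
have /compact_near_coveringP := unit_sphere_compact.
(* The covering parameter is a pair [(u, b)] with [u] near [u0] and [b] tending to 0 from the
   right. *)
move=> /(_ ('rV[R]_n * R)%type (filter_prod (nbhs u0) (0^'+)) (fun p v => p.2 < bilin (G p.1) v v) _).
case.
  move=> v /= v1; have v0 : v != 0 by rewrite -normr_eq0 v1 oner_neq0.
  have cq : {for (v, u0), continuous (fun p : 'rV[R]_n * 'rV[R]_n => bilin (G p.2) p.1 p.1)}.
    apply: bilin_continuous; [|exact: cvg_fst|exact: cvg_fst].
    by apply: (@continuous_comp _ _ _ snd G); [exact: cvg_snd|exact: cG].
  have b20 : 0 < bilin (G u0) v v / 2 by rewrite divr_gt0// Gpos.
  have : \forall p \near (v, u0), bilin (G u0) v v / 2 < bilin (G p.2) p.1 p.1.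
    apply: (cvgr_gt _ cq); rewrite /= ltr_pdivrMr// ltr_pMr ?Gpos//.
    by rewrite ltrDl ltr01.
  move=> [[A B] /= [nA nB] AB].
  exists (A, B `*` [set b | b < bilin (G u0) v v / 2]); first split => //=.
    exists (B, [set b | b < bilin (G u0) v v / 2]) => //=; split => //.
    exact: nbhs_right_lt.
  move=> [v' [u b]] /= [Av' [Bu bb]].
  by apply: lt_trans bb _; exact: (AB (v', u)).
move=> [Us Bs] [/= nU nB] sub.
have [b [b0 Bb]] : exists b, 0 < b /\ Bs b.
  near (0 : R)^'+ => b; exists b; split; near: b => //; exact: nbhs_right_gt.
exists b => //; apply: filterS nU => u Uu v.
have [->|v0] := eqVneq v 0; first by rewrite bilin0 normr0 expr0n mulr0.
have nv0 : 0 < `|v| by rewrite normr_gt0.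
have e : v = `|v| *: (`|v|^-1 *: v) by rewrite scalerA divff ?gt_eqF// scale1r.
rewrite [X in _ <= bilin _ X X]e bilinZ mulrC ler_pM2l ?exprn_gt0//.
apply: ltW; apply: (sub (u, b)) => //=.
by rewrite normrZ normfV normr_id mulVf ?gt_eqF.
Unshelve. all: by end_near. Qed.

End GramBounds.

Section Segments.
Context {R : realType} {n : nat} (M : riemannian_manifold R n).
Implicit Types (c : R -> M) (i j : chart M).

Lemma paramK i (u : 'rV[R]_n) : (coord i @` dom i) u ->
  dom i (param i u) /\ coord i (param i u) = u.
Proof. by move=> [x ix <-]; rewrite coordK. Qed.

(** An arc must be C^1 on all of [R], although only [[0, 1]] counts. This smooth function maps [R]
    into [[0, 1]] and fixes 0 and 1, so a segment reparametrised by it never leaves a ball of the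
    chart. *)
Definition ramp (t : R) : R := (1 - cos (pi * t)) / 2.

Lemma ramp0 : ramp 0 = 0.
Proof. by rewrite /ramp mulr0 cos0 subrr mul0r. Qed.

Lemma ramp1 : ramp 1 = 1.
Proof. by rewrite /ramp mulr1 cospi opprK divff// pnatr_eq0. Qed.

Lemma ramp_itv t : 0 <= ramp t <= 1.
Proof.
have := cos_geN1 (pi * t); have := cos_le1 (pi * t); rewrite /ramp => *; lra.
Qed.

Definition ramp' (t : R) : R := pi * sin (pi * t) / 2.

Lemma is_derive_ramp (t : R) : is_derive t (1 : R) ramp (ramp' t).
Proof.
rewrite /ramp.
have h : is_derive t 1 (fun t : R => pi * t) pi.
  rewrite (_ : (fun t => pi * t) = pi *: (id : R -> R))//.
  by apply: is_derive_eq; rewrite /GRing.scale /= mulr1.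
have hc : is_derive t 1 (cos \o (fun t : R => pi * t)) (pi * - sin (pi * t)).
  apply: is_derive_eq; rewrite /GRing.scale /=; ring.
rewrite (_ : (fun _ => _) = (cst 1 - (cos \o (fun t : R => pi * t))) * cst 2^-1)//.
apply: is_derive_eq.
rewrite scaler0 add0r sub0r /cst /GRing.scale /= /ramp'; ring.
Qed.

Lemma ramp'_le t : `|ramp' t| <= pi.
Proof.
rewrite /ramp' !normrM (ger0_norm (pi_ge0 R)).
have : `|sin (pi * t)| <= 1 by rewrite ler_norml sin_geN1 sin_le1.
rewrite (ger0_norm (_ : 0 <= 2^-1))//.
have := pi_ge0 R; have := normr_ge0 (sin (pi * t)); nra.
Qed.

Lemma ramp'_continuous : continuous ramp'.
Proof.
move=> t; apply: cvgM; last exact: cvg_cst.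
apply: cvgM; first exact: cvg_cst.
apply: (@continuous_comp _ _ _ (fun t : R => pi * t) sin); last exact: continuous_sin.
by apply: cvgM; [exact: cvg_cst|exact: cvg_id].
Qed.

Definition segment (u w : 'rV[R]_n) (t : R) : 'rV[R]_n := u + ramp t *: w.

Lemma segment_diff u w (t : R) : differentiable (segment u w) t /\
  forall v, 'd (segment u w) t v = (v * ramp' t) *: w.
Proof.
have dr : differentiable ramp t by apply/derivable1_diffP; have [] := is_derive_ramp t.
pose Z (t : R) : 'rV[R]_n := ramp t *: w.
have iZ : is_diff t Z (fun v => 'd ramp t v *: w).
  by apply: DiffDef; [exact: differentiableZl|exact: diffZl].
have E : segment u w = cst u + Z by apply/funext.
have [dS ES] := is_diffD (is_diff_cst u t) iZ.
rewrite E; split => // v; apply: (eq_trans (congr1 (fun h : R -> 'rV[R]_n => h v) ES)).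
rewrite /= fctE add0r; congr (_ *: _).
apply: (eq_trans (congr1 (fun h : R -> R => h v) (deriv1E _))).
  exact/derivable1_diffP.
by rewrite derive1E (@derive_val _ _ _ _ _ _ _ (is_derive_ramp t)).
Qed.

Lemma segment_continuous u w : continuous (segment u w).
Proof. by move=> t; apply: differentiable_continuous; have [] := segment_diff u w t. Qed.

Lemma segment_ball (u0 u v : 'rV[R]_n) rho t : `|u - u0| < rho -> `|v - u0| < rho ->
  `|segment u (v - u) t - u0| < rho.
Proof.
move=> hu hv; have /andP[r0 r1] := ramp_itv t.
have -> : segment u (v - u) t - u0 =
    (1 - ramp t) *: (u - u0) + ramp t *: (v - u0).
  by rewrite /segment !scalerBr scalerBl scalerBl !scale1r; 
    apply/rowP => k; rewrite !mxE; ring.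
move: (ramp t) r0 r1 => a a0 a1.
apply: le_lt_trans (ler_normD _ _) _; rewrite !normrZ !ger0_norm ?subr_ge0//.
have m_lt : Num.max `|u - u0| `|v - u0| < rho by rewrite gt_max hu.
apply: le_lt_trans m_lt.
have := le_max `|u - u0| `|u - u0| `|v - u0|; have := le_max `|v - u0| `|u - u0| `|v - u0|.
rewrite !lexx orbT /=; move: (Num.max _ _) => m hq hp.
have a1' : 0 <= 1 - a by rewrite subr_ge0.
have := ler_wpM2l a1' hp; have := ler_wpM2l a0 hq; lra.
Qed.

Lemma segment_chart_derive i j u w (t v : R) :
  (coord i @` dom i) (segment u w t) -> dom j (param i (segment u w t)) ->
  differentiable (fun t => coord j ((param i \o segment u w) t)) t /\
  'D_v (fun t => coord j ((param i \o segment u w) t)) t =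
    (v * ramp' t) *: 'D_w (coord j \o param i) (segment u w t).
Proof.
move=> ct jt; have [it ct'] := paramK ct.
have dT : differentiable (coord j \o param i) (segment u w t).
  by have := transition_differentiable it jt; rewrite ct'.
have [dS ES] := segment_diff u w t.
have dC : differentiable ((coord j \o param i) \o segment u w) t.
  exact: differentiable_comp.
split; first exact: dC.
apply: (eq_trans (deriveE v dC)).
apply: (eq_trans (congr1 (fun h : R -> 'rV[R]_n => h v) (diff_comp dS dT))).
rewrite (deriveE w dT) /comp ES.
first [exact: linearZZ | by rewrite linearZZ | by rewrite linearZ].
Qed.

Lemma C1_segment i u w : (forall t, (coord i @` dom i) (segment u w t)) ->
  C1_curve (param i \o segment u w).
Proof.
move=> hc; have cc : continuous (param i \o segment u w).
  move=> t; apply: continuous_comp; first exact: segment_continuous.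
  exact: param_continuous.
split => // j; split.
  by move=> t jt; have [] := segment_chart_derive 1 (hc t) jt.
move=> v t jt.
pose D (t : R) : 'rV[R]_n := (v * ramp' t) *: 'D_w (coord j \o param i) (segment u w t).
suff cD : {for t, continuous D}.
  refine (near_eq_for_continuous _ cD).
  near=> s; apply: esym; apply: (segment_chart_derive v (hc s) _).2.
  near: s; apply: open_nbhs_nbhs; split => //.
  exact: (@preimage_dom_open _ _ _ (param i \o segment u w)).
have cDw : {for t, continuous ('D_w (coord j \o param i) \o segment u w)}.
  apply: continuous_comp; first exact: segment_continuous.
  have [_ Dc] := @transition_smooth _ _ M i j 1%N.
  have [it ct'] := paramK (hc t).
  by apply: Dc; exists (param i (segment u w t)).
have cr : {for t, continuous (fun s => v * ramp' s)}.
  by apply: cvgM; [exact: cvg_cst|exact: ramp'_continuous].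
exact: (cvgZ cr cDw).
Unshelve. all: by end_near. Qed.

Lemma continuous_integrable01 (f : R -> R) : continuous f ->
  (lebesgue_measure : measure _ R).-integrable `[0, 1] (EFin \o f).
Proof.
move=> cf; apply: continuous_compact_integrable; first exact: segment_compact.
exact: continuous_subspaceT.
Qed.

Lemma arc_length_le c (B : R) : C1_curve c -> (forall t, speed c t <= B) ->
  arc_length c <= B.
Proof.
move=> hc hB; have cs := speed_continuous hc.
apply: le_trans (@le_Rintegral _ _ _ lebesgue_measure `[0, 1]%classic _ (cst B) _ _ _ _) _.
- exact: measurable_itv.
- exact: continuous_integrable01.
- apply: continuous_integrable01; exact: cst_continuous.
- by move=> t _ /=; exact: hB.
rewrite Rintegral_cst//= ?measurable_itv//.
by rewrite /= lebesgue_measure_itv /= lte_fin ltr01 oppr0 adde0 mulr1.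
Qed.

Lemma speed_segment i u w t (B : R) : (forall t, (coord i @` dom i) (segment u w t)) ->
  bilin (gram i (segment u w t)) w w <= B ^+ 2 -> 0 <= B ->
  speed (param i \o segment u w) t <= pi * B.
Proof.
move=> hc hB B0.
have [it et] := paramK (hc t).
rewrite (speedE (C1_segment hc) it).
have E : (fun s => coord i ((param i \o segment u w) s)) = segment u w.
  by apply/funext => s; exact: (paramK (hc s)).2.
have [dS ES] := segment_diff u w t.
have -> : 'D_(1 : R) (fun s => coord i ((param i \o segment u w) s)) t = ramp' t *: w.
  by rewrite E (deriveE (1 : R) dS) ES mul1r.
rewrite /comp et bilinZ.
have h : ramp' t ^+ 2 * bilin (gram i (segment u w t)) w w <= (pi * B) ^+ 2.
  apply: (@le_trans _ _ (ramp' t ^+ 2 * B ^+ 2)); first exact: (ler_wpM2l (sqr_ge0 _) hB).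
  have h1 : ramp' t ^+ 2 <= pi ^+ 2.
    rewrite -real_normK ?num_real//.
    by apply: lerXn2r; rewrite ?nnegrE ?pi_ge0//; exact: ramp'_le.
  by rewrite [leRHS]exprMn; exact: (ler_wpM2r (sqr_ge0 B) h1).
apply: le_trans (ler_wsqrtr h) _.
by rewrite sqrtr_sqr ger0_norm// mulr_ge0 ?pi_ge0.
Qed.

End Segments.

Section LocalCharts.
Context {R : realType} {n : nat} (M : riemannian_manifold R n).

Lemma nbhs_normball (V : normedModType R) (u0 : V) (P : V -> Prop) :
  (\forall u \near u0, P u) -> exists2 rho : R, 0 < rho & forall u, `|u - u0| < rho -> P u.
Proof.
move=> /nbhs_normP [rho r0 sub]; exists rho => // u hu.
by apply: sub; rewrite /ball_ /= distrC.
Qed.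

Lemma chart_box (x0 : M) (i := chart_at x0) (u0 := coord i x0) :
  exists rho b B : R, [/\ 0 < rho, 0 < b, 0 < B &
    forall u, `|u - u0| < rho -> (coord i @` dom i) u /\
      forall v, b * `|v| ^+ 2 <= bilin (gram i u) v v <= B * `|v| ^+ 2].
Proof.
have i0 : dom i x0 := chart_at_dom _.
have cu0 : (coord i @` dom i) u0 by exists x0.
have cg := gram_continuous i0.
have [B B0 hB] := gram_upper cg.
have [b b0 hb] := gram_lower cg (fun v => @gram_pos _ _ _ i _ v cu0).
have hc : \forall u \near u0, (coord i @` dom i) u.
  by apply: open_nbhs_nbhs; split => //; exact: codom_open.
have [r r0 hr] := nbhs_normball (filterI hc (filterI hB hb)).
exists r, b, B; split => // u /hr [cu [hBu hbu]]; split => // v.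
by rewrite hbu hBu.
Qed.

Lemma segment_path (x0 : M) (i := chart_at x0) (u0 := coord i x0) :
  exists rho C : R, [/\ 0 < rho, 0 < C &
    forall u v, `|u - u0| < rho -> `|v - u0| < rho -> 
      [/\ (coord i @` dom i) u, (coord i @` dom i) v &
      exists2 s, piecewise_C1 (param i u) (param i v) s & curve_length s <= C * `|v - u|]].
Proof.
have [rho [b [B [r0 b0 B0 H]]]] := chart_box x0.
exists rho, (pi * Num.sqrt B); split => //.
  by rewrite mulr_gt0 ?pi_gt0 ?sqrtr_gt0.
move=> u v hu hv; split; [exact: (H u hu).1|exact: (H v hv).1|].
have hseg t := H _ (segment_ball t hu hv).
have hc t := (hseg t).1.
have C1 := C1_segment hc.
exists [:: param i \o segment u (v - u)].
  split => //=; first by rewrite /segment ramp0 scale0r addr0.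
  by rewrite /segment ramp1 scale1r addrC subrK.
rewrite curve_length_cons curve_length_nil addr0.
apply: arc_length_le => // t; rewrite -mulrA; apply: speed_segment => //.
  rewrite exprMn sqr_sqrtr ?(ltW B0)//.
  by have [_ /(_ (v - u)) /andP[]] := hseg t.
Qed.

Lemma chart_nbhs (x0 : M) (rho : R) : 0 < rho ->
  \forall x \near x0, dom (chart_at x0) x /\
    `|coord (chart_at x0) x - coord (chart_at x0) x0| < rho.
Proof.
move=> r0; have i0 : dom (chart_at x0) x0 := chart_at_dom _.
apply: filterI; first by apply: open_nbhs_nbhs; split => //; exact: dom_open.
have := coord_continuous i0.
by move=> /cvgrPdist_lt /(_ _ r0); apply: filterS => x; rewrite distrC.
Qed.

Lemma local_path (x0 : M) :
  \forall x \near x0, exists s, piecewise_C1 x0 x s.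
Proof.
have [rho [C [r0 C0 H]]] := segment_path x0.
apply: filterS (chart_nbhs x0 r0) => x [ix hx].
have h0 : `|coord (chart_at x0) x0 - coord (chart_at x0) x0| < rho by rewrite subrr normr0.
have [_ _ [s ps _]] := H _ _ h0 hx.
by exists s; move: ps; rewrite !coordK//; exact: chart_at_dom.
Qed.

(** The set of points reachable from [x] is open by [local_path], and closed because local paths can
    be reversed. *)
Lemma path_connected : connected [set: M] -> forall x y : M, exists s, piecewise_C1 x y s.
Proof.
move=> hcon x.
pose P := [set y : M | exists s, piecewise_C1 x y s].
have oP : open P.
  rewrite openE => y [s ps]; rewrite /interior.
  apply: filterS (local_path y) => z [s' ps']; exists (s ++ s').
  exact: piecewise_C1_cat ps ps'.
have cP : closed P.
  move=> y /(_ _ (local_path y)) [z [[s ps] [s' ps']]].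
  have [s'' ps'' _] := piecewise_C1_rev ps'.
  by exists (s ++ s''); exact: piecewise_C1_cat ps ps''.
suff PT : P = setT by move=> y; have : P y by rewrite PT.
apply: hcon.
- by exists x, [::].
- by exists P => //; rewrite setTI.
- by exists P => //; rewrite setTI.
Qed.

Context (hcon : connected [set: M]).

Definition rdist_tri := rdist_triangle (path_connected hcon).

Lemma rdist_chart_lip (x0 : M) (i := chart_at x0) (u0 := coord i x0) :
  exists rho C : R, [/\ 0 < rho, 0 < C &
    forall u v, `|u - u0| < rho -> `|v - u0| < rho -> 
      [/\ (coord i @` dom i) u, (coord i @` dom i) v & 
         rdist (param i u) (param i v) <= C * `|v - u|]].
Proof.
have [rho [C [r0 C0 H]]] := segment_path x0.
exists rho, C; split => // u v hu hv; have [cu cv [s ps ls]] := H u v hu hv.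
by split => //; apply: le_trans (rdist_le ps) ls.
Qed.

Lemma rdist_near (x0 : M) (e : R) : 0 < e -> \forall x \near x0, rdist x0 x < e.
Proof.
move=> e0; have [rho [C [r0 C0 H]]] := rdist_chart_lip x0.
have r'0 : 0 < Num.min rho (e / C) by rewrite lt_min r0 divr_gt0.
apply: filterS (chart_nbhs x0 r'0) => x [ix].
rewrite lt_min => /andP[hx hx'].
have h0 : `|coord (chart_at x0) x0 - coord (chart_at x0) x0| < rho by rewrite subrr normr0.
have [_ _] := H _ _ h0 hx.
rewrite !coordK//; last exact: chart_at_dom.
move=> /le_lt_trans; apply.
by rewrite mulrC -ltr_pdivlMr.
Qed.

End LocalCharts.

(** * Positivity of the distance between distinct points *)

Section PositiveDistance.
Context {R : realType} {n : nat} (M : riemannian_manifold R n).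

(** The squared positive part is of class C^1, also at 0, so that [bump] stays C^1 along curves that
    cross the edge of its support. *)
Definition psq (s : R) : R := (Num.max 0 s) ^+ 2.

Lemma is_derive_psq (s : R) : is_derive s (1 : R) psq (2 * Num.max 0 s).
Proof.
have [s0|s0|s0] := ltgtP s 0.
- have e : \forall t \near s, cst 0 t = psq t.
    near=> t; rewrite /psq max_l ?expr0n//; apply: ltW; near: t.
    exact: lt_nbhsl.
  rewrite mulr0; split.
    by apply: near_eq_derivable e _; exact: derivable_cst.
  by rewrite -(near_eq_derive _ e) derive_cst.
- have e : \forall t \near s, (fun t : R => t ^+ 2) t = psq t.
    near=> t; rewrite /psq max_r//; apply: ltW; near: t.
    exact: lt_nbhsr.
  have d : is_derive s (1 : R) (fun t : R => t ^+ 2) (2 * s).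
    rewrite (_ : (fun t : R => t ^+ 2) = (id : R -> R) ^+ 2)//.
    by apply: is_derive_eq; rewrite /GRing.scale /= mulr1 expr1 mulr_natl.
  split; first by apply: near_eq_derivable e _; have [] := d.
  by rewrite -(near_eq_derive _ e); have [] := d.
- rewrite s0 mulr0.

  have lim : (fun h : R => h^-1 *: ((psq \o shift 0) (h *: (1 : R)) - psq 0)) @ (0 : R)^' --> (0 : R).
    apply/cvgrPdist_lt => e e0; near=> h.
    have h0 : h != 0 by near: h; exact: nbhs_dnbhs_neq.
    have he : `|h| < e.
      near: h; apply: dnbhs0_lt => //.
    rewrite sub0r normrN /= addr0 /GRing.scale /= mulr1 /psq maxxx expr0n subr0 normrM normfV.
    rewrite mulrC ltr_pdivrMr ?normr_gt0//.
    apply: (@le_lt_trans _ _ (`|h| ^+ 2)).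
      rewrite normrX; apply: lerXn2r; rewrite ?nnegrE ?normr_ge0//.
      by rewrite ger0_norm ?le_max ?lexx// ge_max normr_ge0 ler_norm.
    by rewrite expr2 ltr_pM2r ?normr_gt0.
  split; first by apply/cvg_ex; exists 0.
  exact: cvg_lim lim.
Unshelve. all: by end_near. Qed.

(** The sum of squares replaces the norm of ['rV[R]_n], which is a maximum and not
    differentiable. *)
Definition bump (i : chart M) (u0 : 'rV[R]_n) (rho : R) (z : M) : R :=
  if `[< dom i z >] then psq (rho ^+ 2 - \sum_k (coord i z 0 k - u0 0 k) ^+ 2) else 0.

Lemma is_derive_entry (w : R -> 'rV[R]_n) (t : R) k : differentiable w t ->
  is_derive t (1 : R) (fun s => w s 0 k) ('D_1 w t 0 k).
Proof.
move=> dw.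
have dw1 : derivable w t 1 by apply/derivable1_diffP.
have /derivable_mxP dk := dw1.
split; first exact: dk.
by rewrite derive_mx// mxE.
Qed.

Section BumpAlongCurve.
Variables (i : chart M) (u0 : 'rV[R]_n) (rho b : R).
Let q (u : 'rV[R]_n) := \sum_k (u 0 k - u0 0 k) ^+ 2.
Hypothesis rho0 : 0 < rho.
Hypothesis b0 : 0 < b.
Hypothesis closedK : closed (param i @` [set u | q u <= rho ^+ 2]).
Hypothesis discK : forall u, q u <= rho ^+ 2 -> (coord i @` dom i) u.
Hypothesis discb : forall u v, q u <= rho ^+ 2 ->
  b * `|v| ^+ 2 <= bilin (gram i u) v v.
Variables (c : R -> M) (hc : C1_curve c).
Let w (t : R) := coord i (c t).

Definition bump' (t : R) : R :=
  if `[< dom i (c t) >] then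
    2 * Num.max 0 (rho ^+ 2 - q (w t)) *
      - (\sum_k 2 * (w t 0 k - u0 0 k) * ('D_1 w t) 0 k) else 0.

Lemma near_dom t : dom i (c t) -> \forall s \near t, dom i (c s).
Proof.
move=> it; apply: (@open_nbhs_nbhs _ t (c @^-1` dom i)); split => //.
exact: preimage_dom_open hc.1.
Qed.

(** A point outside the chart domain lies in the open complement of the image of the closed disc,
    where both functions vanish: extending [bump] by 0 creates no jump at the boundary of the
    domain. *)
Lemma near_bump0 t : ~ dom i (c t) ->
  \forall s \near t, bump i u0 rho (c s) = 0 /\ bump' s = 0.
Proof.
move=> nit.
have : \forall s \near t, (~` (param i @` [set u | q u <= rho ^+ 2])) (c s).
  apply: (@open_nbhs_nbhs _ t (c @^-1` _)); split.
    by apply: open_comp => [s _|]; [exact: hc.1|exact: closed_openC].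
  by move=> [u /= /discK cu e]; apply: nit; rewrite -e; exact: (paramK cu).1.
apply: filterS => s nK; rewrite /bump /bump'.
case: asboolP => // si.
have : rho ^+ 2 - q (w s) <= 0.
  rewrite subr_le0 leNgt; apply/negP => h; apply: nK.
  by exists (w s) => /=; [exact: ltW|rewrite /w coordK].
by move=> h; rewrite -/(w s) -/(q (w s)) /psq max_l// expr0n mulr0 mul0r.
Qed.

Lemma is_derive_bump t : is_derive t (1 : R) (bump i u0 rho \o c) (bump' t).
Proof.
have [it|nit] := pselect (dom i (c t)); last first.
  have h0 := near_bump0 nit.
  have e : \forall s \near t, cst 0 s = (bump i u0 rho \o c) s.
    by apply: filterS h0 => s [hs _]; rewrite /= hs.
  have [_ bt] := nbhs_singleton h0; rewrite bt.
  split; first by apply: near_eq_derivable e _; exact: derivable_cst.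
  by rewrite -(near_eq_derive _ e) derive_cst.
have dw : differentiable w t by have [dwi _] := hc.2 i; exact: dwi.
pose g (s : R) : R := rho ^+ 2 - \sum_k (w s 0 k - u0 0 k) ^+ 2.
pose h (k : 'I_n) (s : R) : R := (w s 0 k - u0 0 k) ^+ 2.
have dh k : is_derive t (1 : R) (h k) (2 * (w t 0 k - u0 0 k) * ('D_1 w t) 0 k).
  have de := is_derive_entry k dw.
  rewrite (_ : h k = ((fun s => w s 0 k) - cst (u0 0 k)) ^+ 2)//.
  by apply: is_derive_eq; rewrite subr0 /GRing.scale /= expr1.
have dg : is_derive t (1 : R) g (- \sum_k 2 * (w t 0 k - u0 0 k) * ('D_1 w t) 0 k).
  have ds := is_derive_sum dh.
  rewrite (_ : g = cst (rho ^+ 2) - \sum_k h k); last first.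
    by apply/funext => s; rewrite /g fctE fct_sumE.
  by apply: is_derive_eq; rewrite sub0r.
have dp := is_derive1_comp (is_derive_psq (g t)) dg.
have e : \forall s \near t, (psq \o g) s = (bump i u0 rho \o c) s.
  by apply: filterS (near_dom it) => s si; rewrite /= /bump; case: asboolP.
have -> : bump' t = 2 * Num.max 0 (g t) * - (\sum_k 2 * (w t 0 k - u0 0 k) * ('D_1 w t) 0 k).
  by rewrite /bump'; case: asboolP.
split; first by apply: near_eq_derivable e _; have [] := dp.
by rewrite -(near_eq_derive _ e); have [] := dp.
Qed.

Lemma bump'_continuous : continuous bump'.
Proof.
move=> t; have [it|nit] := pselect (dom i (c t)); last first.
  apply: (@near_eq_for_continuous _ _ (cst 0)); last exact: cvg_cst.
  by apply: filterS (near_bump0 nit) => s [_ hs]; rewrite hs.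
pose F s := 2 * Num.max 0 (rho ^+ 2 - q (w s)) *
      - (\sum_k 2 * (w s 0 k - u0 0 k) * ('D_1 w s) 0 k).
apply: (@near_eq_for_continuous _ _ F).
  by apply: filterS (near_dom it) => s si; rewrite /bump'; case: asboolP.
have [dwi cD] := hc.2 i.
have cw : {for t, continuous w} by apply: differentiable_continuous; exact: dwi.
pose DW (s : R) : 'rV[R]_n := 'D_1 w s.
have cDW : {for t, continuous DW} by exact: cD.
have cDk k : {for t, continuous (fun s => DW s 0 k)} by exact: mx_entry_continuous.
have ce k : {for t, continuous (fun s => w s 0 k - u0 0 k)}.
  by apply: cvgB; [exact: mx_entry_continuous|exact: cvg_cst].
apply: cvgM.
  apply: cvgM; first exact: cvg_cst.
  apply: (@continuous_comp _ _ _ (fun s => rho ^+ 2 - q (w s)) (fun x : R => Num.max 0 x)).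
    apply: cvgB; first exact: cvg_cst.
    by apply: for_continuous_sum => k _; apply: cvgM; exact: ce.
  by apply: continuous_max; [exact: cvg_cst|exact: cvg_id].
apply: cvgN; apply: for_continuous_sum => k _; apply: cvgM.
  by apply: cvgM; [exact: cvg_cst|exact: ce].
exact: cDk.
Qed.

(** The derivative of [psq] contributes at most [2 * rho ^+ 2]; each of the [n] coordinates
    contributes a displacement at most [rho], with a factor 2, and a velocity at most
    [speed c t / Num.sqrt b]. *)
Lemma bump'_le t : `|bump' t| <= (4 * rho ^+ 3 * n%:R / Num.sqrt b) * speed c t.
Proof.
have sb : 0 < Num.sqrt b by rewrite sqrtr_gt0.
have r0 := ltW rho0.
have rhs0 : 0 <= (4 * rho ^+ 3 * n%:R / Num.sqrt b) * speed c t.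
  by rewrite !mulr_ge0 ?speed_ge0 ?invr_ge0 ?(ltW sb) ?exprn_ge0.
rewrite /bump'; case: asboolP => [it|_]; last by rewrite normr0.
have [q0|q0] := lerP (rho ^+ 2 - q (w t)) 0; first by rewrite mulr0 mul0r normr0.
have qr : q (w t) < rho ^+ 2 by rewrite -subr_gt0.
have qk k : `|w t 0 k - u0 0 k| <= rho.
  rewrite -(ger0_norm r0) -ler_sqr ?nnegrE// !real_normK ?num_real//.
  apply: le_trans (ltW qr); rewrite /q (bigD1 k)//= lerDl.
  by apply: sumr_ge0 => j _; exact: sqr_ge0.
have q_ge0 : 0 <= q (w t) by apply: sumr_ge0 => k _; exact: sqr_ge0.
have Dk k : `|('D_1 w t) 0 k| <= speed c t / Num.sqrt b.
  apply: le_trans (rV_entry_le _ _) _.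
  rewrite ler_pdivlMr// (speedE hc it) -/w -[X in X * _]ger0_norm// -sqrtr_sqr -sqrtrM ?sqr_ge0//.
  by apply: ler_wsqrtr; rewrite mulrC; exact: (discb _ (ltW qr)).
rewrite !normrM normrN (ger0_norm (ler0n _ 2)) (ger0_norm (ltW q0)).
have S : `|\sum_k 2 * (w t 0 k - u0 0 k) * ('D_1 w t) 0 k| <= n%:R * (2 * rho * (speed c t / Num.sqrt b)).
  apply: le_trans (ler_norm_sum _ _ _) _.
  apply: (@le_trans _ _ (\sum_(k < n) 2 * rho * (speed c t / Num.sqrt b))).
    apply: ler_sum => k _; rewrite !normrM (ger0_norm (ler0n _ 2)).
    by apply: ler_pM => //; rewrite ler_pM2l.
  by rewrite sumr_const card_ord [leRHS]mulr_natl.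
have d0 : 0 <= speed c t / Num.sqrt b by rewrite divr_ge0 ?speed_ge0 ?ltW.
have -> : 4 * rho ^+ 3 * n%:R / Num.sqrt b * speed c t =
    (2 * rho ^+ 2) * (n%:R * (2 * rho * (speed c t / Num.sqrt b))) by ring.
apply: ler_pM => //; first by rewrite mulr_ge0// ltW.
by rewrite ler_pM2l// gerBl.
Qed.

Lemma bump_arc : `|bump i u0 rho (c 1) - bump i u0 rho (c 0)| <=
  (4 * rho ^+ 3 * n%:R / Num.sqrt b) * arc_length c.
Proof.
have cb := bump'_continuous.
have cf : continuous (bump i u0 rho \o c).
  move=> t; apply: differentiable_continuous; apply/derivable1_diffP.
  by have [] := is_derive_bump t.
have FTC : \int[lebesgue_measure]_(t in `[0, 1]) bump' t =
    bump i u0 rho (c 1) - bump i u0 rho (c 0).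
  have := @continuous_FTC2 R bump' (bump i u0 rho \o c) 0 1 ltr01.
  rewrite /Rintegral => -> //.
  - exact: continuous_subspaceT.
  - split.
    + by move=> t _; have [] := is_derive_bump t.
    + apply: cvg_at_right_filter; exact: cf.
    + apply: cvg_at_left_filter; exact: cf.
  - by move=> t _; rewrite derive1E; have [] := is_derive_bump t.
rewrite -FTC.
have ib := continuous_integrable01 cb.
have cs := speed_continuous hc.
set C := 4 * rho ^+ 3 * n%:R / Num.sqrt b.
have cCs : continuous (fun t => C * speed c t).
  by move=> t; apply: cvgM; [exact: cvg_cst|exact: cs].
have cab : continuous (fun t => `|bump' t|).
  by move=> t; apply: continuous_comp; [exact: cb|exact: norm_continuous].
have h1 : `|\int[lebesgue_measure]_(t in `[0, 1]) bump' t| <=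
    \int[lebesgue_measure]_(t in `[0, 1]) `|bump' t|.
  by apply: le_normr_Rintegral => //; exact: measurable_itv.
have h2 : \int[lebesgue_measure]_(t in `[0, 1]) `|bump' t| <=
    \int[lebesgue_measure]_(t in `[0, 1]) (C * speed c t).
  apply: le_Rintegral; [exact: measurable_itv|exact: continuous_integrable01|
    exact: continuous_integrable01|].
  by move=> t _; exact: bump'_le.
have h3 : \int[lebesgue_measure]_(t in `[0, 1]) (C * speed c t) = C * arc_length c.
  apply: RintegralZl; [exact: measurable_itv|exact: continuous_integrable01].
by apply: le_trans h1 _; rewrite -h3.
Qed.

End BumpAlongCurve.
Lemma rV_norm_le (v : 'rV[R]_n) (r : R) : 0 <= r -> (forall k, `|v 0 k| <= r) -> `|v| <= r.
Proof.
move=> r0 h; rewrite [leLHS]/Num.norm /= mx_normrE.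
by apply: bigmax_le => // -[a k] _ /=; rewrite (ord1 a).
Qed.

Lemma sqdist_disc_norm (u0 u : 'rV[R]_n) (r : R) : 0 <= r ->
  \sum_k (u 0 k - u0 0 k) ^+ 2 <= r ^+ 2 -> `|u - u0| <= r.
Proof.
move=> r0 h; apply: rV_norm_le => // k; rewrite !mxE.
rewrite -(ger0_norm r0) -ler_sqr ?nnegrE// !real_normK ?num_real//.
apply: le_trans h; rewrite (bigD1 k)//= lerDl.
by apply: sumr_ge0 => j _; exact: sqr_ge0.
Qed.

Lemma disc_compact (u0 : 'rV[R]_n) (r : R) : 0 <= r ->
  compact [set u : 'rV[R]_n | \sum_k (u 0 k - u0 0 k) ^+ 2 <= r ^+ 2].
Proof.
move=> r0; apply: bounded_closed_compact.
  exists (`|u0| + r); split; first exact: num_real.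
  move=> x hx u /= /(sqdist_disc_norm r0) hu.
  apply: ltW; apply: le_lt_trans hx; rewrite -[X in `|X|](subrK u0).
  by rewrite addrC; apply: le_trans (ler_normD _ _) _; rewrite lerD2l.
apply: (@closed_comp _ _ (fun u : 'rV[R]_n => \sum_k (u 0 k - u0 0 k) ^+ 2) [set x | x <= r ^+ 2]).
  move=> u _; apply: for_continuous_sum => k _.
  have ce : {for u, continuous (fun u : 'rV[R]_n => u 0 k - u0 0 k)}.
    have c1 : {for u, continuous (fun v : 'rV[R]_n => v 0 k : R)}.
      exact: matrix_normedtype.coord_continuous.
    exact: (cvgB c1 (cvg_cst _)).
  exact: (cvgM ce ce).
exact: closed_le.
Qed.

Lemma bump_path (i : chart M) (u0 : 'rV[R]_n) (rho b : R) : 0 < rho -> 0 < b ->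
  closed (param i @` [set u : 'rV[R]_n | \sum_k (u 0 k - u0 0 k) ^+ 2 <= rho ^+ 2]) ->
  (forall u : 'rV[R]_n, \sum_k (u 0 k - u0 0 k) ^+ 2 <= rho ^+ 2 -> (coord i @` dom i) u) ->
  (forall u v : 'rV[R]_n, \sum_k (u 0 k - u0 0 k) ^+ 2 <= rho ^+ 2 ->
    b * `|v| ^+ 2 <= bilin (gram i u) v v) ->
  forall s x y, piecewise_C1 x y s ->
  `|bump i u0 rho y - bump i u0 rho x| <= 4 * rho ^+ 3 * n%:R / Num.sqrt b * curve_length s.
Proof.
move=> r0 b0 cK dK db; elim => [x y ->|c s IH x y [hc <- /IH h]].
  by rewrite subrr normr0 curve_length_nil mulr0.
rewrite curve_length_cons mulrDr.
have := bump_arc r0 b0 cK dK db hc => hb.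
rewrite -[X in `|X|](subrKA (bump i u0 rho (c 1))) addrC.
apply: le_trans (ler_normD _ _) _.
by rewrite lerD// addrC.
Qed.

(** A bump at [x] that vanishes at [y] is Lipschitz with respect to length by [bump_path], so paths
    from [x] to [y] cannot be arbitrarily short. *)
Lemma rdist_eq0 (hcon : connected [set: M]) (x y : M) : rdist x y = 0 -> x = y.
Proof.
move=> d0; apply: contrapT => xy.
pose i := chart_at x; pose u0 := coord i x.
have ix : dom i x := chart_at_dom _.
have [r [b [B [r0 b0 B0 H]]]] := chart_box x.
pose q (u : 'rV[R]_n) := \sum_k (u 0 k - u0 0 k) ^+ 2.
have q_ge0 u : 0 <= q u by apply: sumr_ge0 => j _; exact: sqr_ge0.
(* [rho] is below [r] to keep the closed disc inside the region controlled by [chart_box], and small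
   enough to leave [y] outside the open disc. *)
have [rho [rho0 rhor hy]] : exists rho : R, [/\ 0 < rho, rho < r & dom i y -> rho ^+ 2 <= q (coord i y)].
  have r20 : 0 < r / 2 by rewrite divr_gt0.
  have r2r : r / 2 < r by rewrite ltr_pdivrMr// ltr_pMr// ltrDl.
  have [iy|niy] := pselect (dom i y); last by exists (r / 2); split.
  have qy : 0 < q (coord i y).
    rewrite lt_neqAle q_ge0 andbT eq_sym; apply/eqP => q0; apply: xy.
    have : `|coord i y - u0| <= 0 by apply: sqdist_disc_norm => //; rewrite -/(q _) q0 expr0n.
    rewrite normr_le0 subr_eq0 => /eqP e.
    by rewrite -(coordK ix) -(coordK iy) e.
  exists (Num.min (r / 2) (Num.sqrt (q (coord i y)))); split.
  - by rewrite lt_min r20 sqrtr_gt0.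
  - by rewrite gt_min r2r.
  - move=> _; rewrite -[leRHS]sqr_sqrtr// lerXn2r ?nnegrE ?sqrtr_ge0//.
      by rewrite le_min sqrtr_ge0 ltW.
    by rewrite ge_min lexx orbT.
have disc u : q u <= rho ^+ 2 -> `|u - u0| < r.
  by move=> /(sqdist_disc_norm (ltW rho0)) h; exact: le_lt_trans h rhor.
have dK u : q u <= rho ^+ 2 -> (coord i @` dom i) u by move=> /disc /H[].
have db u v : q u <= rho ^+ 2 -> b * `|v| ^+ 2 <= bilin (gram i u) v v.
  by move=> /disc /H[_ /(_ v) /andP[]].
have cK : closed (param i @` [set u | q u <= rho ^+ 2]).
  apply: compact_closed; first exact: rm_hausdorff.
  apply: continuous_compact; last exact: disc_compact (ltW rho0).
  apply/subspace_continuousP => u /dK cu.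
  by apply: cvg_within_filter; exact: param_continuous.
have bx : bump i u0 rho x = rho ^+ 4.
  rewrite /bump; case: asboolP => // _.
  rewrite big1 ?subr0; last by move=> k _; rewrite subrr expr0n.
  by rewrite /psq max_r ?exprn_ge0 ?ltW// -exprM.
have by0 : bump i u0 rho y = 0.
  rewrite /bump; case: asboolP => // /hy hq.
  by rewrite /psq max_l ?expr0n// subr_le0.
pose C := 4 * rho ^+ 3 * n%:R / Num.sqrt b.
have C0 : 0 <= C.
  by rewrite !mulr_ge0 ?invr_ge0 ?sqrtr_ge0 ?exprn_ge0 ?(ltW rho0).
have r4 : 0 < rho ^+ 4 by rewrite exprn_gt0.
(* [C + 1] rather than [C], which is 0 when [n] is 0. *)
have e0 : 0 < rho ^+ 4 / (C + 1) by rewrite divr_gt0// ltr_wpDl.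
have [s ps] := rdist_adherent (path_connected hcon) x y e0.
rewrite d0 add0r => ls.
have := bump_path rho0 b0 cK dK db ps.
rewrite bx by0 sub0r normrN ger0_norm ?(ltW r4)// -/C => h.
have : C * curve_length s <= C * (rho ^+ 4 / (C + 1)) by rewrite ler_wpM2l// ltW.
move=> /(le_trans h); rewrite mulrA ler_pdivlMr ?ltr_wpDl// mulrDr mulr1 mulrC.
by rewrite gerDl leNgt r4.
Qed.

End PositiveDistance.

(** * Coverings and bi-Hoelder homeomorphisms *)

(** The sets whose complement satisfies [P] form a filter, proper if [P] fails on the whole space; a
    cluster point of it contradicts the local hypothesis at that point. *)
Lemma compact_ind (T : topologicalType) (P : set T -> Prop) :
  P set0 -> (forall A B, P A -> P B -> P (A `|` B)) ->
  (forall A B, A `<=` B -> P B -> P A) ->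
  (forall x : T, exists2 U : set T, nbhs x U & P U) -> compact [set: T] -> P [set: T].
Proof.
move=> P0 PU Psub Ploc cT; apply: contrapT => nPT.
pose F : set_system T := [set A | P (~` A)].
have FF : ProperFilter F.
  apply: Build_ProperFilter_ex.
    move=> A PA; apply: contrapT => nA; apply: nPT; apply: Psub PA.
    by move=> x _ Ax; apply: nA; exists x.
  split; first by rewrite /F /= setCT.
  - by move=> A B PA PB; rewrite /F /= setCI; exact: PU.
  - by move=> A B AB; apply: Psub; exact: subsetC.
have [x [_ cx]] := cT F FF filterT.
have [U nU PU'] := Ploc x.
have FU : F (~` U) by rewrite /F /= setCK.
by have [y []] := cx _ _ FU nU.
Qed.

Section MetricTopology.
Context {R : realType} {n : nat} (M : riemannian_manifold R n).
Hypotheses (hcpt : compact [set: M]) (hcon : connected [set: M]).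
Local Notation d := (@rdist R n M).

Lemma rdist_dist_le (x y z : M) : `|d x y - d x z| <= d y z.
Proof.
have h1 := rdist_tri hcon x z y; have h2 := rdist_tri hcon x y z.
rewrite (rdistC z y) in h1; rewrite ler_norml; apply/andP; split; lra.
Qed.

Lemma rdist_continuous (x : M) : continuous (d x : M -> R).
Proof.
move=> y; apply/cvgrPdist_lt => e e0.
have := rdist_near y e0; apply: filterS => z; apply: le_lt_trans; exact: rdist_dist_le.
Qed.

Lemma rdist_gt0 (x y : M) : x <> y -> 0 < d x y.
Proof.
move=> xy; rewrite lt_neqAle rdist_ge0 andbT eq_sym; apply/eqP => /(rdist_eq0 hcon).
exact: xy.
Qed.

(** The continuous function [d x] is positive on the compact complement of an open neighbourhood of
    [x], hence bounded below there: with [rdist_near], [d] induces the given topology. *)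
Lemma nbhs_rdist (x : M) (U : set M) : nbhs x U ->
  exists2 r : R, 0 < r & forall y, d x y < r -> U y.
Proof.
rewrite nbhsE => -[V [oV Vx] VU].
have cC : compact (~` V) by apply: subclosed_compact hcpt _ => //; exact: open_closedC.
have /compact_near_coveringP := cC.
move=> /(_ R (0^'+) (fun r y => r < d x y) _) [].
  move=> y nVy; have d0 : 0 < d x y by apply: rdist_gt0 => e; apply: nVy; rewrite -e.
  have d20 : 0 < d x y / 2 by rewrite divr_gt0.
  exists ([set z | d x y / 2 < d x z], [set r | r < d x y / 2]) => /=.
    split; last exact: nbhs_right_lt.
    by apply: (cvgr_gt (d x y) (@rdist_continuous x y)); rewrite ltr_pdivrMr// ltr_pMr// ltrDl.
  by move=> [z r] /= [h1 h2]; exact: lt_trans h2 h1.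
move=> r /= r0 hr.
exists (r / 2); first by rewrite divr_gt0.
move=> y hy; apply: VU; apply: contrapT => nVy.
have := hr (r / 2); rewrite /ball_ /= sub0r normrN ger0_norm ?divr_ge0 ?ltW//.
rewrite ltr_pdivrMr// ltr_pMr// ltrDl ltr01 divr_gt0// => /(_ isT isT y nVy).
by move=> /(lt_trans hy); rewrite ltxx.
Qed.

(** Stated for a pseudometric [rho], so that one Lebesgue number argument serves both real functions
    and homeomorphisms. *)
Lemma uniform_continuity (rho : M -> M -> R) :
  (forall x y, rho x y = rho y x) -> (forall x y z, rho x z <= rho x y + rho y z) ->
  (forall x (e : R), 0 < e -> \forall y \near x, rho x y < e) ->
  forall e : R, 0 < e -> exists2 r : R, 0 < r & forall x y, d x y < r -> rho x y < e.
Proof.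
move=> rC rT rN e e0.
have /compact_near_coveringP := hcpt.
move=> /(_ R (0^'+) (fun r x => forall y, d x y < r -> rho x y < e) _) [].
  move=> x _; have e20 : 0 < e / 2 by rewrite divr_gt0.
  have [s s0 hs] := nbhs_rdist (rN x _ e20).
  have s20 : 0 < s / 2 by rewrite divr_gt0.
  exists ([set z | d x z < s / 2], [set r | r < s / 2]) => /=.
    by split; [exact: rdist_near|exact: nbhs_right_lt].
  move=> [z r] /= [h1 h2] y h3.
  have h4 : rho x z < e / 2 by apply: hs; lra.
  have h5 : rho x y < e / 2.
    apply: hs; have := rdist_tri hcon x z y; lra.
  have := rT z x y; rewrite (rC z x); lra.
move=> r /= r0 hr; exists (r / 2); first by rewrite divr_gt0.
move=> x y hy.
have := hr (r / 2); rewrite /ball_ /= sub0r normrN ger0_norm ?divr_ge0 ?ltW//.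
rewrite ltr_pdivrMr// ltr_pMr// ltrDl ltr01 divr_gt0// => /(_ isT isT x I y).
exact.
Qed.

Lemma continuous_unif (phi : M -> R) : continuous phi ->
  forall e : R, 0 < e -> exists2 r : R, 0 < r & forall x y, d x y < r -> `|phi x - phi y| < e.
Proof.
move=> cphi; apply: (@uniform_continuity (fun x y => `|phi x - phi y|)).
- by move=> x y; rewrite distrC.
- by move=> x y z; rewrite -[X in `|X| <= _](subrKA (phi y)) ler_normD.
- by move=> x e e0; have /cvgrPdist_lt := cphi x; exact.
Qed.

Lemma homeo_unif (f : homeo M) :
  forall e : R, 0 < e -> exists2 r : R, 0 < r & forall x y, d x y < r -> d (f x) (f y) < e.
Proof.
apply: (@uniform_continuity (fun x y => d (f x) (f y))).
- by move=> x y; rewrite rdistC.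
- by move=> x y z; exact: rdist_tri.
- by move=> x e e0; have := @homeo_cont _ _ _ f x _ (rdist_near (f x) e0).
Qed.

Lemma continuous_bounded_above (phi : M -> R) : continuous phi ->
  exists2 b : R, 0 < b & forall x, phi x <= b.
Proof.
move=> cphi.
suff [b b0 hb] : exists2 b : R, 0 < b & forall x, [set: M] x -> phi x <= b.
  by exists b => // x; exact: hb.
apply: (@compact_ind _ (fun A => exists2 b : R, 0 < b & forall x, A x -> phi x <= b) _ _ _ _ hcpt).
- by exists 1.
- move=> A B [a a0 hA] [b b0 hB]; exists (Num.max a b); first by rewrite lt_max a0.
  by move=> x [/hA h|/hB h]; rewrite le_max h ?orbT.
- by move=> A B AB [b b0 hb]; exists b => // x /AB /hb.
move=> x; exists [set y | phi y < phi x + 1].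
  by apply: (cvgr_lt (phi x) (cphi x)); rewrite ltrDl.
by exists (`|phi x| + 1); [rewrite ltr_wpDl|move=> y /= /ltW h; apply: le_trans h _; rewrite lerD2r ler_norm].
Qed.

Lemma rdist_bounded : exists2 D : R, 0 < D & forall x y : M, d x y <= D.
Proof.
have [b b0 hb] := continuous_bounded_above (@rdist_continuous (point : M)).
exists (b + b); first by rewrite addr_gt0.
move=> x y; apply: le_trans (rdist_tri hcon x point y) _.
by rewrite rdistC lerD.
Qed.

Lemma continuous_bounded (phi : M -> R) : continuous phi ->
  exists2 b : R, 0 < b & forall x, `|phi x| <= b.
Proof.
move=> cphi; apply: (@continuous_bounded_above (fun x => `|phi x|)) => x.
by apply: continuous_comp; [exact: cphi|exact: norm_continuous].
Qed.

Definition covering_bound (A : set M) (C : R) := forall r : R, 0 < r -> r <= 1 ->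
  exists (N : nat) (z : nat -> M), N%:R <= C * r^-1 ^+ n /\
    forall x, A x -> exists2 k, (k < N)%N & d x (z k) < r.

Lemma covering_boundU (A B : set M) (a b : R) :
  covering_bound A a -> covering_bound B b -> covering_bound (A `|` B) (a + b).
Proof.
move=> hA hB r r0 r1; have [N [z [hN hz]]] := hA r r0 r1.
have [N' [z' [hN' hz']]] := hB r r0 r1.
exists (N + N')%N, (fun k => if (k < N)%N then z k else z' (k - N)%N).
split; first by rewrite natrD mulrDl lerD.
move=> x [/hz [k kN dk]|/hz' [k kN dk]].
  by exists k; [exact: ltn_addr|rewrite kN].
exists (N + k)%N; first by rewrite ltn_add2l.
by rewrite ltnNge leq_addr /= addKn.
Qed.

(** The grid consists of the centres of [m] equal cells; centres, unlike end points, all lie in the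
    open interval, as the chart requires. *)
Lemma grid_point (rho t : R) (m : nat) : 0 < rho -> `|t| < rho -> (0 < m)%N ->
  exists a : 'I_m, `|t - ((a%:R + 2^-1) * (2 * rho / m%:R) - rho)| <= 2 * rho / m%:R.
Proof.
move=> r0; rewrite ltr_norml => /andP[t1 t2] m0.
have m0' : 0 < m%:R :> R by rewrite ltr0n.
have h0 : 0 < 2 * rho / m%:R by rewrite divr_gt0// mulr_gt0.
set h := 2 * rho / m%:R in h0 *.
have e : h * m%:R = 2 * rho by rewrite /h divfK// gt_eqF.
pose s := (t + rho) / h.
have s0 : 0 <= s by rewrite divr_ge0//; [lra|exact: ltW].
have sm : s < m%:R by rewrite ltr_pdivrMr// mulrC e; lra.
have /andP[a1 a2] := truncn_itv s0.
have am : (Num.truncn s < m)%N by rewrite -(ltr_nat R); exact: le_lt_trans a1 sm.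
exists (Ordinal am) => /=.
move: (Num.truncn s) a1 a2 => a a1 a2.
have es : t = s * h - rho by rewrite /s divfK ?gt_eqF//; lra.
rewrite es.
have -> : s * h - rho - ((a%:R + 2^-1) * h - rho) = (s - a%:R - 2^-1) * h by ring.
rewrite normrM (gtr0_norm h0); apply: ler_piMl; [exact: ltW|rewrite ler_norml].
move: a2; rewrite -natr1 => a2; apply/andP; split; lra.
Qed.

Lemma grid_bound (rho : R) (m : nat) (a : 'I_m) : 0 < rho -> (0 < m)%N ->
  `|(a%:R + 2^-1) * (2 * rho / m%:R) - rho| < rho.
Proof.
move=> r0 m0; have m0' : 0 < m%:R :> R by rewrite ltr0n.
have am : a%:R + 1 <= m%:R :> R by rewrite natr1 ler_nat.
have -> : (a%:R + 2^-1) * (2 * rho / m%:R) - rho = ((2 * a%:R + 1) / m%:R - 1) * rho by field; rewrite gt_eqF.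
rewrite normrM (gtr0_norm r0) gtr_pMl// ltr_norml.
have a0 : 0 <= a%:R :> R by [].
rewrite ltrBDr -[X in X < _](_ : 0 = - 1 + 1)// ?addNr// ltr_pdivlMr// mul0r.
by rewrite ltrBlDr ltr_pdivrMr//; apply/andP; split; lra.
Qed.

Lemma covering_bound_loc (x0 : M) : exists2 U : set M, nbhs x0 U & exists C : R, covering_bound U C.
Proof.
have [rho [C [r0 C0 H]]] := rdist_chart_lip x0.
exists [set x | dom (chart_at x0) x /\ `|coord (chart_at x0) x - coord (chart_at x0) x0| < rho].
  exact: chart_nbhs.
set i := chart_at x0 in H *; set u0 := coord i x0 in H *.
exists ((2 * rho * C + 1) ^+ n) => r rr0 r1.
(* With [m] cells per axis, the cell width [2 * rho / m] times the Lipschitz constant [C] is below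
   [r]; [r <= 1] absorbs the rounding into the constant. *)
pose m := (Num.truncn (2 * rho * C / r)).+1.
have m1 : 2 * rho * C / r < m%:R by apply: truncnS_gt.
have m0 : 0 < m%:R :> R by rewrite ltr0n.
have m2 : m%:R <= (2 * rho * C + 1) * r^-1.
  have s0 : 0 <= 2 * rho * C / r by rewrite divr_ge0 ?ltW// !mulr_gt0.
  have /andP[tr _] := truncn_itv s0.
  have -> : m%:R = (Num.truncn (2 * rho * C / r))%:R + 1 :> R by rewrite natr1.
  by rewrite [leRHS]mulrDl mul1r; apply: lerD => //; rewrite invf_ge1.
pose T := {ffun 'I_n -> 'I_m}.
pose c (a : T) : 'rV[R]_n := u0 + \row_k (((a k)%:R + 2^-1) * (2 * rho / m%:R) - rho).
pose a0 : T := [ffun=> ord0].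
exists (m ^ n)%N, (fun k => param i (c (nth a0 (enum T) k))); split.
  by rewrite natrX -exprMn; apply: lerXn2r; rewrite ?nnegrE// ?ltW// mulr_gt0 ?invr_gt0// ltr_wpDl// !mulr_ge0// ltW.
move=> x [ix hx].
have hg k : exists a : 'I_m, `|(coord i x - u0) 0 k - ((a%:R + 2^-1) * (2 * rho / m%:R) - rho)| <= 2 * rho / m%:R.
  by apply: grid_point => //; apply: le_lt_trans (rV_entry_le _ _) hx.
have [g hg'] := choice hg.
pose a : T := [ffun k => g k].
exists (index a (enum T)).
  have -> : (m ^ n = #|T|)%N by rewrite card_ffun !card_ord.
  by rewrite cardE index_mem mem_enum.
rewrite nth_index ?mem_enum//.
have hc : `|c a - u0| < rho.
  rewrite /c addrC addKr [ltLHS]/Num.norm /= mx_normrE; apply: bigmax_lt => // -[b k] _ /=.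
  by rewrite !mxE; exact: grid_bound.
have [_ _] := H _ _ hc hx.
rewrite coordK// rdistC => /le_lt_trans; apply.
have hcx : `|coord i x - c a| <= 2 * rho / m%:R.
  apply: rV_norm_le; first by rewrite divr_ge0// mulr_ge0// ltW.
  move=> k; have := hg' k; rewrite /c !mxE !ffunE.
  by congr (`|_| <= _); ring.
apply: (@le_lt_trans _ _ (C * (2 * rho / m%:R))); first by rewrite ler_pM2l.
move: m1; rewrite ltr_pdivrMr// => m1.
by rewrite mulrA ltr_pdivrMr// mulrC (mulrC r) mulrC [ltLHS]mulrC.
Qed.

Lemma covering : exists2 C : R, 0 < C & covering_bound [set: M] C.
Proof.
have [C hC] : exists C, covering_bound [set: M] C.
  apply: (@compact_ind _ (fun A => exists C, covering_bound A C)) => //.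
  - by exists 0 => r r0 r1; exists 0%N, (fun=> point); rewrite mul0r; split.
  - by move=> A B [a hA] [b hB]; exists (a + b); exact: covering_boundU.
  - move=> A B AB [b hB]; exists b => r r0 r1; have [N [z [hN hz]]] := hB r r0 r1.
    by exists N, z; split => // x /AB /hz.
  exact: covering_bound_loc.
exists (`|C| + 1); first by rewrite ltr_wpDl.
move=> r r0 r1; have [N [z [hN hz]]] := hC r r0 r1; exists N, z; split => //.
apply: le_trans hN _; apply: ler_wpM2r; first by rewrite exprn_ge0 ?invr_ge0 ?ltW.
by apply: le_trans (ler_norm _) _; rewrite lerDl.
Qed.

(** A chart into row vectors of length 0 has a one-point domain, which is open, and closed because
    [M] is Hausdorff; connectedness concludes. *)
Lemma dim0_one_point : n = 0%N -> forall x y : M, x = y.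
Proof.
move=> n0 x y.
have uv (u v : 'rV[R]_n) : u = v by apply/rowP => k; have := ltn_ord k; rewrite {2}n0.
have dx z : dom (chart_at x) z -> z = x.
  move=> iz; have ix : dom (chart_at x) x := chart_at_dom _.
  by rewrite -(coordK ix) -(coordK iz); congr (param _ _); exact: uv.
have e : dom (chart_at x) = [set x].
  by apply/seteqP; split => [z /dx //|z ->]; exact: chart_at_dom.
suff : [set x] = [set: M] by move=> h; apply/esym; have : [set x] y by rewrite h.
apply: hcon.
- by exists x.
- by exists [set x]; [rewrite -e; exact: dom_open|rewrite setTI].
- exists [set x]; last by rewrite setTI.
  by apply: accessible_closed_set1; apply: hausdorff_accessible; exact: rm_hausdorff.
Qed.

(** Along a coordinate segment cut into [N] equal pieces, images of neighbours are [O(N^-2)] apart,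
    so the end points have images [O(1/N)] apart: an injective [f] cannot do this in positive
    dimension. This bounds the Hoelder exponents and keeps [holder_exp] finite. *)
Lemma square_holder_one_point (f : M -> M) (H : R) : injective f -> 
  (forall x y, d (f x) (f y) <= H * d x y ^+ 2) -> forall x y : M, x = y.
Proof.
move=> finj Hf x0 y0; apply: contrapT => xy.
have n0 : (0 < n)%N by rewrite lt0n; apply/eqP => /dim0_one_point h; exact: xy.
have [rho [C [r0 C0 Hc]]] := rdist_chart_lip x0.
set i := chart_at x0 in Hc; set u0 := coord i x0 in Hc.
pose w : 'rV[R]_n := const_mx (rho / 2).
have r20 : 0 < rho / 2 by rewrite divr_gt0.
have nw : `|w| <= rho / 2.
  by apply: rV_norm_le; [exact: ltW|move=> k; rewrite mxE gtr0_norm].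
have wr : `|w| < rho by apply: le_lt_trans nw _; rewrite ltr_pdivrMr// ltr_pMr// ltrDl.
pose p (N k : nat) : M := param i (u0 + (k%:R / N%:R) *: w).
have inb (N k : nat) : (k <= N)%N -> (0 < N)%N -> `|u0 + (k%:R / N%:R) *: w - u0| < rho.
  move=> kN N0; rewrite addrC addKr normrZ ger0_norm ?divr_ge0//.
  apply: le_lt_trans wr; apply: ler_piMl => //.
  by rewrite ler_pdivrMr ?ltr0n// mul1r ler_nat.
have step (N k : nat) : (k < N)%N -> d (p N k) (p N k.+1) <= C * (`|w| / N%:R).
  move=> kN; have N0 : (0 < N)%N by exact: leq_ltn_trans kN.
  have [_ _] := Hc _ _ (inb N k (ltnW kN) N0) (inb N k.+1 kN N0).
  move=> /le_trans; apply; rewrite ler_pM2l//.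
  rewrite opprD addrACA subrr add0r -scalerBl -mulrBl -natr1 addrAC subrr add0r.
  by rewrite mul1r normrZ gtr0_norm ?invr_gt0 ?ltr0n// mulrC.
have chain (N k : nat) : (k <= N)%N -> d (f (p N 0)) (f (p N k)) <= k%:R * (`|H| * (C * (`|w| / N%:R)) ^+ 2).
  elim: k => [_|k IH kN]; first by rewrite rdistxx mul0r.
  apply: le_trans (rdist_tri hcon _ (f (p N k)) _) _.
  rewrite -natr1 mulrDl mul1r; apply: lerD; first exact: IH (ltnW kN).
  apply: le_trans (Hf _ _) _; apply: (@le_trans _ _ (`|H| * d (p N k) (p N k.+1) ^+ 2)).
    by apply: ler_wpM2r; [exact: sqr_ge0|exact: ler_norm].
  apply: ler_wpM2l => //; apply: lerXn2r; rewrite ?nnegrE ?rdist_ge0//; last exact: step.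
  by rewrite mulr_ge0// ltW.
have e0 N : p N 0 = param i u0 by rewrite /p mul0r scale0r addr0.
have eN N : (0 < N)%N -> p N N = param i (u0 + w).
  by move=> N0; rewrite /p divff ?scale1r// pnatr_eq0 -lt0n.
have small (N : nat) : (0 < N)%N -> d (f (param i u0)) (f (param i (u0 + w))) * N%:R <= `|H| * (C * `|w|) ^+ 2.
  move=> N0; have N0' : 0 < N%:R :> R by rewrite ltr0n.
  have := chain N N (leqnn N); rewrite e0 eN// => h.
  apply: le_trans (ler_wpM2r (ltW N0') h) _.
  rewrite le_eqVlt; apply/orP; left; apply/eqP; field; exact: lt0r_neq0.
have fe : d (f (param i u0)) (f (param i (u0 + w))) = 0.
  apply/le_anti; rewrite rdist_ge0 andbT leNgt; apply/negP => dp.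
  pose N := (Num.truncn ((`|H| * (C * `|w|) ^+ 2) / d (f (param i u0)) (f (param i (u0 + w))))).+1.
  have := small N isT; rewrite leNgt => /negP; apply.
  by rewrite [ltRHS]mulrC -ltr_pdivrMr//; exact: truncnS_gt.
have pe := finj _ _ (rdist_eq0 hcon fe).
have c0 : (coord i @` dom i) u0 by exists x0 => //; exact: chart_at_dom.
have cw : (coord i @` dom i) (u0 + w).
  by have [] := Hc u0 (u0 + w); rewrite ?subrr ?normr0// addrC addKr.
have : u0 = u0 + w by rewrite -[RHS](paramK cw).2 -pe (paramK c0).2.
move=> /eqP; rewrite -subr_eq0 opprD addNKr oppr_eq0 => /eqP w0.
have : w 0 (Ordinal n0) = 0 by rewrite w0 mxE.
by rewrite mxE => e; move: r20; rewrite e ltxx.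
Qed.

Lemma holder_const_lty (g : R) (f : homeo M) : (holder_const g f < +oo)%E <->
  exists H : R, forall x y, x <> y -> d (f x) (f y) <= H * d x y `^ g.
Proof.
split.
  have [[x0 [y0 xy0]]|nxy] := pselect (exists x y : M, x <> y); last first.
    by move=> _; exists 0 => x y xy; exfalso; apply: nxy; exists x, y.
  move=> h; have ub x y : x <> y -> ((d (f x) (f y) / d x y `^ g)%:E <= holder_const g f)%E.
    by move=> xy; apply: ereal_sup_ubound; exists x, y.
  case e : (holder_const g f) h => [H| |]//.
    move=> _; exists H => x y xy; have := ub x y xy; rewrite e lee_fin.
    by rewrite ler_pdivrMr// powR_gt0// rdist_gt0.
  by have := ub x0 y0 xy0; rewrite e leeNy_eq.
move=> [H hH]; apply: (@le_lt_trans _ _ H%:E); last exact: ltry.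
apply: ge_ereal_sup => _ [x [y [xy ->]]]; rewrite lee_fin.
by rewrite ler_pdivrMr ?hH// powR_gt0// rdist_gt0.
Qed.

Lemma holder_const_anti (g g' : R) (f : homeo M) : g <= g' ->
  (holder_const g' f < +oo)%E -> (holder_const g f < +oo)%E.
Proof.
move=> gg /holder_const_lty [H hH]; apply/holder_const_lty.
have [D D0 hD] := rdist_bounded.
exists (`|H| * D `^ (g' - g)) => x y xy; apply: le_trans (hH x y xy) _.
have d0 := rdist_gt0 xy.
have -> : d x y `^ g' = d x y `^ (g' - g) * d x y `^ g.
  by rewrite -powRD ?subrK// (gt_eqF d0) implybT.
rewrite mulrA; apply: ler_wpM2r; first exact: powR_ge0.
apply: le_trans (ler_wpM2r (powR_ge0 _ _) (ler_norm H)) _; apply: ler_wpM2l => //.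
by apply: ge0_ler_powR; rewrite ?nnegrE ?subr_ge0 ?rdist_ge0 ?(ltW D0).
Qed.

Lemma holder_const2_lty (g : R) (f : homeo M) : (holder_const2 g f < +oo)%E <->
  (holder_const g f < +oo)%E /\ (holder_const g (homeo_inv f) < +oo)%E.
Proof. by rewrite /holder_const2 gt_max; split => [/andP[]|[-> ->]]. Qed.

Lemma holder_const2_anti (g g' : R) (f : homeo M) : g <= g' ->
  (holder_const2 g' f < +oo)%E -> (holder_const2 g f < +oo)%E.
Proof.
move=> gg /holder_const2_lty [h1 h2]; apply/holder_const2_lty.
by split; apply: holder_const_anti; eauto.
Qed.

Lemma holder_exponent_lt2 (g : R) (f : homeo M) (x0 y0 : M) : x0 <> y0 ->
  (holder_const g f < +oo)%E -> g < 2.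
Proof.
move=> xy0 hg; rewrite ltNge; apply/negP => g2; apply: xy0.
have /holder_const_lty [H hH] := holder_const_anti g2 hg.
apply: (@square_holder_one_point f H); first exact: can_inj (@homeo_funK _ _ _ f).
move=> x y; have [->|/eqP xy] := eqVneq x y; first by rewrite !rdistxx expr0n mulr0.
by have := hH x y xy; rewrite powR_mulrn ?rdist_ge0.
Qed.

(** The lower bound on [d (f x) (f y)] is the Hoelder bound of the inverse at the images. The
    exponent [holder_exp f / 2] is strictly below the supremum, which is positive and at most 2, so
    the constant is finite and [fine] is harmless. *)
Lemma Hol_holder (f : homeo M) (x0 y0 : M) : x0 <> y0 -> Hol f ->
  [/\ 0 < holder_exp f, 0 < holder_L f &
   forall x y, x <> y -> d x y <= holder_L f * d (f x) (f y) `^ (holder_exp f / 2)].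
Proof.
move=> xy0 [[g1 g10 h1] [g2 g20 h2]].
pose S := [set g : R | 0 < g /\ (holder_const2 g f < +oo)%E].
pose G := ereal_sup [set g%:E | g in S].
have Sub g : S g -> (g%:E <= G)%E by move=> Sg; apply: ereal_sup_ubound; exists g.
have Sg0 : S (Num.min g1 g2).
  split; first by rewrite lt_min g10.
  apply/holder_const2_lty; split.
    by apply: holder_const_anti h1; rewrite ge_min lexx.
  by apply: holder_const_anti h2; rewrite ge_min lexx orbT.
have G2 : (G <= 2%:E)%E.
  apply: ge_ereal_sup => _ [g [_ /holder_const2_lty [hg _]] <-].
  by rewrite lee_fin ltW//; exact: holder_exponent_lt2 xy0 hg.
have Gfin : G \is a fin_num.
  rewrite fin_numE; apply/andP; split; apply/eqP => e.
    by have := Sub _ Sg0; rewrite e leeNy_eq.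
  by move: G2; rewrite e leye_eq.
have eG : G = (holder_exp f)%:E by rewrite /holder_exp -/S -/G fineK.
have gam0 : 0 < holder_exp f.
  by rewrite -lte_fin -eG; apply: lt_le_trans (Sub _ Sg0); rewrite lte_fin; case: Sg0.
have : ((holder_exp f / 2)%:E < G)%E.
  by rewrite eG lte_fin ltr_pdivrMr// ltr_pMr// ltrDl.
move=> /ereal_sup_gt [_ [g [g0 hg] <-]]; rewrite lte_fin => /ltW gg.
have c2 := holder_const2_anti gg hg.
have key x y : x <> y ->
    ((d x y / d (f x) (f y) `^ (holder_exp f / 2))%:E <= holder_const2 (holder_exp f / 2) f)%E.
  move=> xy; rewrite /holder_const2 le_max; apply/orP; right.
  apply: ereal_sup_ubound; exists (f x), (f y); split.
    by move=> /(can_inj (@homeo_funK _ _ _ f)).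
  by rewrite /= !homeo_funK.
have fxy x y : x <> y -> 0 < d (f x) (f y).
  by move=> xy; apply: rdist_gt0 => /(can_inj (@homeo_funK _ _ _ f)).
have eL : holder_const2 (holder_exp f / 2) f = (holder_L f)%:E.
  rewrite /holder_L fineK// fin_numE (lt_eqF c2) andbT; apply/eqP => e.
  by have := key _ _ xy0; rewrite e leeNy_eq.
split => //.
  rewrite -lte_fin -eL; apply: lt_le_trans (key _ _ xy0).
  by rewrite lte_fin divr_gt0 ?powR_gt0 ?fxy// rdist_gt0.
move=> x y xy; have := key x y xy; rewrite eL lee_fin.
by rewrite ler_pdivrMr// powR_gt0// fxy.
Qed.

(** With [a = 1 + ln (holder_L f)], [g = holder_exp f] and [l] the logarithm of the truncated
    distance, [Hol_holder] gives [- ln (d (f x) (f y)) <= (2 / g) * (a - 1 - l)]. As [l <= -1],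
    [c <= a] and [c <= 1], the bracket is at most [- l * (a / c)], which leaves [- l] times
    [holder_Lambda f / c]. *)
Lemma Hol_lower_bound (f : homeo M) (x0 y0 : M) (c t : R) : x0 <> y0 -> Hol f ->
  0 < c -> c <= 1 -> c <= 1 + ln (holder_L f) -> holder_Lambda f <= c * t ->
  forall x y, (Num.min (d x y) (expR (-1))) `^ t <= d (f x) (f y).
Proof.
move=> xy0 /(Hol_holder xy0) [gam0 L0 hL] c0 c1 ca.
rewrite /holder_Lambda; set a := 1 + ln (holder_L f) in ca *; set g := holder_exp f in gam0 hL * => ht x y.
have a0 : 0 < a := lt_le_trans c0 ca.
have t0 : 0 < t.
  by rewrite -(pmulr_rgt0 _ c0); apply: lt_le_trans ht; rewrite mulr_gt0// divr_gt0.
have [->|/eqP xy] := eqVneq x y.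
  by rewrite !rdistxx min_l ?expR_ge0// powR0// gt_eqF.
have d0 := rdist_gt0 xy.
have fd0 : 0 < d (f x) (f y) by apply: rdist_gt0 => /(can_inj (@homeo_funK _ _ _ f)).
set m := Num.min _ _; have m0 : 0 < m by rewrite lt_min d0 expR_gt0.
have lm1 : ln m <= -1.
  by rewrite -[leRHS](@expRK R) ler_ln ?posrE ?expR_gt0// ge_min lexx orbT.
have lmd : ln m <= ln (d x y) by rewrite ler_ln ?posrE// ge_min lexx.
have := hL x y xy.
rewrite -ler_ln ?posrE ?mulr_gt0 ?powR_gt0// lnM ?posrE ?powR_gt0// ln_powR => h.
rewrite -ler_ln ?posrE ?powR_gt0// ln_powR.
have eL : ln (holder_L f) = a - 1 by rewrite /a addrAC subrr add0r.
rewrite eL in h.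
set D := ln (d (f x) (f y)) in h *; set l := ln m in lm1 lmd *.
have h1 : - D * (g / 2) <= a - 1 - l by lra.
have h2 : a - 1 - l <= - l * (a / c).
  rewrite mulrA ler_pdivlMr//; nra.
have h3 : - D <= - l * (a / c) * (2 / g).
  have e : - D = - D * (g / 2) * (2 / g) by field; rewrite gt_eqF.
  by rewrite {1}e; apply: ler_wpM2r; [rewrite divr_ge0// ltW|exact: le_trans h1 h2].
have h4 : - l * (a / c) * (2 / g) <= - l * t.
  rewrite -mulrA; apply: ler_wpM2l; first lra.
  rewrite -(ler_pM2l c0); apply: le_trans ht.
  by rewrite le_eqVlt; apply/orP; left; apply/eqP; field; rewrite !gt_eqF.
by have := le_trans h3 h4; rewrite mulrC; lra.
Qed.

End MetricTopology.

(** * Measures on the group of homeomorphisms *)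

Lemma continuous_realP (T : topologicalType) (R : realType) (f : T -> R) :
  (forall x (e : R), 0 < e -> nbhs x [set y | `|f x - f y| < e]) -> continuous f.
Proof. by move=> h x; apply/cvgrPdist_lt => e; exact: h. Qed.

Section Mean.
Context (T : ptopologicalType) (R : realType).
Implicit Types (mu : probability (borel T) R) (f g : T -> R).

Lemma borel_open (U : set T) : open U -> measurable (U : set (borel T)).
Proof. by move=> oU; exact: sub_sigma_algebra. Qed.

Definition bdd_measurable f := measurable_fun [set: borel T] (f : borel T -> R) /\
  exists b : R, forall x, `|f x| <= b.

Lemma continuous_borel f : continuous f -> measurable_fun [set: borel T] (f : borel T -> R).
Proof.
move=> /continuousP cf mD; apply: (measurability _ (RGenOInfty.measurableE R)) => //.
move=> _ [_ [x ->] <-]; rewrite setTI; apply: borel_open.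
by apply: cf; rewrite set_itvoy; exact: open_gt.
Qed.

Lemma bdd_measurable_continuous f (b : R) : continuous f -> (forall x, `|f x| <= b) ->
  bdd_measurable f.
Proof. by move=> cf fb; split; [exact: continuous_borel|exists b]. Qed.

Lemma bdd_integrable mu f : bdd_measurable f -> mu.-integrable [set: borel T] (EFin \o f).
Proof.
move=> [mf [b fb]]; apply: measurable_bounded_integrable => //.
  by apply: (@le_lt_trans _ _ 1%E); [exact: probability_le1|exact: ltry].
exists b; split; first exact: num_real.
by move=> x bx y _; apply: le_trans (fb y) _; exact: ltW.
Qed.

Definition mean mu f : R := \int[mu]_x f x.

Lemma bdd_lin (a : R) f g : bdd_measurable f -> bdd_measurable g ->
  bdd_measurable (fun x => a * f x + g x).
Proof.
move=> [mf [b fb]] [mg [c gc]]; split.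
  by apply: measurable_funD => //; exact: measurable_funM.
exists (`|a| * b + c) => x; apply: le_trans (ler_normD _ _) _.
by rewrite normrM lerD// ler_wpM2l.
Qed.

Lemma bdd_cst (c : R) : bdd_measurable (fun=> c).
Proof. by split; [exact: measurable_cst|exists `|c|]. Qed.

Lemma mean_lin mu (a : R) f g : bdd_measurable f -> bdd_measurable g ->
  mean mu (fun x => a * f x + g x) = a * mean mu f + mean mu g.
Proof.
move=> bf bg; have bf' := bdd_integrable mu bf; have bg' := bdd_integrable mu bg.
have ba : mu.-integrable [set: borel T] (EFin \o (fun x => a * f x)).
  apply: bdd_integrable; have := bdd_lin a bf (bdd_cst 0).
  by congr bdd_measurable; apply/funext => x; rewrite addr0.
rewrite /mean RintegralD//; congr (_ + _).
by rewrite RintegralZl.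
Qed.

Lemma mean_le mu f g : bdd_measurable f -> bdd_measurable g ->
  (forall x, f x <= g x) -> mean mu f <= mean mu g.
Proof.
move=> bf bg fg; apply: le_Rintegral => //.
- exact: bdd_integrable.
- exact: bdd_integrable.
Qed.

Lemma mean_cst mu (c : R) : mean mu (fun=> c) = c.
Proof.
rewrite /mean Rintegral_cst//=.
have -> : mu [set: borel T] = 1%E by exact: probability_setT.
by rewrite mulr1.
Qed.

Lemma bdd_indic (A : set T) : measurable (A : set (borel T)) ->
  bdd_measurable (\1_A : T -> R).
Proof.
move=> mA; split; first exact: measurable_indic.
by exists 1 => x; rewrite indicE; case: (_ \in _); rewrite ?normr1 ?normr0.
Qed.

Lemma mean_indic mu (A : set T) : measurable (A : set (borel T)) ->
  mean mu (\1_A : T -> R) = fine (mu A).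
Proof. by move=> mA; rewrite /mean /Rintegral integral_indic// setIT. Qed.

Lemma bdd_sum (I : Type) (r : seq I) (F : I -> T -> R) :
  (forall i, bdd_measurable (F i)) -> bdd_measurable (fun x => \sum_(i <- r) F i x).
Proof.
move=> bF; elim: r => [|i r IH].
  by rewrite (_ : (fun _ => _) = fun=> 0); [exact: bdd_cst|apply/funext => x; rewrite big_nil].
rewrite (_ : (fun _ => _) = fun x => 1 * F i x + \sum_(i <- r) F i x); first exact: bdd_lin.
by apply/funext => x; rewrite big_cons mul1r.
Qed.

Lemma mean_sum mu (I : Type) (r : seq I) (F : I -> T -> R) :
  (forall i, bdd_measurable (F i)) ->
  mean mu (fun x => \sum_(i <- r) F i x) = \sum_(i <- r) mean mu (F i).
Proof.
move=> bF; elim: r => [|i r IH].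
  rewrite big_nil -[RHS](mean_cst mu); congr mean; apply/funext => x.
  by rewrite big_nil.
rewrite big_cons -IH -[X in X + _]mul1r -mean_lin//; last exact: bdd_sum.
by congr mean; apply/funext => x; rewrite big_cons mul1r.
Qed.

Lemma bdd_scale (c : R) f :
  bdd_measurable f -> bdd_measurable (fun x => c * f x).
Proof.
move=> bf; have := bdd_lin c bf (bdd_cst 0).
by congr bdd_measurable; apply/funext => x; rewrite addr0.
Qed.

Lemma mean_scale mu (c : R) f :
  bdd_measurable f -> mean mu (fun x => c * f x) = c * mean mu f.
Proof.
move=> bf; rewrite -[RHS]addr0 -(mean_cst mu 0) -mean_lin//; last exact: bdd_cst.
by congr mean; apply/funext => x; rewrite addr0.
Qed.

Lemma mean_EFin mu f : bdd_measurable f ->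
  (mean mu f)%:E = (\int[mu]_x (f x)%:E)%E.
Proof.
by move=> bf; rewrite /mean /Rintegral fineK//; apply: integrable_fin_num => //; exact: bdd_integrable.
Qed.

(* Integrals of nonnegative functions are suprema over simple minorants, hence
   monotone even for nonmeasurable integrands such as those of [conv]. *)
Lemma le_integral_nonneg mu (f g : borel T -> \bar R) :
  (forall x, 0 <= f x)%E -> (forall x, f x <= g x)%E -> (\int[mu]_x f x <= \int[mu]_x g x)%E.
Proof.
move=> f0 fg; have g0 x : (0 <= g x)%E by exact: le_trans (fg x).
rewrite !ge0_integralTE//; apply: le_ereal_sup => _ [h hh <-]; exists h => // x.
exact: le_trans (hh x) (fg x).
Qed.

(** Markov's inequality through the simple minorant [k] on [B]; neither [g] nor [D] is assumed
    measurable, which is the situation of [holder_Lambda] on [Hol]. *)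
Lemma integral_ge_measure mu (D B : set (borel T)) (g : borel T -> \bar R) (k : R) :
  measurable B -> B `<=` D -> 0 <= k ->
  (forall x, D x -> (0 <= g x)%E) -> (forall x, B x -> (k%:E <= g x)%E) ->
  (k%:E * mu B <= \int[mu]_(x in D) g x)%E.
Proof.
move=> mB BD k0 g0 kg.
have -> : (k%:E * mu B = \int[mu]_x (k%:E * (\1_B x)%:E))%E.
  rewrite ge0_integralZl//; first by rewrite integral_indic// setIT.
  by apply/measurable_EFinP; exact: measurable_indic.
rewrite (integral_mkcond D); apply: le_integral_nonneg => x.
  by rewrite mule_ge0// lee_fin.
rewrite /patch indicE; case: (boolP (x \in B)) => [xB|_].
  by rewrite mule1 mem_set ?kg//; [exact: set_mem|apply: BD; exact: set_mem].
by rewrite mule0; case: ifP => // xD; apply: g0; exact: set_mem.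
Qed.

End Mean.

Section HomeoTopology.
Context {R : realType} {n : nat} (M : riemannian_manifold R n).
Hypotheses (hcpt : compact [set: M]) (hcon : connected [set: M]).
Local Notation d := (@rdist R n M).

Lemma homeo_nbhsE (f : homeo M) (U : set (homeo M)) : nbhs f U <->
  exists2 e : R, 0 < e & forall g : homeo M, (forall x, d (f x) (g x) < e) -> U g.
Proof.
split.
  rewrite nbhsE => -[V [oV Vf] VU]; have [e e0 eV] := oV f Vf.
  by exists e => // g /eV /VU.
move=> [e e0 eU]; rewrite nbhsE.
exists [set g : homeo M | exists2 e', e' < e & forall x, d (f x) (g x) <= e'].
  split; last by exists 0 => // x; rewrite rdistxx.
  move=> g [e' e'e fg]; exists ((e - e') / 2); first by rewrite divr_gt0// subr_gt0.
  move=> h gh; exists ((e + e') / 2); first by rewrite ltr_pdivrMr//; lra.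
  by move=> x; have := rdist_tri hcon (f x) (g x) (h x); have := fg x; have := gh x; lra.
move=> g [e' e'e fg]; apply: eU => x; exact: le_lt_trans (fg x) e'e.
Qed.

Lemma homeo_continuous (psi : homeo M -> R) :
  (forall (f : homeo M) (e : R), 0 < e -> exists2 r : R, 0 < r &
    forall g : homeo M, (forall x, d (f x) (g x) < r) -> `|psi f - psi g| < e) ->
  continuous psi.
Proof.
move=> h; apply: continuous_realP => f e /(h f)[r r0 hr].
by apply/homeo_nbhsE; exists r.
Qed.

Lemma homeo_openE (U : set (homeo M)) :
  (forall f, U f -> exists2 e : R, 0 < e &
    forall g : homeo M, (forall x, d (f x) (g x) < e) -> U g) -> open U.
Proof. by []. Qed.

(** A Lindelof argument: each map outside the support lies in a class [S D] of small uniform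
    diameter contained in a null open set, and the data [D] are countable, so countably many null
    classes cover the complement. *)
Lemma msupportC_null (mu : probability (borel (homeo M)) R) :
  measurable (~` msupport mu : set (borel (homeo M))) /\ mu (~` msupport mu) = 0%E.
Proof.
have oC : open (~` msupport mu).
  apply: homeo_openE => f /existsNP [U /not_implyP [oU /not_implyP [Uf nU]]].
  have [e e0 eU] := oU f Uf; exists e => // g /eU Ug sg.
  by apply: nU; exact: sg.
have mC := borel_open oC; split => //.
apply/(negligibleP mu mC).
have [C C0 hC] := covering hcpt.
pose rad (m : nat) : R := m.+1%:R^-1.
have rad0 m : 0 < rad m by rewrite invr_gt0 ltr0n.
have net m : exists Nz : nat * (nat -> M), forall x, exists2 k, (k < Nz.1)%N & d x (Nz.2 k) < rad m.
  have [|N [z [_ hz]]] := hC (rad m) (rad0 m).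
    by rewrite invf_le1 ?ltr0n// ler1n.
  by exists (N, z) => x; exact: hz.
have [Nz hNz] := choice net.
(* For [D = ((m, k), s)], maps in [S D] send points less than [rad k] apart to points less than
   [rad m] apart, and send the [i]-th point of the [k]-net near the point of the [m]-net whose index
   is the [i]-th entry of [s]. Finite lists suffice as the nets are finite. *)
pose S (D : nat * nat * seq nat) := [set f : homeo M |
  (forall x y, d x y < rad D.1.2 -> d (f x) (f y) < rad D.1.1) /\
  forall i, (i < (Nz D.1.2).1)%N ->
    d (f ((Nz D.1.2).2 i)) ((Nz D.1.1).2 (nth 0%N D.2 i)) < rad D.1.1].
have diamS D f g x : S D f -> S D g -> d (f x) (g x) < 4 * rad D.1.1.
  move=> [f1 f2] [g1 g2]; have [i iN hi] := hNz D.1.2 x.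
  have := f1 _ _ hi; have := g1 _ _ hi; have := f2 i iN; have := g2 i iN.
  set z := (Nz D.1.2).2 i; set w := (Nz D.1.1).2 _ => a1 a2 a3 a4.
  have := rdist_tri hcon (f x) (f z) (g x).
  have := rdist_tri hcon (f z) w (g x).
  have := rdist_tri hcon w (g z) (g x).
  by rewrite (rdistC w (g z)) (rdistC (g z) (g x)); lra.
have coverS (f : homeo M) m : exists2 D, D.1.1 = m & S D f.
  have [r r0 hr] := homeo_unif hcpt hcon f (rad0 m).
  pose k := Num.truncn r^-1.
  have kr : rad k < r by rewrite invf_plt ?posrE ?ltr0n//; exact: truncnS_gt.
  have hs i : exists j, d (f ((Nz k).2 i)) ((Nz m).2 j) < rad m.
    by have [j _ hj] := hNz m (f ((Nz k).2 i)); exists j.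
  have [s hs'] := choice hs.
  exists ((m, k), mkseq s (Nz k).1) => //; split => /=.
    by move=> x y xy; apply: hr; exact: lt_trans xy kr.
  by move=> i iN; rewrite nth_mkseq.
pose V (j : nat) : set (homeo M) := match unpickle j with
  | Some D => if pselect (mu.-negligible (S D : set (borel (homeo M)))) then S D else set0
  | None => set0 end.
have nV : mu.-negligible (\bigcup_j (V j : set (borel (homeo M)))).
  apply: negligible_bigcup => j; rewrite /V.
  by case: unpickle => [D|]; [case: pselect => // ?|]; exact: negligible_set0.
apply: (negligibleS _ nV).
move=> f /existsNP [U /not_implyP [oU /not_implyP [Uf nU]]].
have [e e0 eU] := oU f Uf.
pose m := Num.truncn (4 / e).
have me : 4 * rad m < e.
  by rewrite ltr_pdivrMr ?ltr0n// mulrC -ltr_pdivrMr//; exact: truncnS_gt.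
have [D Dm SD] := coverS f m.
exists (pickle D) => //; rewrite /V pickleK.
case: pselect => // -[].
exists U; split.
- exact: borel_open.
- by apply/eqP; rewrite eq_le measure_ge0 andbT leNgt; apply/negP.
- move=> g Sg; apply: eU => x; apply: lt_trans me.
  by rewrite -Dm; exact: diamS.
Qed.

End HomeoTopology.

Section HomeoMeasure.
Context {R : realType} {n : nat} (M : riemannian_manifold R n).
Hypotheses (hcpt : compact [set: M]) (hcon : connected [set: M]).
Local Notation d := (@rdist R n M).

Definition homeo_dist (f g : homeo M) : R := sup [set d (f x) (g x) | x in [set: M]].

Lemma homeo_dist_ge (f g : homeo M) x : d (f x) (g x) <= homeo_dist f g.
Proof.
have [D D0 hD] := rdist_bounded hcpt hcon.
by apply: ub_le_sup; [exists D => _ [y _ <-]; exact: hD|exists x].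
Qed.

Lemma homeo_dist_le (f g : homeo M) (e : R) : (forall x, d (f x) (g x) <= e) ->
  homeo_dist f g <= e.
Proof.
move=> h; apply: ge_sup; first by exists (d (f point) (g point)), point.
by move=> _ [y _ <-].
Qed.

(** Weak-* convergence only sees continuous functions, so a uniform ball around [f] is replaced by a
    tent function of [homeo_dist f]. *)
Lemma homeo_bump (f : homeo M) (e : R) : 0 < e -> exists h : homeo M -> R,
  [/\ continuous h, forall g, 0 <= h g <= 1,
    forall g, 0 < h g -> forall x, d (f x) (g x) < e &
    exists2 r : R, 0 < r & forall g : homeo M, (forall x, d (f x) (g x) < r) -> 2^-1 <= h g].
Proof.
move=> e0; exists (fun g => Num.max 0 (1 - homeo_dist f g / e)); split.
- apply: homeo_continuous => // g e' e'0.
  exists (e * e' / 2); first by rewrite !mulr_gt0.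
  move=> g' gg'.
  have h1 : homeo_dist f g' <= homeo_dist f g + e * e' / 2.
    apply: homeo_dist_le => x; apply: le_trans (rdist_tri hcon _ (g x) _) _.
    by apply: lerD; [exact: homeo_dist_ge|exact: ltW].
  have h2 : homeo_dist f g <= homeo_dist f g' + e * e' / 2.
    apply: homeo_dist_le => x; apply: le_trans (rdist_tri hcon _ (g' x) _) _.
    by apply: lerD; [exact: homeo_dist_ge|rewrite rdistC; exact: ltW].
  have h3 : `|homeo_dist f g / e - homeo_dist f g' / e| <= e' / 2.
    rewrite -mulrBl normrM (@ger0_norm _ e^-1) ?invr_ge0 ?(ltW e0)//.
    by rewrite ler_pdivrMr// ler_norml; apply/andP; split; lra.
  have h4 : e' / 2 < e' by rewrite ltr_pdivrMr// ltr_pMr// ltrDl.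
  move: h3 h4; set a := homeo_dist f g / e; set b := homeo_dist f g' / e.
  rewrite ler_norml ltr_norml => /andP[h3 h3'] h4.
  by case: (leP 0 (1 - a)) => ?; case: (leP 0 (1 - b)) => ?; apply/andP; split; lra.
- move=> g; rewrite le_max lexx ge_max ler01 /= gerBl divr_ge0 ?(ltW e0)//.
  by apply: le_trans (homeo_dist_ge f g point); exact: rdist_ge0.
- move=> g; rewrite lt_max ltxx /= subr_gt0 ltr_pdivrMr// mul1r => h x.
  exact: le_lt_trans (homeo_dist_ge _ _ _) h.
- exists (e / 2); first by rewrite divr_gt0.
  move=> g hg; rewrite le_max; apply/orP; right.
  have : homeo_dist f g / e <= 2^-1.
    rewrite ler_pdivrMr// mulrC; apply: homeo_dist_le => x; exact: ltW.
  lra.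
Qed.

Lemma mean_bump_gt0 (mu : probability (borel (homeo M)) R) (f : homeo M) (h : homeo M -> R) (r : R) :
  msupport mu f -> bdd_measurable h -> (forall g, 0 <= h g) -> 0 < r ->
  (forall g : homeo M, (forall x, d (f x) (g x) < r) -> 2^-1 <= h g) ->
  0 < mean mu h.
Proof.
move=> sf bh h0 r0 hr.
have : nbhs f [set g : homeo M | forall x, d (f x) (g x) < r].
  by apply/homeo_nbhsE => //; exists r.
rewrite nbhsE => -[U [oU Uf] Ur].
have mU := borel_open oU.
have muU := sf U oU Uf.
have muU' : 0 < fine (mu U).
  apply: fine_gt0; rewrite muU /=; apply: le_lt_trans (probability_le1 mu mU) _.
  exact: ltry.
apply: (@lt_le_trans _ _ (2^-1 * fine (mu U))); first by rewrite mulr_gt0.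
rewrite -mean_indic//.
have bi := bdd_indic R mU.
rewrite -[leLHS]addr0 -(mean_cst mu 0) -mean_lin//; last exact: bdd_cst.
apply: mean_le => //; first exact: bdd_lin (bdd_cst _ _).
move=> g; rewrite addr0 indicE; case: (boolP (g \in U)) => [gU|_].
  by rewrite mulr1; apply: hr; apply: Ur; exact: set_mem.
by rewrite mulr0.
Qed.

(** The condition is closed in [f], hence Borel, and stands in for bounds on [holder_Lambda f],
    whose measurability is not at hand. The cut at [expR (-1)] makes [- ln] of the truncated
    distance at least 1. *)
Definition expansion_set (t : R) : set (homeo M) :=
  [set f | forall x y, (Num.min (d x y) (expR (-1))) `^ t <= d (f x) (f y)].

Lemma expansion_setC_open t : open (~` expansion_set t).
Proof.
apply: homeo_openE => f /existsNP[x /existsNP[y /negP]]; rewrite -ltNge => lt.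
set m := _ `^ t in lt; exists ((m - d (f x) (f y)) / 2); first by rewrite divr_gt0// subr_gt0.
move=> g fg; move=> /(_ x y); apply/negP; rewrite -ltNge.
have := rdist_tri hcon (g x) (f x) (g y); have := rdist_tri hcon (f x) (f y) (g y).
have := fg x; have := fg y; rewrite (rdistC (g x) (f x)) -/m; lra.
Qed.

(** Markov's inequality for the power [beta] of [holder_Lambda], with [Hol_lower_bound] in
    contrapositive form: off a null set, a map outside [expansion_set t] has [holder_Lambda] above
    [c * t]. *)
Lemma expansion_tail (mu : probability (borel (homeo M)) R) (x0 y0 : M) (beta C0 c t : R) :
  x0 <> y0 -> msupport mu `<=` @Hol R n M -> 0 < beta -> 0 < c -> c <= 1 -> 0 < t ->
  (\int[mu]_(f in @Hol R n M) (holder_Lambda f `^ beta)%:E < C0%:E)%E ->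
  {ae mu, forall f, c <= 1 + ln (holder_L f)} ->
  fine (mu (~` expansion_set t)) <= C0 * (c * t) `^ (- beta).
Proof.
move=> xy0 sH b0 c0 c1 t0 hI [N [mN N0 subN]].
have [mS S0] := msupportC_null hcpt hcon mu.
have mE := borel_open (@expansion_setC_open t).
pose B := (~` expansion_set t) `\` (~` msupport mu `|` N).
have mB : measurable (B : set (borel (homeo M))).
  by apply: measurableD => //; exact: measurableU.
have Z0 : mu (~` msupport mu `|` N) = 0%E by rewrite measureU0.
have eB : (mu (~` expansion_set t) <= mu B)%E.
  rewrite -[leRHS](measureU0 _ _ Z0)//; last exact: measurableU.
  apply: le_measure; rewrite ?inE//.
    by apply: measurableU => //; exact: measurableU.
  by move=> f nE; rewrite /B; have [hz|hz] := pselect ((~` msupport mu `|` N) f); [right|left].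
have hB f : B f -> Hol f /\ ((c * t) `^ beta <= holder_Lambda f `^ beta).
  move=> [nE]; rewrite not_orP => -[/contrapT sf nN].
  have Hf := sH f sf; split => //.
  have cf : c <= 1 + ln (holder_L f) by apply: contrapT => nc; exact/nN/subN.
  have lt : c * t < holder_Lambda f.
    rewrite ltNge; apply/negP => le; apply: nE => x y.
    exact: (Hol_lower_bound hcpt hcon xy0 Hf c0 c1 cf le).
  have ct0 : 0 <= c * t by rewrite mulr_ge0// ltW.
  by apply: ge0_ler_powR; rewrite ?nnegrE ?(ltW b0) ?(ltW lt) ?(le_trans ct0 (ltW lt)).
have ct : 0 < (c * t) `^ beta by rewrite powR_gt0 ?mulr_gt0.
have h1 : (((c * t) `^ beta)%:E * mu B <= \int[mu]_(f in @Hol R n M) (holder_Lambda f `^ beta)%:E)%E.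
  apply: integral_ge_measure => //.
  - by move=> f /hB[].
  - exact: ltW.
  - by move=> f _; rewrite lee_fin powR_ge0.
  - by move=> f /hB[_]; rewrite lee_fin.
have h2 := le_lt_trans h1 hI.
have mBfin : mu B \is a fin_num by exact: fin_num_measure.
rewrite powRN ler_pdivlMr//.
move: h2; rewrite -(fineK mBfin) -EFinM lte_fin mulrC => /ltW; apply: le_trans.
apply: ler_wpM2r; first exact: ltW.
by apply: fine_le => //; exact: fin_num_measure.
Qed.

End HomeoMeasure.

(** * Positive functionals and the measures they represent *)

Section States.
Context {R : realType} {T : topologicalType}.
Implicit Types (f g : T -> R) (S : (T -> R) -> R).

(* States replace probability measures: their convolutions are defined without
   measurability questions, and limits along ultrafilters are again states. *)
Definition is_state S := [/\
  forall (a : R) f g, continuous f -> continuous g -> S (fun x => a * f x + g x) = a * S f + S g,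
  forall f, continuous f -> (forall x, 0 <= f x) -> 0 <= S f &
  S (fun=> 1) = 1].

Lemma continuous_cst (c : R) : continuous (fun _ : T => c).
Proof. by move=> x; exact: cvg_cst. Qed.

Lemma continuous_add f g : continuous f -> continuous g -> continuous (fun x => f x + g x).
Proof. by move=> cf cg x; apply: cvgD; [exact: cf|exact: cg]. Qed.

Lemma continuous_mul f g : continuous f -> continuous g -> continuous (fun x => f x * g x).
Proof. by move=> cf cg x; apply: cvgM; [exact: cf|exact: cg]. Qed.

Lemma continuous_sub f g : continuous f -> continuous g -> continuous (fun x => f x - g x).
Proof. by move=> cf cg x; apply: cvgB; [exact: cf|exact: cg]. Qed.

Lemma continuous_bigsum (I : Type) (r : seq I) (F : I -> T -> R) :
  (forall i, continuous (F i)) -> continuous (fun x => \sum_(i <- r) F i x).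
Proof. by move=> cF x; apply: for_continuous_sum => i _; exact: cF. Qed.

Section OneState.
Variables (S : (T -> R) -> R) (hS : is_state S).

Lemma state0 : S (fun=> 0) = 0.
Proof.
have [lin _ _] := hS; have := lin (-1) (fun=> 0) (fun=> 0) (@continuous_cst 0) (@continuous_cst 0).
by rewrite mulr0 addr0 mulN1r addNr.
Qed.

Lemma stateZ (a : R) f : continuous f -> S (fun x => a * f x) = a * S f.
Proof.
move=> cf; have [lin _ _] := hS; rewrite -[RHS]addr0 -state0 -lin//; last exact: continuous_cst.
by congr S; apply/funext => x; rewrite addr0.
Qed.

Lemma stateD f g : continuous f -> continuous g -> S (fun x => f x + g x) = S f + S g.
Proof.
move=> cf cg; have [lin _ _] := hS; rewrite -[S f]mul1r -lin//.
by congr S; apply/funext => x; rewrite mul1r.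
Qed.

Lemma stateB f g : continuous f -> continuous g -> S (fun x => f x - g x) = S f - S g.
Proof.
move=> cf cg; have [lin _ _] := hS; rewrite addrC -mulN1r -lin//.
by congr S; apply/funext => x; rewrite mulN1r addrC.
Qed.

Lemma state_cst (c : R) : S (fun=> c) = c.
Proof.
have [_ _ S1] := hS; rewrite (_ : (fun=> c) = fun x => c * 1); last first.
  by apply/funext => x; rewrite mulr1.
by rewrite stateZ ?S1 ?mulr1//; exact: continuous_cst.
Qed.

Lemma state_ge0 f : continuous f -> (forall x, 0 <= f x) -> 0 <= S f.
Proof. by have [_ + _] := hS; exact. Qed.

Lemma state_le f g : continuous f -> continuous g -> (forall x, f x <= g x) -> S f <= S g.
Proof.
move=> cf cg fg; rewrite -subr_ge0 -stateB//; apply: state_ge0.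
  exact: continuous_sub.
by move=> x; rewrite subr_ge0.
Qed.

Lemma state_le_cst f (c : R) : continuous f -> (forall x, f x <= c) -> S f <= c.
Proof. by move=> cf fc; rewrite -[leRHS]state_cst; apply: state_le => //; exact: continuous_cst. Qed.

Lemma state_norm_le f (c : R) : continuous f -> (forall x, `|f x| <= c) -> `|S f| <= c.
Proof.
move=> cf fc; rewrite ler_norml; apply/andP; split.
  rewrite -[leLHS]state_cst; apply: state_le => //; first exact: continuous_cst.
  by move=> x; have := fc x; rewrite ler_norml => /andP[].
by apply: state_le_cst => // x; have := fc x; rewrite ler_norml => /andP[].
Qed.

Lemma state_dist_le f g (c : R) : continuous f -> continuous g ->
  (forall x, `|f x - g x| <= c) -> `|S f - S g| <= c.
Proof. by move=> cf cg h; rewrite -stateB//; apply: state_norm_le => //; exact: continuous_sub. Qed.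

Lemma state_sum (I : Type) (r : seq I) (F : I -> T -> R) : (forall i, continuous (F i)) ->
  S (fun x => \sum_(i <- r) F i x) = \sum_(i <- r) S (F i).
Proof.
move=> cF; elim: r => [|i r IH].
  by rewrite big_nil -[RHS]state0; congr S; apply/funext => x; rewrite big_nil.
rewrite big_cons -IH -stateD//; last exact: continuous_bigsum.
by congr S; apply/funext => x; rewrite big_cons.
Qed.

End OneState.

Lemma state_comp S (f : T -> T) : is_state S -> continuous f -> is_state (fun phi => S (phi \o f)).
Proof.
move=> hS cf; have [lin pos one] := hS.
have cc (phi : T -> R) : continuous phi -> continuous (phi \o f).
  by move=> cphi x; apply: continuous_comp; [exact: cf|exact: cphi].
split => //; first by move=> a p q cp cq; rewrite -lin//; exact: cc.
by move=> p cp p0; apply: pos; [exact: cc|move=> x; exact: p0].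
Qed.

End States.

(** * Borel measures from states by Daniell's upper integral *)

Section UpperIntegral.
Context {R : realType} {T : ptopologicalType}.
Variables (S : (T -> R) -> R) (hS : is_state S).
Local Open Scope ereal_scope.

Definition cover_seq (psi : T -> \bar R) (phi : nat -> T -> R) := [/\
  forall k, continuous (phi k), forall k x, (0 <= phi k x)%R &
  forall x, psi x <= \sum_(k <oo) (phi k x)%:E].

(* Daniell's upper integral; on indicators it is an outer measure for which open
   sets are measurable, which gives the part of the Riesz theorem needed here. *)
Definition upper_int (psi : T -> \bar R) : \bar R :=
  ereal_inf [set \sum_(k <oo) (S (phi k))%:E | phi in cover_seq psi].

Lemma cover_sum_ge0 psi phi : cover_seq psi phi -> 0 <= \sum_(k <oo) (S (phi k))%:E.
Proof.
move=> [c0 p0 _]; apply: nneseries_ge0 => k _ _; rewrite lee_fin.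
exact: (state_ge0 hS).
Qed.

Lemma upper_ge0 psi : 0 <= upper_int psi.
Proof. by apply: le_ereal_inf_tmp => _ [phi hphi <-]; exact: cover_sum_ge0 hphi. Qed.

Lemma upper_le_cover psi phi : cover_seq psi phi -> upper_int psi <= \sum_(k <oo) (S (phi k))%:E.
Proof. by move=> h; apply: ereal_inf_lbound; exists phi. Qed.

Lemma le_upper psi psi' : (forall x, psi x <= psi' x) -> upper_int psi <= upper_int psi'.
Proof.
move=> h; apply: le_ereal_inf_tmp => _ [phi [c p hc] <-]; apply: upper_le_cover.
by split => // x; apply: le_trans (h x) _.
Qed.

Lemma upper_adherent psi (e : R) : (0 < e)%R -> upper_int psi < +oo ->
  exists2 phi, cover_seq psi phi & \sum_(k <oo) (S (phi k))%:E <= upper_int psi + e%:E.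
Proof.
move=> e0 fin.
have uf : upper_int psi \is a fin_num.
  by rewrite ge0_fin_numE// upper_ge0.
have [_ [phi hphi <-] /ltW lt] := lb_ereal_inf_adherent e0 uf.
by exists phi.
Qed.

Lemma nneseries_pair (f : nat -> nat * nat) (a : nat -> nat -> \bar R) :
  set_bij [set: nat] [set: nat * nat] f -> (forall i j, 0 <= a i j) ->
  \sum_(l <oo) a (f l).1 (f l).2 = \sum_(i <oo) \sum_(j <oo) a i j.
Proof.
move=> bf a0; rewrite nneseries_esumT//.
rewrite -(@reindex_esum _ _ _ setT setT f (fun p => a p.1 p.2))//.
rewrite nneseries_esumT; last by move=> i; apply: nneseries_ge0.
transitivity (\esum_(i in [set: nat]) \esum_(j in [set: nat]) a i j).
  by rewrite esum_esum//; congr esum; apply/seteqP; split.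
by apply: eq_esum => i _; rewrite nneseries_esumT.
Qed.

Lemma upper_sigma_sub (psi : nat -> T -> \bar R) : (forall i x, 0 <= psi i x) ->
  upper_int (fun x => \sum_(i <oo) psi i x) <= \sum_(i <oo) upper_int (psi i).
Proof.
move=> psi0; have [[i ioo]|noo] := pselect (exists i, upper_int (psi i) = +oo).
  by rewrite (eseries_pinfty _ _ ioo) ?leey// => k _; rewrite -ltNye (lt_le_trans _ (upper_ge0 _)).
have fin i : upper_int (psi i) < +oo.
  by rewrite ltey; apply/eqP => e; apply: noo; exists i.
apply/lee_addgt0Pr => e e0.
apply: le_trans (epsilon_trick xpredT (fun i => upper_ge0 (psi i)) (ltW e0)).
have en i : (0 < e / (2 ^ i.+1)%:R)%R by rewrite divr_gt0// ltr0n expn_gt0.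
have ex i : exists phi, cover_seq (psi i) phi /\
    \sum_(k <oo) (S (phi k))%:E <= upper_int (psi i) + (e / (2 ^ i.+1)%:R)%:E.
  by have [phi h1 h2] := upper_adherent (en i) (fin i); exists phi.
have [Phi hPhi] := choice ex.
have /card_esym/ppcard_eqP[f] := card_nat2.
have bf : set_bij [set: nat] [set: nat * nat] f by exact: bij.
have cov : cover_seq (fun x => \sum_(i <oo) psi i x) (fun l => Phi (f l).1 (f l).2).
  split.
  - by move=> l; have [[c _ _] _] := hPhi (f l).1; exact: c.
  - by move=> l; have [[_ p _] _] := hPhi (f l).1; exact: p.
  - move=> x; rewrite (nneseries_pair (a := fun i j => (Phi i j x)%:E))//.
      by apply: lee_nneseries => [i _ _|i _] //; have [[_ _]] := hPhi i.
    by move=> i j; have [[_ p _] _] := hPhi i; rewrite lee_fin.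
apply: le_trans (upper_le_cover cov) _.
rewrite (nneseries_pair (a := fun i j => (S (Phi i j))%:E))//.
  apply: lee_nneseries.
    by move=> i _ _; have [h _] := hPhi i; exact: cover_sum_ge0 h.
  by move=> i _; have [_] := hPhi i.
by move=> i j; have [[c p _] _] := hPhi i; rewrite lee_fin; exact: (state_ge0 hS).
Qed.

Lemma eseries_first (u : nat -> \bar R) : (forall k, u k.+1 = 0) -> \sum_(k <oo) u k = u 0%N.
Proof.
move=> u0; apply: lim_near_cst => //; exists 1%N => // -[|m] //= _.
by rewrite big_nat_recl// big1 ?adde0.
Qed.

Lemma upper_le_state (f : T -> R) : continuous f -> (forall x, 0 <= f x)%R ->
  upper_int (fun x => (f x)%:E) <= (S f)%:E.
Proof.
move=> cf f0; have cov : cover_seq (fun x => (f x)%:E) (fun k => if k is 0%N then f else fun=> 0%R).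
  split; [by case=> [|k] //; exact: continuous_cst|by case|].
  by move=> x; rewrite eseries_first.
by apply: le_trans (upper_le_cover cov) _; rewrite eseries_first// => k; rewrite state0.
Qed.

Definition outer_of_state (A : set T) : \bar R := upper_int (fun x => (\1_A x)%:E).

Lemma outer_of_state0 : outer_of_state set0 = 0.
Proof.
apply/eqP; rewrite eq_le upper_ge0 andbT.
rewrite /outer_of_state indic0.
apply: le_trans (upper_le_state (@continuous_cst _ _ 0) _) _ => //.
by rewrite (state0 hS).
Qed.

Lemma le_outer_of_state : {homo outer_of_state : A B / A `<=` B >-> A <= B}.
Proof.
move=> A B AB; apply: le_upper => x; rewrite lee_fin !indicE.
case: (boolP (x \in A)) => [xA|_]; last by case: (x \in B).
by rewrite mem_set//; apply: AB; exact: set_mem.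
Qed.

Lemma indic_bigcup_le (F : nat -> set T) x :
  (\1_(\bigcup_k F k) x)%:E <= \sum_(k <oo) (\1_(F k) x)%:E :> \bar R.
Proof.
have pos k : 0 <= (\1_(F k) x)%:E :> \bar R by rewrite lee_fin.
rewrite [X in X%:E <= _]indicE; case: (boolP (x \in _)) => [|_]; last exact: nneseries_ge0.
move=> /set_mem [k _ Fk]; apply: le_trans (nneseries_lim_ge k.+1 (fun k _ _ => pos k)).
rewrite big_nat_recr//= [X in _ + X%:E]indicE mem_set//.
by rewrite leeDr// sume_ge0.
Qed.

Lemma outer_of_state_sigma_sub : sigma_subadditive outer_of_state.
Proof.
move=> F; apply: le_trans (le_upper (indic_bigcup_le F)) _.
by apply: upper_sigma_sub => i x; rewrite lee_fin.
Qed.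

HB.instance Definition _ := isOuterMeasure.Build R T outer_of_state
  outer_of_state0 (fun A => upper_ge0 _) le_outer_of_state outer_of_state_sigma_sub.

(** The telescoping terms [f * (g k.+1 - g k)] form a covering sequence of [f] restricted to [U],
    with total value at most [S f]; a partial sum, which is [S (f * g k)], comes within [e] of the
    total. *)
Lemma upper_cozero (f : T -> R) (U : set T) (g : nat -> T -> R) (e : R) :
  continuous f -> (forall x, 0 <= f x)%R -> (forall k, continuous (g k)) ->
  (forall x, g 0%N x = 0%R) -> (forall k x, g k x <= g k.+1 x)%R -> (forall k x, g k x <= 1)%R ->
  (forall x, U x -> g ^~ x @ \oo --> (1 : R)%R) -> (0 < e)%R ->
  exists k, upper_int (fun x => (f x * \1_U x)%:E) <= (S (fun x => f x * g k x))%:E + e%:E.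
Proof.
move=> cf f0 cg g0 gi g1 gU e0.
pose h k x : R := (f x * (g k.+1 x - g k x))%R.
have ch k : continuous (h k) by apply: continuous_mul => //; exact: continuous_sub.
have h0 k x : (0 <= h k x)%R by rewrite mulr_ge0// subr_ge0.
have sumh N x : (\sum_(0 <= k < N) h k x = f x * g N x)%R.
  by rewrite -mulr_sumr telescope_sumr// g0 subr0.
have cfg N : continuous (fun x => f x * g N x)%R by exact: continuous_mul.
have sumS N : (\sum_(0 <= k < N) S (h k) = S (fun x => f x * g N x))%R.
  rewrite -(state_sum hS)//; congr S; apply/funext => x; exact: sumh.
have cov : cover_seq (fun x => (f x * \1_U x)%:E) h.
  split => // x; rewrite indicE; case: (boolP (x \in U)) => [/set_mem Ux|_]; last first.
    by rewrite mulr0; apply: nneseries_ge0 => k _ _; rewrite lee_fin.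
  have cv : \sum_(0 <= k < N) (h k x)%:E @[N --> \oo] --> (f x)%:E.
    rewrite (_ : (fun N => _) = EFin \o (fun N => f x * g N x)%R); last first.
      by apply/funext => N /=; rewrite sumEFin sumh.
    apply: cvg_EFin; first by near=> N.
    by rewrite -[X in _ --> X]mulr1; apply: cvgM; [exact: cvg_cst|exact: gU].
  by rewrite mulr1 (cvg_lim _ cv).
have cvgS : cvg (\sum_(0 <= k < N) (S (h k))%:E @[N --> \oo]).
  by apply: is_cvg_nneseries => k _ _; rewrite lee_fin; exact: (state_ge0 hS).
have bnd : \sum_(k <oo) (S (h k))%:E <= (S f)%:E.
  apply: lime_le => //; near=> N; rewrite sumEFin sumS lee_fin.
  apply: (state_le hS) => // x; rewrite ler_piMr//.
have finsum : \sum_(k <oo) (S (h k))%:E \is a fin_num.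
  rewrite ge0_fin_numE ?(le_lt_trans bnd) ?ltry//.
  by apply: nneseries_ge0 => k _ _; rewrite lee_fin; exact: (state_ge0 hS).
have : \sum_(k <oo) (S (h k))%:E - e%:E < \sum_(k <oo) (S (h k))%:E.
  by rewrite lteBlDr// lteDl.
move=> lt; have [N hN] : exists N, \sum_(k <oo) (S (h k))%:E - e%:E < \sum_(0 <= k < N) (S (h k))%:E.
  apply: contrapT => nN; move: lt; rewrite ltNge => /negP; apply.
  apply: lime_le => //; near=> N; rewrite leNgt; apply/negP => lt; apply: nN; by exists N.
exists N; apply: le_trans (upper_le_cover cov) _.
by rewrite -sumS -sumEFin -leeBlDr//; exact: ltW.
Unshelve. all: by end_near. Qed.

(** A nearly optimal covering [phi] of [X] is split term by term: [phi k * g (N k)] nearly accounts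
    for [phi k] on [U] by [upper_cozero], and the remainders still cover [X] outside [U], where [g]
    vanishes. The errors are summable. *)
Lemma caratheodory_cozero (U : set T) (g : nat -> T -> R) :
  (forall k, continuous (g k)) -> (forall k x, 0 <= g k x <= 1)%R ->
  (forall x, g 0%N x = 0%R) -> (forall k x, g k x <= g k.+1 x)%R ->
  (forall k x, ~ U x -> g k x = 0%R) ->
  (forall x, U x -> g ^~ x @ \oo --> (1 : R)%R) ->
  caratheodory_measurable outer_of_state U.
Proof.
move=> cg g01 g0 gi gn gU; apply: le_caratheodory_measurable => X.
change (outer_of_state (X `&` U) + outer_of_state (X `&` ~` U) <= outer_of_state X).
have [->|fin] := eqVneq (outer_of_state X) +oo; first exact: leey.
apply/lee_addgt0Pr => e e0; have e20 : (0 < e / 2)%R by rewrite divr_gt0.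
have [|phi [cphi phi0 hphi] hS'] := @upper_adherent (fun x => (\1_X x)%:E) _ e20.
  by rewrite ltey.
have en i : (0 < e / 2 / (2 ^ i.+1)%:R)%R by rewrite divr_gt0// ltr0n expn_gt0.
have g1 k x : (g k x <= 1)%R by have /andP[] := g01 k x.
have ex i := upper_cozero (cphi i) (phi0 i) cg g0 gi g1 gU (en i).
have [N hN] := choice ex.
have cf k : continuous (fun x => phi k x * g (N k) x)%R by exact: continuous_mul.
have cf' k : continuous (fun x => phi k x - phi k x * g (N k) x)%R by exact: continuous_sub.
have f0 k x : (0 <= phi k x * g (N k) x)%R by rewrite mulr_ge0//; have /andP[] := g01 (N k) x.
have f'0 k x : (0 <= phi k x - phi k x * g (N k) x)%R by rewrite subr_ge0 ler_piMr.
have h1 : outer_of_state (X `&` U) <=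
    \sum_(k <oo) ((S (fun x => phi k x * g (N k) x)%R)%:E + (e / 2 / (2 ^ k.+1)%:R)%:E).
  apply: (@le_trans _ _ (upper_int (fun x => \sum_(k <oo) (phi k x * \1_U x)%:E))).
    apply: le_upper => x; rewrite indicE; case: (boolP (x \in _)) => [/set_mem [Xx Ux]|_]; last first.
      by apply: nneseries_ge0 => k _ _; rewrite lee_fin mulr_ge0.
    have := hphi x; rewrite indicE mem_set// => /le_trans; apply.
    by apply: lee_nneseries => [k _ _|k _]; rewrite lee_fin// indicE mem_set// mulr1.
  apply: le_trans (upper_sigma_sub _) _; first by move=> i x; rewrite lee_fin mulr_ge0.
  by apply: lee_nneseries => [k _ _|k _]; [exact: upper_ge0|exact: hN].
have h2 : outer_of_state (X `&` ~` U) <= \sum_(k <oo) (S (fun x => phi k x - phi k x * g (N k) x)%R)%:E.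
  apply: upper_le_cover; split => // x.
  rewrite indicE; case: (boolP (x \in _)) => [/set_mem [Xx nUx]|_]; last first.
    by apply: nneseries_ge0 => k _ _; rewrite lee_fin.
  have := hphi x; rewrite indicE mem_set// => /le_trans; apply.
  by apply: lee_nneseries => [k _ _|k _]; rewrite lee_fin// gn// mulr0 subr0.
apply: le_trans (leeD h1 h2) _.
rewrite -nneseriesD//; last 2 first.
- by move=> k _ _; rewrite -EFinD lee_fin addr_ge0 ?(ltW (en k))//; exact: (state_ge0 hS).
- by move=> k _ _; rewrite lee_fin; exact: (state_ge0 hS).
rewrite [leRHS](_ : _ = outer_of_state X + (e / 2)%:E + (e / 2)%:E); last first.
  by rewrite -addeA -EFinD -splitr.
apply: le_trans (leeD2r _ hS').
have Sp k : 0 <= (S (phi k))%:E by rewrite lee_fin; exact: (state_ge0 hS).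
apply: le_trans (epsilon_trick xpredT Sp (ltW e20)).
rewrite le_eqVlt; apply/orP; left; apply/eqP; apply: eq_eseriesr => k _.
by rewrite -!EFinD (stateB hS)//; congr EFin; ring.
Qed.

Hypothesis hcpt : compact [set: T].

(** For the lower bound, a sequence covering 1 has, by compactness, a finite partial sum above
    [1 - e] everywhere, as in Dini's theorem; the state of this continuous sum is then at least
    [1 - e]. *)
Lemma outer_of_stateT : outer_of_state [set: T] = 1.
Proof.
have [_ _ S1] := hS.
apply/eqP; rewrite eq_le; apply/andP; split.
  rewrite /outer_of_state indicT; apply: le_trans (upper_le_state (@continuous_cst _ _ 1%R) _) _ => //.
  by rewrite S1.
apply: le_ereal_inf_tmp => _ [phi [cphi phi0 hphi] <-].
apply/lee_addgt0Pr => e e0.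
have /compact_near_coveringP := hcpt.
move=> /(_ nat \oo (fun N x => (1 - e < \sum_(0 <= k < N) phi k x)%R) _) [].
  move=> x _.
  have [N hN] : exists N, (1 - e < \sum_(0 <= k < N) phi k x)%R.
    apply: contrapT => nN.
    have : \sum_(k <oo) (phi k x)%:E <= (1 - e)%:E.
      apply: lime_le; first by apply: is_cvg_nneseries => k _ _; rewrite lee_fin.
      near=> N; rewrite sumEFin lee_fin leNgt; apply/negP => lt; apply: nN; by exists N.
    have := hphi x; rewrite indicT => h1 h2; have := le_trans h1 h2.
    by rewrite lee_fin /cst leNgt => /negP; apply; rewrite ltrBlDr ltrDl.
  have cs : continuous (fun x => \sum_(0 <= k < N) phi k x)%R by exact: continuous_bigsum.
  exists ([set y | (1 - e < \sum_(0 <= k < N) phi k y)%R], [set m | (N <= m)%N]) => /=.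
    by split; [exact: (cvgr_gt _ (cs x) _ hN)|exists N].
  move=> [y m] /= [h1 h2]; apply: lt_le_trans h1 _.
  by rewrite [leRHS](big_cat_nat (leq0n N) h2)/= lerDl; apply: sumr_ge0.
move=> N _ /(_ N (leqnn N)) hN.
have cs : continuous (fun x => \sum_(0 <= k < N) phi k x)%R by exact: continuous_bigsum.
have : (1 - e <= \sum_(0 <= k < N) S (phi k))%R.
  rewrite -(state_sum hS)// -(state_cst hS (1 - e)); apply: (state_le hS) => //.
    exact: continuous_cst.
  by move=> x; exact: ltW (hN x I).
move=> h; rewrite -leeBlDr//; apply: le_trans (nneseries_lim_ge N _); last first.
  by move=> k _ _; rewrite lee_fin; exact: (state_ge0 hS).
by rewrite sumEFin -EFinB lee_fin.
Unshelve. all: by end_near. Qed.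

Hypothesis hopen : forall U : set T, open U -> exists g : nat -> T -> R, [/\
  (forall k, continuous (g k)), (forall k x, 0 <= g k x <= 1)%R /\ (forall x, g 0%N x = 0%R),
  (forall k x, g k x <= g k.+1 x)%R,
  (forall k x, ~ U x -> g k x = 0%R) &
  (forall x, U x -> g ^~ x @ \oo --> (1 : R)%R)].

Lemma borel_caratheodory (A : set (borel T)) : measurable A -> caratheodory_measurable outer_of_state A.
Proof.
move=> mA; pose c : set (set T) := caratheodory_measurable outer_of_state.
suff : <<s @open T >> `<=` c by apply.
apply: smallest_sub.
  split; [exact: caratheodory_measurable_set0| |exact: caratheodory_measurable_bigcup].
  by move=> B; rewrite setTD; exact: caratheodory_measurable_setC.
by move=> U /hopen [g [cg [g01 g0] gi gn gU]]; exact: caratheodory_cozero.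
Qed.

Definition state_measure (A : set (borel T)) : \bar R := outer_of_state A.

Lemma state_measure_sigma_additive : semi_sigma_additive state_measure.
Proof.
move=> A mA tA mU.
apply: (@caratheodory_measure_sigma_additive R T outer_of_state) => //.
- by move=> k; exact: borel_caratheodory.
- exact: borel_caratheodory.
Qed.

HB.instance Definition _ := isMeasure.Build _ _ _ state_measure
  outer_of_state0 (fun A => upper_ge0 _) state_measure_sigma_additive.

HB.instance Definition _ := Measure_isProbability.Build _ _ _ state_measure outer_of_stateT.

Lemma state_representation : exists m : probability (borel T) R,
  forall A : set (borel T), m A = outer_of_state A.
Proof. by exists (state_measure : probability (borel T) R). Qed.

End UpperIntegral.

Section ManifoldStates.
Context {R : realType} {n : nat} (M : riemannian_manifold R n).
Hypotheses (hcpt : compact [set: M]) (hcon : connected [set: M]).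
Local Notation d := (@rdist R n M).

Definition dist_to (F : set M) (x : M) : R := inf [set d x y | y in F].

Lemma dist_to_le (F : set M) x y : F y -> dist_to F x <= d x y.
Proof.
by move=> Fy; apply: ge_inf; [exists 0 => _ [z _ <-]; exact: rdist_ge0|exists y].
Qed.

Lemma dist_to_ge (F : set M) x (r : R) : F !=set0 -> (forall y, F y -> r <= d x y) ->
  r <= dist_to F x.
Proof.
move=> [y Fy] h; apply: lb_le_inf; first by exists (d x y), y.
by move=> _ [z Fz <-]; exact: h.
Qed.

Lemma dist_to_lip (F : set M) x y : F !=set0 -> dist_to F x <= dist_to F y + d x y.
Proof.
move=> F0; rewrite -lerBlDr; apply: dist_to_ge => // z Fz.
have := dist_to_le x Fz; have := rdist_tri hcon x y z; lra.
Qed.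

Lemma dist_to_continuous (F : set M) : F !=set0 -> continuous (dist_to F).
Proof.
move=> F0; apply: continuous_realP => x e e0.
have := rdist_near x e0; apply: filterS => y hy /=.
have := dist_to_lip x y F0; have := dist_to_lip y x F0; rewrite (rdistC y x).
rewrite ltr_norml => h1 h2; apply/andP; split; lra.
Qed.

Lemma open_cozero (U : set M) : open U -> exists g : nat -> M -> R, [/\
  (forall k, continuous (g k)), (forall k x, 0 <= g k x <= 1) /\ (forall x, g 0%N x = 0),
  (forall k x, g k x <= g k.+1 x),
  (forall k x, ~ U x -> g k x = 0) &
  (forall x, U x -> g ^~ x @ \oo --> (1 : R))].
Proof.
(* The distance to an empty complement would be [inf set0 = 0], so the whole space is treated
   apart. *)
move=> oU; have [UT|nUT] := pselect (~` U = set0).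
  exists (fun k _ => if k is 0%N then 0 else 1); split.
  - by case=> [|k]; exact: continuous_cst.
  - by split => // -[|k] x; rewrite ?lexx ?ler01.
  - by move=> [|k] x //=; exact: ler01.
  - by move=> k x nUx; have : (~` U) x by []; rewrite UT.
  - move=> x _; apply: cvg_near_cst; exists 1%N => // -[|k] //.
have F0 : ~` U !=set0 by apply/set0P/eqP.
have D0 x : 0 <= dist_to (~` U) x by apply: dist_to_ge => // y _; exact: rdist_ge0.
exists (fun k x => Num.min 1 (k%:R * dist_to (~` U) x)); split.
- move=> k x; apply: (@continuous_min _ _ (fun=> 1) (fun x => k%:R * dist_to (~` U) x)).
    exact: cvg_cst.
  by apply: cvgM; [exact: cvg_cst|exact: dist_to_continuous].
- split=> [k x|x]; last by rewrite mul0r min_r// ler01.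
  by rewrite ge_min lexx le_min ler01 mulr_ge0.
- move=> k x; rewrite le_min ge_min lexx /= ge_min; apply/orP; right.
  by apply: ler_wpM2r => //; rewrite ler_nat.
- move=> k x nUx; have -> : dist_to (~` U) x = 0.
    by apply/le_anti; rewrite D0 andbT -(rdistxx x); exact: dist_to_le.
  by rewrite mulr0 min_r// ler01.
- move=> x Ux; have [r r0 hr] := nbhs_rdist hcpt hcon (open_nbhs_nbhs (conj oU Ux)).
  have Dr : r <= dist_to (~` U) x.
    apply: dist_to_ge => // y nUy; rewrite leNgt; apply/negP => lt; exact/nUy/hr.
  apply: cvg_near_cst; exists (Num.truncn r^-1).+1 => // k /= hk.
  rewrite min_l//; apply: (@le_trans _ _ (k%:R * r)); last by rewrite ler_wpM2l.
  rewrite -ler_pdivrMr// mul1r; apply: (@le_trans _ _ (Num.truncn r^-1).+1%:R).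
    by apply: ltW; exact: truncnS_gt.
  by rewrite ler_nat.
Qed.

Lemma state_borel (S : (M -> R) -> R) : is_state S -> exists m : probability (borel M) R,
  forall A : set (borel M), m A = outer_of_state S A.
Proof. by move=> hS; apply: state_representation => //; exact: open_cozero. Qed.

(** Composition with [f] and its inverse exchanges the covering sequences of [A] with those of its
    preimage, so an identity of states passes directly to the outer measures. *)
Lemma outer_transport (S S' : (M -> R) -> R) (f : homeo M) :
  (forall phi : M -> R, continuous phi -> S (phi \o f) = S' phi) ->
  forall A : set M, outer_of_state S (f @^-1` A) = outer_of_state S' A.
Proof.
move=> h A; rewrite /outer_of_state /upper_int; congr ereal_inf; apply/seteqP; split => _ [phi [c p hc] <-].
  exists (fun k => phi k \o homeo_invfun f).
    split => [k x|k x|x]; [|exact: p|].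
      by apply: continuous_comp; [exact: homeo_inv_cont|exact: c].
    have := hc (homeo_invfun f x); rewrite !indicE.
    suff -> : (homeo_invfun f x \in f @^-1` A) = (x \in A) by [].
    by apply/idP/idP => /set_mem; rewrite /= ?homeo_invK => ?; apply/mem_set; rewrite //= homeo_invK.
  apply: eq_eseriesr => k _; rewrite -h.
    by congr (S _)%:E; apply/funext => x /=; rewrite homeo_funK.
  by move=> x; apply: continuous_comp; [exact: homeo_inv_cont|exact: c].
exists (fun k => phi k \o f).
  split => [k x|k x|x]; [|exact: p|].
    by apply: continuous_comp; [exact: homeo_cont|exact: c].
  have := hc (f x); rewrite !indicE.
  by suff -> : (f x \in A) = (x \in f @^-1` A).
by apply: eq_eseriesr => k _; rewrite h.
Qed.

Lemma state_of_measure (nu : probability (borel M) R) : is_state (mean nu).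
Proof.
have bm (phi : M -> R) : continuous phi -> bdd_measurable phi.
  by move=> c; have [b b0 hb] := continuous_bounded hcpt c; exact: bdd_measurable_continuous c hb.
split.
- by move=> a p q cp cq; apply: mean_lin; exact: bm.
- move=> p cp p0; rewrite -(mean_cst nu 0); apply: mean_le => //; [exact: bdd_cst|exact: bm].
- exact: mean_cst.
Qed.

Lemma state_homeo_continuous (S : (M -> R) -> R) (phi : M -> R) : is_state S -> continuous phi ->
  continuous (fun f : homeo M => S (phi \o f)).
Proof.
move=> hS cphi; apply: homeo_continuous => // f e e0.
have e20 : 0 < e / 2 by rewrite divr_gt0.
have [r r0 hr] := continuous_unif hcpt hcon cphi e20.
exists r => // g fg; apply: (@le_lt_trans _ _ (e / 2)); last by rewrite ltr_pdivrMr// ltr_pMr// ltrDl.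
apply: (state_dist_le hS).
- by move=> x; apply: continuous_comp; [exact: homeo_cont|exact: cphi].
- by move=> x; apply: continuous_comp; [exact: homeo_cont|exact: cphi].
- by move=> x; apply: ltW; exact: hr (fg x).
Qed.

Lemma comp_homeo_continuous (f : homeo M) (phi : M -> R) : continuous phi -> continuous (phi \o f).
Proof. by move=> cphi x; apply: continuous_comp; [exact: homeo_cont|exact: cphi]. Qed.

Lemma state_homeo_bdd (S : (M -> R) -> R) (phi : M -> R) : is_state S -> continuous phi ->
  bdd_measurable (fun f : homeo M => S (phi \o f)).
Proof.
move=> hS cphi; have [b b0 hb] := continuous_bounded hcpt cphi.
apply: (@bdd_measurable_continuous _ _ _ b); first exact: state_homeo_continuous.
move=> f; apply: (state_norm_le hS) => [|x]; last exact: hb.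
exact: comp_homeo_continuous.
Qed.

Definition convolve (mu : probability (borel (homeo M)) R) (S : (M -> R) -> R) (phi : M -> R) : R :=
  mean mu (fun f : homeo M => S (phi \o f)).

Lemma convolve_state mu S : is_state S -> is_state (convolve mu S).
Proof.
move=> hS; split.
- move=> a p q cp cq; rewrite /convolve -mean_lin; [|exact: state_homeo_bdd..].
  congr mean; apply/funext => f.
  have [lin _ _] := hS; rewrite -lin//; exact: comp_homeo_continuous.
- move=> p cp p0; rewrite -(mean_cst mu 0); apply: mean_le; [exact: bdd_cst|exact: state_homeo_bdd|].
  move=> f; apply: (state_ge0 hS); [exact: comp_homeo_continuous|move=> x; exact: p0].
- rewrite /convolve (_ : (fun f => _) = fun=> 1) ?mean_cst//.
  by apply/funext => f; have [_ _] := hS.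
Qed.

End ManifoldStates.

(** * Energies *)

Section Features.
Context {R : realType} {n : nat} (M : riemannian_manifold R n).
Hypotheses (hcpt : compact [set: M]) (hcon : connected [set: M]).
Local Notation d := (@rdist R n M).

(** Here [a], [b] are the lengths of two vectors and [p] is their inner product: normalising vectors
    of length at least 1 does not move them apart. *)
Lemma normalized_close (a b p s : R) : 1 <= a -> 1 <= b -> p <= a * b ->
  a ^+ 2 + b ^+ 2 - 2 * p <= s -> 1 - s / 2 <= p / (a * b).
Proof.
move=> a1 b1 pab hs; have ab0 : 0 < a * b by rewrite mulr_gt0 ?(lt_le_trans ltr01).
rewrite -[p](divfK (lt0r_neq0 ab0)) in pab hs *.
rewrite mulfK ?lt0r_neq0//.
move: (p / (a * b)) pab hs => t pab hs.
have t1 : t <= 1 by rewrite -(ler_pM2r ab0) mul1r.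
have ab1 : 1 <= a * b by rewrite -[1]mul1r ler_pM.
have := sqr_ge0 (a - b); nra.
Qed.

(** Tents of slope [1 / r] around the points of an [r]-net, divided by their Euclidean norm, which
    is at least 1 since some tent is at least 1 at each point. The exponent [n + 2] comes from
    counting all [O(r^-n)] tents, each changing by at most [d x y / r], with a square. *)
Lemma scale_features : exists2 C : R, 0 < C & forall r : R, 0 < r -> r <= 1 ->
  exists (N : nat) (z : nat -> M) (U : nat -> M -> R), [/\
    (forall i, continuous (U i)) /\ (forall i x, 0 <= U i x),
    forall x, \sum_(i < N) U i x ^+ 2 = 1,
    forall i x, U i x != 0 -> d x (z i) < 2 * r &
    forall x y, 1 - C * d x y ^+ 2 / r ^+ (n + 2) <= \sum_(i < N) U i x * U i y].
Proof.
have [C C0 hC] := covering hcpt.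
exists C => // r r0 r1; have [N [z [hN hz]]] := hC r r0 r1.
pose g (i : nat) (x : M) : R := Num.max 0 (2 - d (z i) x / r).
have cg i : continuous (g i).
  move=> x; apply: (@continuous_max _ _ (fun=> 0) (fun x => 2 - d (z i) x / r)).
    exact: cvg_cst.
  apply: cvgB; first exact: cvg_cst.
  by apply: cvgM; [exact: rdist_continuous|exact: cvg_cst].
have g0 i x : 0 <= g i x by rewrite le_max lexx.
have glip i x y : `|g i x - g i y| <= d x y / r.
  have : `|d (z i) x / r - d (z i) y / r| <= d x y / r.
    rewrite -mulrBl normrM (@ger0_norm _ r^-1) ?invr_ge0 ?(ltW r0)//.
    by apply: ler_wpM2r; [rewrite invr_ge0 ltW|exact: rdist_dist_le].
  have dr : 0 <= d x y / r by rewrite divr_ge0 ?rdist_ge0 ?ltW.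
  rewrite /g; move: (d (z i) x / r) (d (z i) y / r) (d x y / r) dr => a b c c0.
  rewrite ler_norml => /andP[h1 h2]; rewrite ler_norml.
  by case: (leP 0 (2 - a)) => ?; case: (leP 0 (2 - b)) => ?; apply/andP; split; lra.
pose q x := \sum_(i < N) g i x ^+ 2.
have q1 x : 1 <= q x.
  have [k kN dk] := hz x I; rewrite /q (bigD1 (Ordinal kN))//=.
  have gk : 1 <= g k x.
    rewrite le_max; apply/orP; right; rewrite rdistC in dk.
    have : d (z k) x / r <= 1 by rewrite ler_pdivrMr// mul1r ltW.
    lra.
  rewrite -[1]addr0; apply: lerD; first by rewrite expr2 -[1]mul1r ler_pM.
  by apply: sumr_ge0 => i _; exact: sqr_ge0.
have q0 x : 0 < q x by exact: lt_le_trans ltr01 (q1 x).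
have sq1 x : 1 <= Num.sqrt (q x) by rewrite -[leLHS]sqrtr1; exact: ler_wsqrtr.
have sq0 x : Num.sqrt (q x) != 0 by rewrite gt_eqF// sqrtr_gt0.
exists N, z, (fun i x => g i x / Num.sqrt (q x)); split.
- split => [i x|i x]; last by rewrite divr_ge0 ?sqrtr_ge0.
  apply: cvgM; first exact: cg.
  apply: (@cvgV _ _ _ _ (fun x => Num.sqrt (q x))); first exact: sq0.
  apply: (@continuous_comp _ _ _ q); last exact: sqrt_continuous.
  by apply: for_continuous_sum => k _; apply: cvgM; exact: cg.
- move=> x; under eq_bigr do rewrite expr_div_n sqr_sqrtr ?(ltW (q0 x))//.
  by rewrite -mulr_suml -/(q x) divff// gt_eqF.
- move=> i x; apply: contraNT; rewrite -leNgt => h.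
  rewrite /g max_l ?mul0r// subr_le0 ler_pdivlMr//.
  by rewrite rdistC.
- move=> x y; set S := \sum_(i < N) _.
  have eS : S = (\sum_(i < N) g i x * g i y) / (Num.sqrt (q x) * Num.sqrt (q y)).
    rewrite /S mulr_suml; apply: eq_bigr => i _.
    by rewrite invfM; ring.
  set p := \sum_(i < N) g i x * g i y in eS.
  have es (a b : R) : a ^+ 2 + b ^+ 2 - 2 * (a * b) = (a - b) ^+ 2 by ring.
  have esum : q x + q y - 2 * p = \sum_(i < N) (g i x - g i y) ^+ 2.
    rewrite /q /p mulr_sumr -big_split/= -sumrB; apply: eq_bigr => i _.
    by rewrite -es.
  have sumle : \sum_(i < N) (g i x - g i y) ^+ 2 <= 2 * (C * d x y ^+ 2 / r ^+ (n + 2)).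
    apply: (@le_trans _ _ (\sum_(i < N) (d x y / r) ^+ 2)).
      apply: ler_sum => i _; rewrite -real_normK ?num_real//.
      by apply: lerXn2r; rewrite ?nnegrE// divr_ge0 ?rdist_ge0 ?ltW.
    rewrite sumr_const card_ord -[leLHS]mulr_natl.
    have c0 : 0 <= (d x y / r) ^+ 2 by exact: sqr_ge0.
    apply: le_trans (ler_wpM2r c0 hN) _.
    have e : C * r^-1 ^+ n * (d x y / r) ^+ 2 = C * d x y ^+ 2 / r ^+ (n + 2).
      have rn : r != 0 by rewrite gt_eqF.
      by rewrite exprD exprVn expr_div_n; field; rewrite rn expf_neq0.
    rewrite e mulr2n mulrDl mul1r lerDl.
    by rewrite !mulr_ge0 ?invr_ge0 ?exprn_ge0 ?rdist_ge0 ?ltW.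
  (* Cauchy-Schwarz, from the nonnegative sum of the squares of [g i x * b - g i y * a]. *)
  have pab : p <= Num.sqrt (q x) * Num.sqrt (q y).
    have [a [b [/andP[a1 b1] ea eb -> ->]]] : exists a b : R, [/\ (1 <= a) && (1 <= b), q x = a ^+ 2,
        q y = b ^+ 2, Num.sqrt (q x) = a & Num.sqrt (q y) = b].
      exists (Num.sqrt (q x)), (Num.sqrt (q y)); rewrite !sq1; split => //.
        by rewrite sqr_sqrtr ?(ltW (q0 _)).
      by rewrite sqr_sqrtr ?(ltW (q0 _)).
    have : 0 <= \sum_(i < N) (g i x * b - g i y * a) ^+ 2.
      by apply: sumr_ge0 => i _; exact: sqr_ge0.
    have -> : \sum_(i < N) (g i x * b - g i y * a) ^+ 2 =
       q x * b ^+ 2 + q y * a ^+ 2 - 2 * a * b * p.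
      rewrite /q /p !mulr_suml mulr_sumr -big_split/= -sumrB; apply: eq_bigr => i _.
      ring.
    have ab0 : 0 < a * b by rewrite mulr_gt0 ?(lt_le_trans ltr01).
    rewrite ea eb -[p <= _](ler_pM2l ab0) => h; lra.
  rewrite eS.
  have := normalized_close (sq1 x) (sq1 y) pab.
  rewrite !sqr_sqrtr ?(ltW (q0 _))// => /(_ (2 * (C * d x y ^+ 2 / r ^+ (n + 2)))).
  rewrite esum => /(_ sumle).
  by rewrite [2 * _]mulrC mulfK ?pnatr_eq0.
Qed.

(** As [scale j.+1 = scale j ^+ (n + 3)], points closer than [scale j.+1] make the error
    [d ^+ 2 / scale j ^+ (n + 2)] of [scale_features] at most [scale j], hence at most [4^-1 ^+ j].
    Raising a scale to the power [(n + 3) ^+ s] moves its index by [s]. *)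
Definition scale (j : nat) : R := expR (- (n + 3)%:R ^+ j).

Lemma expR2_ge4 : 4 <= expR 2 :> R.
Proof.
have h : 2 <= expR 1 :> R by have := expR_ge1Dx (1 : R); lra.
by rewrite (_ : 2 = 1 + 1 :> R) // expRD; nra.
Qed.

Lemma scale_gt0 j : 0 < scale j. Proof. exact: expR_gt0. Qed.

Lemma base_ge3 : 3 <= (n + 3)%:R :> R. Proof. by rewrite natrD lerDr. Qed.

Lemma scale_le1 j : scale j <= 1.
Proof. by rewrite -expR0 ler_expR oppr_le0 exprn_ge0. Qed.

Lemma scale_succ j : 4 * scale j.+1 <= scale j.
Proof.
apply: (@le_trans _ _ (expR 2 * scale j.+1)).
  by apply: ler_wpM2r; [exact: ltW (scale_gt0 _)|exact: expR2_ge4].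
rewrite -expRD ler_expR exprS.
have h1 : 1 <= (n + 3)%:R ^+ j :> R by apply: exprn_ege1; have := base_ge3; lra.
have := base_ge3; nra.
Qed.

Lemma scale_geometric j : scale j <= (4^-1) ^+ j.
Proof.
elim: j => [|j IH]; first by rewrite expr0 scale_le1.
rewrite exprS -ler_pdivrMl ?invr_gt0// invrK.
exact: le_trans (scale_succ j) IH.
Qed.

Lemma scale_power j : scale j.+1 = scale j ^+ (n + 3).
Proof. by rewrite /scale -expRM_natl exprS mulrN mulrC. Qed.

Lemma features : exists (C : R) (N : nat -> nat) (z : nat -> nat -> M) (U : nat -> nat -> M -> R),
  [/\ 0 < C, (forall j i, continuous (U j i)) /\ (forall j i x, 0 <= U j i x),
    forall j x, \sum_(i < N j) U j i x ^+ 2 = 1,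
    forall j i x, U j i x != 0 -> d x (z j i) < 2 * scale j &
    forall j x y, d x y < scale j.+1 -> 1 <= \sum_(i < N j) U j i x * U j i y + C * (4^-1) ^+ j].
Proof.
have [C C0 hC] := scale_features.
have ex j : exists D : nat * (nat -> M) * (nat -> M -> R), [/\
    (forall i, continuous (D.2 i)) /\ (forall i x, 0 <= D.2 i x),
    forall x, \sum_(i < D.1.1) D.2 i x ^+ 2 = 1,
    forall i x, D.2 i x != 0 -> d x (D.1.2 i) < 2 * scale j &
    forall x y, 1 - C * d x y ^+ 2 / scale j ^+ (n + 2) <= \sum_(i < D.1.1) D.2 i x * D.2 i y].
  by have [N [z [U h]]] := hC _ (scale_gt0 j) (scale_le1 j); exists (N, z, U).
have [D hD] := choice ex.
exists C, (fun j => (D j).1.1), (fun j => (D j).1.2), (fun j => (D j).2); split => //.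
- by split => j; have [[]] := hD j.
- by move=> j; have [] := hD j.
- by move=> j; have [] := hD j.
move=> j x y xy; have [_ _ _ /(_ x y) h] := hD j.
rewrite -lerBlDr; apply: le_trans h; rewrite lerD2l lerN2.
rewrite -mulrA ler_pM2l//; apply: le_trans (scale_geometric j).
rewrite ler_pdivrMr ?exprn_gt0 ?scale_gt0//.
apply: (@le_trans _ _ (scale j.+1 ^+ 2)).
  by apply: lerXn2r; rewrite ?nnegrE ?rdist_ge0 ?ltW ?scale_gt0.
rewrite scale_power -exprM -exprS.
by apply: ler_wiXn2l; rewrite ?scale_le1 ?ltW ?scale_gt0//; lia.
Qed.

End Features.

Lemma half_geometric_le (R : realType) (J : nat) : \sum_(j < J) (2^-1 : R) ^+ j <= 2.
Proof.
suff : \sum_(j < J) (2^-1 : R) ^+ j = 2 - 2 * 2^-1 ^+ J.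
  by move=> ->; rewrite gerBl mulr_ge0// exprn_ge0.
elim: J => [|J IH]; first by rewrite big_ord0 expr0; lra.
by rewrite big_ord_recr /= IH exprS; lra.
Qed.

Lemma arith_geometric_le (R : realType) (x : R) (J : nat) : 0 <= x -> x < 1 ->
  \sum_(t < J) (t.+1)%:R * x ^+ t <= ((1 - x) ^+ 2)^-1.
Proof.
move=> x0 x1; have d0 : 0 < (1 - x) ^+ 2 by rewrite exprn_gt0// subr_gt0.
rewrite -[leRHS]mul1r ler_pdivlMr//.
suff -> : (\sum_(t < J) (t.+1)%:R * x ^+ t) * (1 - x) ^+ 2 = 1 - x ^+ J * (J%:R * (1 - x) + 1).
  rewrite gerBl mulr_ge0 ?exprn_ge0// addr_ge0// mulr_ge0//; lra.
elim: J => [|J IH]; first by rewrite big_ord0 expr0; lra.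
rewrite big_ord_recr /= mulrDl IH -(natr1 J) (exprS x J); ring.
Qed.

(** The exponent is the [alpha] of the final estimate, fixed so that the square of
    [(a ^+ m) ^ - alpha] is the energy decay [b ^ - m]. *)
Lemma powR_log_ratio (R : realType) (a b : R) m : 1 < a -> 1 < b ->
  ((a ^+ m) `^ (- (ln b / (2 * ln a)))) ^+ 2 = (b ^+ m)^-1.
Proof.
move=> a1 b1; have a0 : 0 < a by lra.
have b0 : 0 < b by lra.
have la : ln a != 0 by rewrite gt_eqF// ln_gt0.
have ab : a `^ (ln b / ln a) = b by rewrite /powR gt_eqF// divfK// lnK ?posrE.
rewrite -powR_mulrn ?powR_ge0// -powRrM mulNr powRN.
have -> : ln b / (2 * ln a) * 2%:R = ln b / ln a by field.
congr (_^-1); rewrite -(powR_mulrn m (ltW a0)) -powRrM mulrC powRrM ab.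
by rewrite powR_mulrn// ltW.
Qed.

Lemma expr1D_le (R : realType) (del : R) k : 0 <= del -> del <= 1 -> (1 + del) ^+ k <= 1 + 2 ^+ k * del.
Proof.
move=> d0 d1; suff : (1 + del) ^+ k <= 1 + (2 ^+ k - 1) * del by lra.
elim: k => [|k IH]; first by rewrite !expr0; lra.
rewrite !exprS; apply: (@le_trans _ _ ((1 + del) * (1 + (2 ^+ k - 1) * del))).
  by rewrite ler_wpM2l//; lra.
have : 1 <= 2 ^+ k :> R by rewrite exprn_ege1//; lra.
move: (2 ^+ k) => u u1; have : 0 <= (u - 1) * (del * (1 - del)) by rewrite !mulr_ge0//; lra.
lra.
Qed.

Lemma ultra_map_compact (X : Type) (T : topologicalType) (F : set_system X) (u : X -> T) (A : set T) :
  UltraFilter F -> compact A -> (forall x, A (u x)) -> exists2 p, A p & u x @[x --> F] --> p.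
Proof.
move=> FU; rewrite compact_ultra => cA Au.
have UU : UltraFilter (u x @[x --> F]).
  split=> [|G GF sub]; first exact: fmap_proper_filter.
  apply/seteqP; split => // B GB.
  have [//|FnB] := in_ultra_setVsetC (u @^-1` B) FU.
  have GnB : G (~` B) by apply: sub.
  have /filter_ex[x []//] : G (B `&` ~` B) by exact: filterI.
have [|p [Ap hp]] := cA _ UU; last by exists p.
change (F (u @^-1` A)); exact: filterE.
Qed.

Lemma pointwise_eval_continuous (T : topologicalType) (I : Type) (i : I) :
  continuous (fun f : {ptws I -> T} => f i).
Proof.
move=> f; have /cvg_sup/(_ i)/cvg_image : (f : {ptws I -> T}) --> (f : {ptws I -> T}) by exact: cvg_id.
move=> h; apply: cvg_trans (h _) => {h}.
  by move=> Q /= [W nbdW <-]; apply: filterS nbdW; exact: preimage_image.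
by rewrite eqEsubset; split => y //; exists (fun=> y).
Qed.

Lemma weak_star_mean (R : realType) (T : ptopologicalType) (X : Type) (F : set_system X) (FF : Filter F)
    (mu_ : X -> probability (borel T) R) (mu : probability (borel T) R) (h : T -> R) (b : R) :
  (mu_ x : weak_star T R) @[x --> F] --> (mu : weak_star T R) ->
  continuous h -> (forall x, `|h x| <= b) -> mean (mu_ x) h @[x --> F] --> mean mu h.
Proof.
move=> hmu ch hb.
have bh : bounded_fun h.
  by exists b; split; [exact: num_real|move=> y by' x _; apply: le_trans (hb x) (ltW by')].
pose hh : Cb T R := exist _ h (conj ch bh).
have := @initial_continuous _ _ (fun mu : probability (borel T) R =>
    (fun phi : Cb T R => \int[mu]_x sval phi x) : {ptws Cb T R -> R}) mu.
move=> /(cvg_comp _ _ hmu) h1.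
have h2 := @pointwise_eval_continuous R (Cb T R) hh (fun phi : Cb T R => \int[mu]_x sval phi x).
exact: (cvg_comp _ _ h1 h2).
Qed.

Section Energy.
Context {R : realType} {n : nat} (M : riemannian_manifold R n).
Hypotheses (hcpt : compact [set: M]) (hcon : connected [set: M]).
Local Notation d := (@rdist R n M).
Local Notation scale := (@scale R n).
Variables (C : R) (N : nat -> nat) (z : nat -> nat -> M) (U : nat -> nat -> M -> R).
Hypotheses (C0 : 0 < C) (cU : forall j i, continuous (U j i))
  (U0 : forall j i x, 0 <= U j i x)
  (U1 : forall j x, \sum_(i < N j) U j i x ^+ 2 = 1)
  (Usupp : forall j i x, U j i x != 0 -> d x (z j i) < 2 * scale j)
  (Uclose : forall j x y, d x y < scale j.+1 ->
    1 <= \sum_(i < N j) U j i x * U j i y + C * (4^-1) ^+ j).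

Lemma kernel_le1 j x y : \sum_(i < N j) U j i x * U j i y <= 1.
Proof.
have : 0 <= \sum_(i < N j) (U j i x - U j i y) ^+ 2 by apply: sumr_ge0 => i _; exact: sqr_ge0.
have -> : \sum_(i < N j) (U j i x - U j i y) ^+ 2 =
    \sum_(i < N j) U j i x ^+ 2 + \sum_(i < N j) U j i y ^+ 2 - 2 * \sum_(i < N j) U j i x * U j i y.
  by rewrite mulr_sumr -big_split/= -sumrB; apply: eq_bigr => i _; ring.
rewrite !U1; lra.
Qed.

Lemma kernel_supp j x y : d x y >= 4 * scale j -> \sum_(i < N j) U j i x * U j i y = 0.
Proof.
move=> h; apply: big1 => i _; apply/eqP; rewrite mulf_eq0; apply: contraT.
rewrite negb_or => /andP[/Usupp h1 /Usupp h2].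
have := rdist_tri hcon x (z j i) y; rewrite (rdistC (z j i) y); lra.
Qed.

(** The truncation at [expR (-1)] is invisible here since every scale is at most
    [scale 0 = expR (-1)]. *)
Lemma expansion_scale (f : homeo M) s j x y : expansion_set ((n + 3)%:R ^+ s) f ->
  d (f x) (f y) < scale (j + s) -> d x y < scale j.
Proof.
move=> hf lt; rewrite ltNge; apply/negP => h.
have b3 := @base_ge3 R n; have t0 : 0 < (n + 3)%:R ^+ s :> R by rewrite exprn_gt0//; lra.
have sm : scale j <= Num.min (d x y) (expR (-1)).
  rewrite le_min h /= ler_expR lerN2 exprn_ege1//; lra.
have := le_lt_trans (hf x y) lt; rewrite ltNge => /negP; apply.
have -> : scale (j + s) = scale j `^ ((n + 3)%:R ^+ s).
  by rewrite -expRM mulNr -exprD addnC.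
apply: ge0_ler_powR; rewrite ?nnegrE ?(ltW t0)//; first exact: ltW (scale_gt0 _).
by rewrite le_min rdist_ge0 expR_ge0.
Qed.

(** If the images are far apart the left kernel vanishes. Otherwise one extra index absorbs the
    factor 4 of [kernel_supp] through [scale_succ], and a second one is needed because [Uclose] at
    [j] asks for distance below [scale j.+1]. *)
Lemma kernel_shift (f : homeo M) s j x y : expansion_set ((n + 3)%:R ^+ s) f ->
  \sum_(i < N (s.+2 + j)) U (s.+2 + j) i (f x) * U (s.+2 + j) i (f y) <=
  \sum_(i < N j) U j i x * U j i y + C * (4^-1) ^+ j.
Proof.
move=> hf; have [h|h] := leP (4 * scale (s.+2 + j)) (d (f x) (f y)).
  rewrite kernel_supp// addr_ge0//; last by rewrite mulr_ge0 ?exprn_ge0 ?ltW.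
  by apply: sumr_ge0 => i _; exact: mulr_ge0.
apply: le_trans (kernel_le1 _ _ _) _; apply: Uclose.
apply: (expansion_scale hf); apply: lt_le_trans h _.
by rewrite (_ : j.+1 + s = (s + j).+1)%N ?[(s.+2 + j)%N]addSn ?addSn; [exact: scale_succ|lia].
Qed.

Implicit Types (S : (M -> R) -> R) (phi : M -> R).

(** Integration of a kernel inequality against [phi(x) dS(x) dS(y)], one variable at a time because
    a state acts on functions of one variable. *)
Lemma kernel_state_le S phi (e : R) p p' (a b : 'I_p -> M -> R) (a' b' : 'I_p' -> M -> R) :
  is_state S -> continuous phi -> (forall x, 0 <= phi x) ->
  (forall i, continuous (a i)) -> (forall i, continuous (b i)) ->
  (forall i, continuous (a' i)) -> (forall i, continuous (b' i)) ->
  (forall x y, \sum_i a i x * b i y <= \sum_i a' i x * b' i y + e) ->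
  \sum_i S (fun x => phi x * a i x) * S (b i) <=
  \sum_i S (fun x => phi x * a' i x) * S (b' i) + e * S phi.
Proof.
move=> hS cphi phi0 ca cb ca' cb' h.
have lin q (u v : 'I_q -> M -> R) x : (forall i, continuous (v i)) ->
    S (fun y => \sum_i u i x * v i y) = \sum_i u i x * S (v i).
  move=> cv; rewrite (state_sum hS) => [|i]; last first.
    by apply: continuous_mul => //; exact: continuous_cst.
  by apply: eq_bigr => i _; rewrite (stateZ hS).
have csum q (u v : 'I_q -> M -> R) x : (forall i, continuous (v i)) ->
    continuous (fun y => \sum_i u i x * v i y).
  by move=> cv; apply: continuous_bigsum => i; apply: continuous_mul => //; exact: continuous_cst.
have h1 x : \sum_i a i x * S (b i) <= \sum_i a' i x * S (b' i) + e.
  rewrite -!lin// -[X in _ + X](state_cst hS e) -(stateD hS)//; last 2 first.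
  - exact: csum.
  - exact: continuous_cst.
  apply: (state_le hS); [exact: csum| |exact: h].
  by apply: continuous_add; [exact: csum|exact: continuous_cst].
have lin2 q (u v : 'I_q -> M -> R) : (forall i, continuous (u i)) ->
    S (fun x => phi x * \sum_i u i x * S (v i)) = \sum_i S (fun x => phi x * u i x) * S (v i).
  move=> cu; rewrite (_ : (fun x => _) = fun x => \sum_i (S (v i) * (phi x * u i x))); last first.
    by apply/funext => x; rewrite mulr_sumr; apply: eq_bigr => i _; ring.
  rewrite (state_sum hS) => [|i].
    by apply: eq_bigr => i _; rewrite (stateZ hS) 1?mulrC//; exact: continuous_mul.
  by apply: continuous_mul; [exact: continuous_cst|exact: continuous_mul].
have csum2 q (u v : 'I_q -> M -> R) : (forall i, continuous (u i)) ->
    continuous (fun x => phi x * \sum_i u i x * S (v i)).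
  move=> cu; apply: continuous_mul => //; apply: continuous_bigsum => i.
  by apply: continuous_mul => //; exact: continuous_cst.
rewrite -!lin2// -(stateZ hS)// -(stateD hS)//; last 2 first.
- exact: csum2.
- by apply: continuous_mul => //; exact: continuous_cst.
apply: (state_le hS).
- exact: csum2.
- by apply: continuous_add; [exact: csum2|apply: continuous_mul => //; exact: continuous_cst].
by move=> x; rewrite [e * _]mulrC -mulrDr; apply: ler_wpM2l.
Qed.

(** The double integral of [phi(x)] times the kernel at index [j]. As a functional of [phi] it is an
    energy density; its weighted sums over [j], divided by the total energy, are what converges to
    the limit states. *)
Definition wenergy j S phi : R := \sum_(i < N j) S (fun x => phi x * U j i x) * S (U j i).
Definition energy j S : R := \sum_(i < N j) S (U j i) ^+ 2.

Lemma wenergy1 j S : wenergy j S (fun=> 1) = energy j S.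
Proof.
apply: eq_bigr => i _; rewrite expr2; congr (S _ * _).
by apply/funext => x; rewrite mul1r.
Qed.

Lemma energy_ge0 j S : 0 <= energy j S.
Proof. by apply: sumr_ge0 => i _; exact: sqr_ge0. Qed.

Lemma wenergy_ge0 j S phi : is_state S -> continuous phi -> (forall x, 0 <= phi x) ->
  0 <= wenergy j S phi.
Proof.
move=> hS cphi phi0; apply: sumr_ge0 => i _; apply: mulr_ge0; apply: (state_ge0 hS) => //.
  exact: continuous_mul.
by move=> x; exact: mulr_ge0.
Qed.

Lemma wenergy_le j S phi : is_state S -> continuous phi -> (forall x, 0 <= phi x) ->
  wenergy j S phi <= S phi.
Proof.
move=> hS cphi phi0.
have := @kernel_state_le S phi 1 _ 0 (fun i : 'I_(N j) => U j i) (fun i => U j i)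
  (fun=> phi) (fun=> phi) hS cphi phi0.
rewrite big_ord0 add0r mul1r; apply => // x y.
by rewrite big_ord0 add0r; exact: kernel_le1.
Qed.

Lemma energy_le1 j S : is_state S -> energy j S <= 1.
Proof.
move=> hS; rewrite -wenergy1 -[leRHS](state_cst hS); apply: wenergy_le => //.
exact: continuous_cst.
Qed.

Definition push S (f : homeo M) : (M -> R) -> R := fun phi => S (phi \o f).

Lemma push_state S f : is_state S -> is_state (push S f).
Proof. by move=> hS; apply: state_comp => //; exact: homeo_cont. Qed.

Lemma wenergy_shift S phi (f : homeo M) s j : is_state S -> continuous phi ->
  (forall x, 0 <= phi x) -> expansion_set ((n + 3)%:R ^+ s) f ->
  wenergy (s.+2 + j) (push S f) phi <= wenergy j S (phi \o f) + C * (4^-1) ^+ j * S (phi \o f).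
Proof.
move=> hS cphi phi0 hf.
apply: (@kernel_state_le S (phi \o f) _ _ _ (fun i : 'I_(N (s.+2 + j)) => U (s.+2 + j) i \o f)
   (fun i => U (s.+2 + j) i \o f) (fun i : 'I_(N j) => U j i) (fun i => U j i)) => //.
- exact: comp_homeo_continuous.
- by move=> x; exact: phi0.
- by move=> i; exact: comp_homeo_continuous.
- by move=> i; exact: comp_homeo_continuous.
- by move=> x y /=; exact: kernel_shift.
Qed.

(** Two points of the support of [phi] are closer than [scale j.+1], so [phi x * phi y] is below the
    kernel up to the error of [Uclose]; integrating in both variables gives the square. *)
Lemma small_ball_energy S phi j (x0 : M) : is_state S -> continuous phi ->
  (forall x, 0 <= phi x <= 1) -> (forall x, phi x != 0 -> d x0 x < scale j.+1 / 2) ->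
  S phi ^+ 2 <= energy j S + C * (4^-1) ^+ j.
Proof.
move=> hS cphi phi01 sphi.
have := @kernel_state_le S (fun=> 1) (C * (4^-1) ^+ j) 1 _ (fun=> phi) (fun=> phi)
  (fun i : 'I_(N j) => U j i) (fun i => U j i) hS (@continuous_cst _ _ 1) (fun=> ler01).
rewrite big_ord1 -/(wenergy j S (fun=> 1)) wenergy1 (state_cst hS) mulr1 expr2.
rewrite (_ : (fun x => 1 * phi x) = phi); last by apply/funext => x; rewrite mul1r.
apply => // x y; rewrite big_ord1.
have Ce : 0 <= C * (4^-1) ^+ j by rewrite mulr_ge0 ?exprn_ge0 ?ltW.
have K0 : 0 <= \sum_(i < N j) U j i x * U j i y by apply: sumr_ge0 => i _; exact: mulr_ge0.
have [->|px] := eqVneq (phi x) 0; first by rewrite mul0r addr_ge0.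
have [->|py] := eqVneq (phi y) 0; first by rewrite mulr0 addr_ge0.
apply: (@le_trans _ _ 1).
  have /andP[? ?] := phi01 x; have /andP[? ?] := phi01 y.
  by rewrite -[1]mul1r; apply: ler_pM.
apply: Uclose; have := rdist_tri hcon x x0 y; rewrite (rdistC x x0).
have := sphi x px; have := sphi y py; lra.
Qed.

(** For [1 < lam] the full series may diverge; the cutoff [J] keeps it finite, and the growth and
    contraction estimates are uniform in [J]. *)
Definition wtotal J (lam : R) S phi : R := \sum_(j < J) lam ^+ j * wenergy j S phi.
Definition total J (lam : R) S : R := \sum_(j < J) lam ^+ j * energy j S.

Lemma wtotal1 J lam S : wtotal J lam S (fun=> 1) = total J lam S.
Proof. by apply: eq_bigr => j _; rewrite wenergy1. Qed.

Lemma total_ge0 J (lam : R) S : 0 <= lam -> 0 <= total J lam S.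
Proof. by move=> l0; apply: sumr_ge0 => j _; rewrite mulr_ge0 ?exprn_ge0 ?energy_ge0. Qed.

Lemma wtotal_ge0 J (lam : R) S phi : 0 <= lam -> is_state S -> continuous phi ->
  (forall x, 0 <= phi x) -> 0 <= wtotal J lam S phi.
Proof. by move=> l0 hS c p; apply: sumr_ge0 => j _; rewrite mulr_ge0 ?exprn_ge0 ?wenergy_ge0. Qed.

Lemma geometric_total_le J (lam : R) : 1 <= lam -> lam <= 2 ->
  \sum_(j < J) lam ^+ j * (C * (4^-1) ^+ j) <= 2 * C.
Proof.
move=> l1 l2; apply: (@le_trans _ _ (\sum_(j < J) C * 2^-1 ^+ j)); last first.
  by rewrite -mulr_sumr mulrC; apply: (ler_wpM2r (ltW C0)); exact: half_geometric_le.
apply: ler_sum => j _; rewrite mulrCA -exprMn ler_pM2l//.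
by apply: lerXn2r; rewrite ?nnegrE; lra.
Qed.

Lemma wtotal_shift J (lam : R) S phi (f : homeo M) s : 1 <= lam -> lam <= 2 ->
  is_state S -> continuous phi -> (forall x, 0 <= phi x <= 1) ->
  expansion_set ((n + 3)%:R ^+ s) f ->
  wtotal J lam (push S f) phi <= lam ^+ s.+2 * (wtotal J lam S (phi \o f) + 2 * C + s.+2%:R).
Proof.
move=> l1 l2 hS cphi phi01 hf; have l0 : 0 <= lam by lra.
have phi0 x : 0 <= phi x by have /andP[] := phi01 x.
have phi1 x : phi x <= 1 by have /andP[] := phi01 x.
have cpf : continuous (phi \o f) by exact: comp_homeo_continuous.
have hP := push_state f hS.
have S1 : S (phi \o f) <= 1 by apply: (state_le_cst hS) => // x; exact: phi1.
(* Raising the cutoff lets the shifted indices match all of [0..J-1]; the first [s.+2] terms are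
   bounded trivially, each by [lam ^+ s.+2]. *)
apply: (@le_trans _ _ (wtotal (s.+2 + J) lam (push S f) phi)).
  rewrite /wtotal addnC big_split_ord /= lerDl; apply: sumr_ge0 => j _.
  by rewrite mulr_ge0 ?exprn_ge0 ?wenergy_ge0.
rewrite /wtotal big_split_ord /= addrC mulrDr mulrDr; apply: lerD; last first.
  apply: (@le_trans _ _ (\sum_(j < s.+2) lam ^+ s.+2)); last first.
    by rewrite sumr_const card_ord mulr_natr.
  apply: ler_sum => j _; rewrite -[leRHS]mulr1; apply: ler_pM; rewrite ?exprn_ge0 ?wenergy_ge0//.
    by apply: ler_weXn2l => //; exact: ltnW.
  apply: le_trans (wenergy_le _ hP cphi phi0) _.
  exact: S1.
rewrite -mulrDr.
apply: (@le_trans _ _ (\sum_(j < J) lam ^+ s.+2 * (lam ^+ j * wenergy j S (phi \o f) + lam ^+ j * (C * (4^-1) ^+ j)))).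
  apply: ler_sum => j _; rewrite exprD -mulrA ler_wpM2l ?exprn_ge0// -mulrDr ler_wpM2l ?exprn_ge0//.
  apply: le_trans (wenergy_shift _ hS cphi phi0 hf) _.
  by rewrite lerD2l; apply: ler_piMr => //; rewrite mulr_ge0 ?exprn_ge0 ?(ltW C0).
rewrite -mulr_sumr ler_wpM2l ?exprn_ge0// big_split/= lerD2l.
exact: geometric_total_le.
Qed.

Lemma total_shift J (lam : R) S (f : homeo M) s : 1 <= lam -> lam <= 2 -> is_state S ->
  expansion_set ((n + 3)%:R ^+ s) f ->
  total J lam (push S f) <= lam ^+ s.+2 * (total J lam S + 2 * C + s.+2%:R).
Proof.
move=> l1 l2 hS hf; rewrite -!wtotal1.
by apply: (@wtotal_shift J lam S (fun=> 1) f s) => // x; rewrite ?ler01 ?lexx//; exact: cvg_cst.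
Qed.

Lemma total_le J (lam : R) S : 1 <= lam -> is_state S -> total J lam S <= J%:R * lam ^+ J.
Proof.
move=> l1 hS; have l0 : 0 <= lam by lra.
apply: (@le_trans _ _ (\sum_(j < J) lam ^+ J)); last by rewrite sumr_const card_ord mulr_natl.
apply: ler_sum => j _; rewrite -[leRHS]mulr1; apply: ler_pM; rewrite ?exprn_ge0 ?energy_ge0 ?energy_le1//.
by apply: ler_weXn2l => //; exact: ltnW.
Qed.

(* Layer cake over the sets [expansion_set ((n + 3)%:R ^+ t)], which increase with [t]. *)
Lemma total_push_layers J (lam : R) S (f : homeo M)
    (a := fun t => lam ^+ t.+2 * (total J lam S + 2 * C + t.+2%:R)) :
  1 <= lam -> lam <= 2 -> is_state S ->
  total J lam (push S f) <=
    a 0%N + \sum_(t < J) (a t.+1 - a t) * \1_(~` expansion_set ((n + 3)%:R ^+ t)) f.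
Proof.
move=> l1 l2 hS; have l0 : 0 <= lam by lra.
have V0 := total_ge0 J S l0.
have a_incr t : a t <= a t.+1.
  have t0 : 0 <= t.+2%:R :> R := ler0n _ _.
  apply: ler_pM; [exact: exprn_ge0| |exact: ler_weXn2l|by rewrite lerD2l ler_nat].
  by move: (t.+2%:R : R) t0 => u u0; rewrite !addr_ge0// mulr_ge0// ltW.
have term_ge0 t : 0 <= (a t.+1 - a t) * \1_(~` expansion_set ((n + 3)%:R ^+ t)) f.
  by rewrite mulr_ge0// subr_ge0.
have claim m : (forall t, (t < m)%N -> ~ expansion_set ((n + 3)%:R ^+ t) f) ->
    a m = a 0%N + \sum_(t < m) (a t.+1 - a t) * \1_(~` expansion_set ((n + 3)%:R ^+ t)) f.
  move=> h; rewrite (eq_bigr (fun t : 'I_m => a t.+1 - a t)) => [|t _]; last first.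
    rewrite indicE mem_set ?mulr1//; exact: h.
  by rewrite -(big_mkord xpredT (fun t => a t.+1 - a t)) telescope_sumr// addrC subrK.
have [[t0 [t0J ht0 mt0]]|none] := pselect (exists t0, [/\ (t0 <= J)%N, expansion_set ((n + 3)%:R ^+ t0) f &
    forall t, (t < t0)%N -> ~ expansion_set ((n + 3)%:R ^+ t) f]).
  apply: le_trans (total_shift J l1 l2 hS ht0) _.
  rewrite -/(a t0) (claim t0 mt0) lerD2l.
  rewrite -(subnKC t0J) big_split_ord /= lerDl; apply: sumr_ge0 => t _; exact: term_ge0.
(* Here all layers below [J] are counted, so the right-hand side is [a J], which exceeds the trivial
   bound [total_le]. *)
have all_out t : (t < J)%N -> ~ expansion_set ((n + 3)%:R ^+ t) f.
  elim/ltn_ind: t => t IH tJ ht; apply: none; exists t; split => //; first exact: ltnW.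
  by move=> t' t't; apply: IH => //; exact: ltn_trans t't tJ.
rewrite -(claim J all_out); apply: le_trans (total_le J l1 (push_state f hS)) _.
rewrite /a mulrC; apply: ler_pM; rewrite ?exprn_ge0//.
  by apply: ler_weXn2l => //; lia.
apply: (@le_trans _ _ J.+2%:R); first by rewrite ler_nat; lia.
by rewrite lerDr addr_ge0// mulr_ge0// ltW.
Qed.

Lemma push_sqr_bdd S (c : R) j i : is_state S ->
  bdd_measurable (fun f : homeo M => (push S f (U j i) - c) ^+ 2).
Proof.
move=> hS; have [mb [b hb]] := state_homeo_bdd hcpt hcon hS (cU (j:=j) (i:=i)).
split.
  apply: (@measurable_funX _ _ _ setT (fun f : borel (homeo M) => push S f (U j i) - c) 2%N).
  by apply: measurable_funB => //; exact: measurable_cst.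
exists ((b + `|c|) ^+ 2) => f; rewrite normrX; apply: lerXn2r; rewrite ?nnegrE//.
  by apply: addr_ge0 => //; apply: le_trans (hb f).
by apply: le_trans (ler_normB _ _) _; rewrite lerD2r; exact: hb.
Qed.

Lemma layered_push_bdd J lam S (c : nat -> nat -> R) : is_state S ->
  bdd_measurable (fun f : homeo M =>
    \sum_(j < J) lam ^+ j * \sum_(i < N j) (push S f (U j i) - c j i) ^+ 2).
Proof.
move=> hS; apply: bdd_sum => j.
have := bdd_lin (lam ^+ j) (bdd_sum (index_enum 'I_(N j)) (fun i => push_sqr_bdd (c j i) j i hS))
  (bdd_cst _ 0).
by congr bdd_measurable; apply/funext => f; rewrite addr0.
Qed.

Lemma total_push_bdd J lam S : is_state S ->
  bdd_measurable (fun f : homeo M => total J lam (push S f)).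
Proof.
move=> hS; have := layered_push_bdd J lam (fun _ _ => 0) hS.
congr bdd_measurable; apply/funext => f; apply: eq_bigr => j _; congr (_ * _).
by apply: eq_bigr => i _; rewrite subr0.
Qed.

(** Only the increments [a t.+1 - a t] meet the tails, and their dependence on the total carries the
    factor [lam - 1], so its coefficient is [1 + O(lam - 1)]. The number [x] bounds [lam * q] away
    from 1 independently of [lam]. *)
Lemma mean_total_push (mu : probability (borel (homeo M)) R) J (lam q x C1 : R) S :
  1 <= lam -> lam <= 2 -> is_state S -> 0 <= q -> lam * q <= x -> x < 1 -> 0 <= C1 ->
  (forall t, fine (mu (~` expansion_set ((n + 3)%:R ^+ t))) <= C1 * q ^+ t) ->
  mean mu (fun f => total J lam (push S f)) <=
   lam ^+ 2 * (total J lam S + 2 * C + 2) +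
    4 * C1 * ((lam - 1) * (total J lam S + 2 * C) + 4) * ((1 - x) ^+ 2)^-1.
Proof.
move=> l1 l2 hS q0 lqx x1 C10 tail; have l0 : 0 <= lam by lra.
have V0 := total_ge0 J S l0; set V := total J lam S in V0 *.
pose a t := lam ^+ t.+2 * (V + 2 * C + t.+2%:R).
pose G t : set (homeo M) := ~` expansion_set ((n + 3)%:R ^+ t).
have mG t : measurable (G t : set (borel (homeo M))).
  by apply: borel_open; exact: expansion_setC_open.
have bind t : bdd_measurable (\1_(G t) : homeo M -> R) by exact: bdd_indic.
have bterm t : bdd_measurable (fun f => (a t.+1 - a t) * \1_(G t) f).
  have := bdd_lin (a t.+1 - a t) (bind t) (bdd_cst _ 0).
  by congr bdd_measurable; apply/funext => f; rewrite addr0.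
have mterm t : mean mu (fun f => (a t.+1 - a t) * \1_(G t) f) = (a t.+1 - a t) * fine (mu (G t)).
  rewrite -(mean_indic mu (mG t)) -[RHS]addr0 -(mean_cst mu 0) -mean_lin//; last exact: bdd_cst.
  by congr mean; apply/funext => f; rewrite addr0.
have bsum : bdd_measurable (fun f => \sum_(t < J) (a t.+1 - a t) * \1_(G t) f).
  by apply: bdd_sum => t.
apply: (@le_trans _ _ (mean mu (fun f => 1 * a 0%N + \sum_(t < J) (a t.+1 - a t) * \1_(G t) f))).
  apply: mean_le; [exact: total_push_bdd|exact: bdd_lin (bdd_cst _ _) bsum|].
  by move=> f; rewrite mul1r; exact: total_push_layers.
rewrite (mean_lin mu 1 (bdd_cst _ (a 0%N)) bsum) mean_cst mul1r mean_sum//.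
apply: lerD; first by [].
apply: (@le_trans _ _ (\sum_(t < J) 4 * C1 * ((lam - 1) * (V + 2 * C) + 4) * (t.+1%:R * x ^+ t))); last first.
  rewrite -mulr_sumr; apply: ler_wpM2l.
    by rewrite !mulr_ge0// addr_ge0// mulr_ge0//; [lra|rewrite addr_ge0// mulr_ge0// ltW].
  by apply: arith_geometric_le => //; apply: le_trans lqx; rewrite mulr_ge0.
apply: ler_sum => t _; rewrite mterm.
have -> : a t.+1 - a t = lam ^+ t.+2 * ((lam - 1) * (V + 2 * C) + (lam - 1) * t.+2%:R + lam).
  by rewrite /a -(natr1 t.+2) (exprS lam t.+2); ring.
have W0 : 0 <= (lam - 1) * (V + 2 * C).
  by rewrite mulr_ge0//; [lra|rewrite addr_ge0// mulr_ge0// ltW].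
have t1 : 1 <= t.+1%:R :> R by rewrite ler1n.
have b1 : (lam - 1) * (V + 2 * C) + (lam - 1) * t.+2%:R + lam <= ((lam - 1) * (V + 2 * C) + 4) * t.+1%:R.
  rewrite -(natr1 t.+1); move: (t.+1%:R : R) t1 => u u1; nra.
have p0 : 0 <= (lam - 1) * (V + 2 * C) + (lam - 1) * t.+2%:R + lam.
  by rewrite !addr_ge0// mulr_ge0//; lra.
have f0 : 0 <= fine (mu (G t)) by rewrite fine_ge0.
apply: (@le_trans _ _ (lam ^+ t.+2 * (((lam - 1) * (V + 2 * C) + 4) * t.+1%:R) * (C1 * q ^+ t))).
  apply: ler_pM => //; first by rewrite mulr_ge0 ?exprn_ge0.
    by apply: ler_wpM2l => //; rewrite exprn_ge0.
  exact: tail.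
have l4 : lam ^+ 2 <= 4 by rewrite -[4](_ : 2 ^+ 2 = _); [apply: lerXn2r; rewrite ?nnegrE|rewrite -natrX].
have lqt : (lam * q) ^+ t <= x ^+ t.
  by apply: lerXn2r; rewrite ?nnegrE ?mulr_ge0//; apply: le_trans lqx; rewrite mulr_ge0.
have -> : lam ^+ t.+2 * (((lam - 1) * (V + 2 * C) + 4) * t.+1%:R) * (C1 * q ^+ t) =
  (lam ^+ 2 * (lam * q) ^+ t) * (C1 * ((lam - 1) * (V + 2 * C) + 4) * t.+1%:R).
  by rewrite exprMn !exprS; ring.
have -> : 4 * C1 * ((lam - 1) * (V + 2 * C) + 4) * (t.+1%:R * x ^+ t) =
  (4 * x ^+ t) * (C1 * ((lam - 1) * (V + 2 * C) + 4) * t.+1%:R) by ring.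
apply: ler_wpM2r; first by rewrite !mulr_ge0// addr_ge0.
by apply: ler_pM; rewrite ?exprn_ge0// mulr_ge0.
Qed.

(** Weighted squared distance between the feature vectors of [push S f] and [S']; for
    [S' = convolve mu S] its mean is the total variance. *)
Definition spread J (lam : R) S S' (f : homeo M) : R :=
  \sum_(j < J) lam ^+ j * \sum_(i < N j) (push S f (U j i) - S' (U j i)) ^+ 2.

Lemma spread_ge0 J (lam : R) S S' f : 0 <= lam -> 0 <= spread J lam S S' f.
Proof.
move=> l0; apply: sumr_ge0 => j _; rewrite mulr_ge0 ?exprn_ge0//.
by apply: sumr_ge0 => i _; exact: sqr_ge0.
Qed.

Lemma spread_bdd J (lam : R) S S' : is_state S -> bdd_measurable (spread J lam S S').
Proof. by move=> hS; exact: (layered_push_bdd J lam (fun j i => S' (U j i)) hS). Qed.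

Lemma mean_spread (mu : probability (borel (homeo M)) R) J lam S : is_state S ->
  mean mu (spread J lam S (convolve mu S)) =
  mean mu (fun f => total J lam (push S f)) - total J lam (convolve mu S).
Proof.
move=> hS; have bq (c : R) j i := push_sqr_bdd c j i hS.
have bq0 j i : bdd_measurable (fun f : homeo M => push S f (U j i) ^+ 2).
  have := bq 0 j i; congr bdd_measurable; apply/funext => f; by rewrite subr0.
have bs (c : nat -> R) j : bdd_measurable (fun f : homeo M => \sum_(i < N j) (push S f (U j i) - c i) ^+ 2).
  by apply: bdd_sum => i.
have bs0 j : bdd_measurable (fun f : homeo M => \sum_(i < N j) push S f (U j i) ^+ 2).
  by apply: bdd_sum => i.
rewrite /spread /total /energy mean_sum => [|j]; last by apply: bdd_scale; exact: (bs (fun i => convolve mu S (U j i))).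
rewrite mean_sum => [|j]; last by apply: bdd_scale; exact: bs0.
rewrite -sumrB; apply: eq_bigr => j _.
rewrite mean_scale; last exact: (bs (fun i => convolve mu S (U j i))).
rewrite mean_scale; last exact: bs0.
rewrite -mulrBr; congr (_ * _).
rewrite mean_sum => [|i]; last exact: bq.
rewrite mean_sum => [|i]; last exact: bq0.
rewrite -sumrB; apply: eq_bigr => i _; set c := convolve _ _ _.
have bp : bdd_measurable (fun f : homeo M => push S f (U j i)) by exact: state_homeo_bdd.
have -> : (fun f : homeo M => (push S f (U j i) - c) ^+ 2) =
    (fun f => (- 2 * c) * push S f (U j i) + (1 * push S f (U j i) ^+ 2 + c ^+ 2)).
  by apply/funext => f; ring.
rewrite mean_lin//; last by apply: bdd_lin => //; exact: bdd_cst.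
rewrite mean_lin ?mean_cst//; last exact: bdd_cst.
have -> : mean mu (fun f : homeo M => push S f (U j i)) = c by [].
ring.
Qed.

Lemma total_convolve_le (mu : probability (borel (homeo M)) R) J (lam : R) S : 0 <= lam -> is_state S ->
  total J lam (convolve mu S) <= mean mu (fun f => total J lam (push S f)).
Proof.
move=> l0 hS; rewrite -subr_ge0 -mean_spread// -(mean_cst mu 0).
apply: mean_le; [exact: bdd_cst|exact: spread_bdd|move=> f; exact: spread_ge0].
Qed.

(** * Transport of energy densities under small variance *)

Lemma wtotal_lin J lam S (a : R) phi psi : is_state S -> continuous phi -> continuous psi ->
  wtotal J lam S (fun x => a * phi x + psi x) = a * wtotal J lam S phi + wtotal J lam S psi.
Proof.
move=> hS cp cq; rewrite mulr_sumr -big_split; apply: eq_bigr => j _.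
rewrite /= [a * _]mulrCA -mulrDr; congr (_ * _).
rewrite mulr_sumr -big_split; apply: eq_bigr => i _.
rewrite /= mulrA -mulrDl; congr (_ * _).
have [lin _ _] := hS; rewrite -lin.
- by congr S; apply/funext => x; rewrite mulrDl mulrA.
- exact: continuous_mul.
- exact: continuous_mul.
Qed.

Lemma wtotal_le J (lam : R) S phi psi : 0 <= lam -> is_state S -> continuous phi -> continuous psi ->
  (forall x, phi x <= psi x) -> wtotal J lam S phi <= wtotal J lam S psi.
Proof.
move=> l0 hS cp cq pq; rewrite -subr_ge0 addrC -mulN1r -wtotal_lin//.
apply: wtotal_ge0 => //.
  by apply: continuous_add => //; apply: continuous_mul => //; exact: continuous_cst.
by move=> x; rewrite mulN1r addrC subr_ge0.
Qed.

(* Reading [phi] at the centres [z j i] makes the dependence on the state purely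
   quadratic, at the price of the oscillation of [phi] at scale [j]. *)
Definition localized J (lam : R) S phi : R :=
  \sum_(j < J) lam ^+ j * \sum_(i < N j) phi (z j i) * S (U j i) ^+ 2.

Lemma oscillation_le S phi (e : R) j : is_state S -> continuous phi -> 0 <= e ->
  (forall i x, U j i x != 0 -> `|phi x - phi (z j i)| <= e) ->
  `|wenergy j S phi - \sum_(i < N j) phi (z j i) * S (U j i) ^+ 2| <= e * energy j S.
Proof.
move=> hS cp e0 osc; rewrite -sumrB mulr_sumr.
apply: le_trans (ler_norm_sum _ _ _) _; apply: ler_sum => i _.
have Uge0 : 0 <= S (U j i) by apply: (state_ge0 hS).
rewrite expr2 mulrA -mulrBl normrM (ger0_norm Uge0) mulrA ler_wpM2r//.
rewrite -(stateZ hS)// -(stateZ hS)//.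
have cm : continuous (fun x => phi x * U j i x) by exact: continuous_mul.
have cc (c : R) : continuous (fun x => c * U j i x).
  by apply: continuous_mul => //; exact: continuous_cst.
have key x : `|phi x * U j i x - phi (z j i) * U j i x| <= e * U j i x.
  rewrite -mulrBl normrM (ger0_norm (U0 _ _ _)).
  have [->|Ux] := eqVneq (U j i x) 0; first by rewrite !mulr0.
  by rewrite ler_wpM2r//; exact: osc.
rewrite -(stateB hS)// ler_norml -mulN1r -(stateZ hS)//; apply/andP; split.
  apply: (state_le hS); [|exact: continuous_sub|].
    by apply: continuous_mul => //; exact: continuous_cst.
  by move=> x; have := key x; rewrite ler_norml mulN1r => /andP[].
apply: (state_le hS) => //; first exact: continuous_sub.
by move=> x; have := key x; rewrite ler_norml => /andP[].
Qed.

Lemma scale_small (r : R) : 0 < r -> exists j0, forall j, (j0 <= j)%N -> 2 * scale j < r.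
Proof.
move=> r0; exists (Num.truncn (2 / r)).+1 => j hj.
apply: (@le_lt_trans _ _ (2 * 4^-1 ^+ j)); first by rewrite ler_pM2l//; exact: scale_geometric.
rewrite exprVn -[_ / _]/(2 * (4 ^+ j)^-1) ltr_pdivrMr ?exprn_gt0// -ltr_pdivrMl// mulrC.
apply: (@lt_le_trans _ _ (Num.truncn (2 / r)).+1%:R); first exact: truncnS_gt.
rewrite -natrX ler_nat; apply: leq_trans hj _; apply: ltnW; exact: ltn_expl.
Qed.

Lemma localization phi (e : R) : continuous phi -> (forall x, 0 <= phi x <= 1) -> 0 < e ->
  exists2 B : R, 0 < B & forall J lam S, 1 <= lam -> lam <= 2 -> is_state S ->
    `|wtotal J lam S phi - localized J lam S phi| <= e * total J lam S + B.
Proof.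
move=> cp p01 e0; have [r r0 hr] := continuous_unif hcpt hcon cp e0.
have [j0 hj0] := scale_small r0.
(* Below [j0] the oscillation of [phi] is not small, but the term of index [j] is at most [2 ^+ j],
   hence at most [4 ^+ j0 * 2^-1 ^+ j], and these sum to [4 ^+ j0 * 2]. *)
exists (4 ^+ j0 * 2); first by rewrite mulr_gt0 ?exprn_gt0.
move=> J lam S l1 l2 hS; have l0 : 0 <= lam by lra.
rewrite -sumrB; apply: le_trans (ler_norm_sum _ _ _) _.
apply: (@le_trans _ _ (\sum_(j < J) (e * (lam ^+ j * energy j S) + 4 ^+ j0 * 2^-1 ^+ j))); last first.
  rewrite big_split/= -!mulr_sumr lerD2l ler_pM2l ?exprn_gt0//.
  exact: half_geometric_le.
apply: ler_sum => j _; rewrite -mulrBr normrM (ger0_norm (exprn_ge0 _ l0)).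
have [j0j|jj0] := leqP j0 j.
  apply: (@le_trans _ _ (e * (lam ^+ j * energy j S))); last first.
    by rewrite lerDl mulr_ge0// exprn_ge0.
  rewrite mulrCA ler_wpM2l ?exprn_ge0//; apply: oscillation_le => //; first exact: ltW.
  by move=> i x /Usupp lt; apply/ltW/hr; apply: lt_trans lt _; exact: hj0.
apply: (@le_trans _ _ (4 ^+ j0 * 2^-1 ^+ j)); last first.
  by rewrite lerDr mulr_ge0 ?(ltW e0)// mulr_ge0 ?exprn_ge0 ?energy_ge0.
apply: (@le_trans _ _ (2 ^+ j)).
  rewrite -[leRHS]mulr1; apply: ler_pM; rewrite ?exprn_ge0//.
    by apply: lerXn2r; rewrite ?nnegrE//.
  apply: (@le_trans _ _ (1 * energy j S)); last by rewrite mul1r energy_le1.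
  apply: oscillation_le => // i x _; rewrite ler_norml.
  by have /andP[? ?] := p01 x; have /andP[? ?] := p01 (z j i); apply/andP; split; lra.
have -> : 2 ^+ j = 4 ^+ j * 2^-1 ^+ j :> R by rewrite -exprMn; congr (_ ^+ _); lra.
by rewrite ler_wpM2r ?exprn_ge0//; apply: ler_weXn2l; [lra|exact: ltnW].
Qed.

Lemma localized_dist_le J (lam tau : R) S S' phi (f : homeo M) : 0 <= lam -> 0 < tau ->
  (forall x, 0 <= phi x <= 1) ->
  localized J lam S' phi <= localized J lam (push S f) phi +
    spread J lam S S' f / (2 * tau) + tau * (total J lam (push S f) + total J lam S').
Proof.
move=> l0 t0 p01.
have -> : localized J lam (push S f) phi + spread J lam S S' f / (2 * tau) +
   tau * (total J lam (push S f) + total J lam S') =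
  \sum_(j < J) lam ^+ j * \sum_(i < N j) (phi (z j i) * push S f (U j i) ^+ 2 +
     (push S f (U j i) - S' (U j i)) ^+ 2 / (2 * tau) +
     tau * (push S f (U j i) ^+ 2 + S' (U j i) ^+ 2)).
  rewrite mulrDr /total /spread /localized mulr_suml !mulr_sumr -!big_split/=.
  apply: eq_bigr => j _; rewrite !big_split/= -mulr_suml -mulr_sumr big_split/= /energy; ring.
apply: ler_sum => j _; apply: ler_wpM2l; first exact: exprn_ge0.
apply: ler_sum => i _; have /andP[] := p01 (z j i).
move: (phi (z j i)) (push S f (U j i)) (S' (U j i)) => p a b p0 p1.
rewrite -addrA -lerBlDl.
have -> : p * b ^+ 2 - p * a ^+ 2 = p * ((b - a) * (b + a)) by ring.
(* Young's inequality with parameter [tau]; the difference of the two sides is a sum of squares. *)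
have h : (b - a) * (b + a) <= (a - b) ^+ 2 / (2 * tau) + tau * (a ^+ 2 + b ^+ 2).
  rewrite -subr_ge0.
  have -> : (a - b) ^+ 2 / (2 * tau) + tau * (a ^+ 2 + b ^+ 2) - (b - a) * (b + a) =
    ((a - b + tau * (a + b)) ^+ 2 + tau ^+ 2 * (a - b) ^+ 2) / (2 * tau) by field; lra.
  apply: divr_ge0; last by rewrite mulr_ge0// ltW.
  by apply: addr_ge0; [exact: sqr_ge0|apply: mulr_ge0; exact: sqr_ge0].
have h0 : 0 <= (a - b) ^+ 2 / (2 * tau) + tau * (a ^+ 2 + b ^+ 2).
  apply: addr_ge0; first by apply: divr_ge0; [exact: sqr_ge0|rewrite mulr_ge0// ltW].
  by apply: mulr_ge0; [exact: ltW|apply: addr_ge0; exact: sqr_ge0].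
move: h h0; move: (_ / _ + _) ((b - a) * (b + a)) => u w h h0; nra.
Qed.

(** Reading [phi] at the centres yields quadratic forms, compared between [S'] and [push S g]
    through the small spread; the shift by [g] then relates [push S g] to [S]. Only one inequality
    results because the shift is one-sided. *)
Lemma transport s phi (e : R) : continuous phi -> (forall x, 0 <= phi x <= 1) -> 0 < e ->
  exists eta del0 : R, [/\ 0 < eta, 0 < del0 & forall (del : R) J S S' (g : homeo M),
    0 < del -> del <= del0 -> is_state S -> is_state S' ->
    del^-1 <= total J (1 + del) S -> total J (1 + del) S' <= 2 * total J (1 + del) S ->
    expansion_set ((n + 3)%:R ^+ s) g ->
    spread J (1 + del) S S' g <= eta * total J (1 + del) S ->
    wtotal J (1 + del) S' phi <= wtotal J (1 + del) S (phi \o g) + e * total J (1 + del) S].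
Proof.
move=> cp p01 e0.
have e16 : 0 < e / 16 by rewrite divr_gt0.
have [B B0 hB] := localization cp p01 e16.
set P : R := 2 ^+ s.+2; have P1 : 1 <= P by rewrite exprn_ege1//; lra.
set Q : R := 2 * C + s.+2%:R; have Q0 : 0 < Q.
  by rewrite addr_gt0 ?ltr0n// mulr_gt0.
pose L := P + 2 * B + (1 + P) * Q.
have L0 : 0 < L by rewrite /L addr_gt0// ?mulr_gt0//; lra.
(* Young's inequality is used with [tau = e / 32], which turns [eta = e ^+ 2 / 128] into [e / 8]. As
   [1 <= del * V], all additive constants are multiples of [del * V]; [L] collects the coefficients,
   so [del * L <= e / 4] makes these errors at most [e / 4 * V]. *)
exists (e ^+ 2 / 128), (Num.min (Num.min 1 L^-1) (e / 4 / L)); split.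
- by rewrite divr_gt0 ?exprn_gt0.
- by rewrite !lt_min ltr01 invr_gt0 L0 divr_gt0// divr_gt0.
move=> del J S S' g d0; rewrite !le_min => /andP[/andP[d1 dL] dL2] hS hS' V1 V2 hg hD.
have l0 : 0 <= 1 + del by lra.
have hP := push_state g hS.
set V := total J (1 + del) S in V1 V2 hD *.
have V0 : 0 < V by apply: lt_le_trans V1; rewrite invr_gt0.
have dV : 1 <= del * V by rewrite -ler_pdivrMl// mulr1.
have dL' : del * L <= 1 by rewrite -ler_pdivlMr// mul1r.
have dL2' : del * L <= e / 4 by rewrite -ler_pdivlMr.
have l1 : 1 <= 1 + del by lra.
have l2 : 1 + del <= 2 by lra.
have hW := wtotal_shift J l1 l2 hS cp p01 hg.
have {}hW : wtotal J (1 + del) (push S g) phi <= (1 + del) ^+ s.+2 * (wtotal J (1 + del) S (phi \o g) + Q).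
  by rewrite /Q addrA; exact: hW.
have hVg : total J (1 + del) (push S g) <= (1 + del) ^+ s.+2 * (V + Q).
  by rewrite /Q addrA; apply: total_shift => //; lra.
have W0 : 0 <= wtotal J (1 + del) S (phi \o g).
  apply: wtotal_ge0 => //; first exact: comp_homeo_continuous.
  by move=> x; have /andP[] := p01 (g x).
have W1 : wtotal J (1 + del) S (phi \o g) <= V.
  rewrite /V -wtotal1; apply: wtotal_le => //; first exact: comp_homeo_continuous.
    exact: continuous_cst.
  by move=> x; have /andP[] := p01 (g x).
have hl : (1 + del) ^+ s.+2 <= 1 + P * del by apply: expr1D_le => //; exact: ltW.
have hl1 : 1 <= (1 + del) ^+ s.+2 by rewrite exprn_ege1//; lra.
have dV0 : 0 <= del * V by lra.
have PdQ : (1 + P * del) * Q <= (1 + P) * Q * (del * V).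
  apply: (@le_trans _ _ ((1 + P) * Q)); last by rewrite ler_peMr// mulr_ge0//; lra.
  rewrite ler_pM2r// lerD2l ler_piMr//; lra.
have B2 : 2 * B <= 2 * B * (del * V) by rewrite ler_peMr//; lra.
have tot : P * (del * V) + 2 * B * (del * V) + (1 + P) * Q * (del * V) <= e / 4 * V.
  have -> : P * (del * V) + 2 * B * (del * V) + (1 + P) * Q * (del * V) = del * L * V.
    by rewrite /L; ring.
  by rewrite ler_pM2r.
have tot1 : P * (del * V) + 2 * B * (del * V) + (1 + P) * Q * (del * V) <= V.
  have -> : P * (del * V) + 2 * B * (del * V) + (1 + P) * Q * (del * V) = del * L * V.
    by rewrite /L; ring.
  by rewrite ler_piMl// ltW.
have shift w : 0 <= w -> w <= V ->
    (1 + del) ^+ s.+2 * (w + Q) <= w + P * (del * V) + (1 + P) * Q * (del * V).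
  move=> w0 wV; apply: (@le_trans _ _ ((1 + P * del) * (w + Q))); first by rewrite ler_wpM2r//; lra.
  have : P * del * w <= P * (del * V).
    by rewrite -mulrA ler_wpM2l//; [lra|rewrite ler_pM2l].
  rewrite mulrDr mulrDl mul1r; lra.
have {}hW := le_trans hW (shift _ W0 W1).
have {}hVg := le_trans hVg (shift _ (ltW V0) (lexx V)).
have Bd0 : 0 <= 2 * B * (del * V) by rewrite mulr_ge0//; lra.
have Vg2 : total J (1 + del) (push S g) <= 2 * V by lra.
have Vg0 : 0 <= total J (1 + del) (push S g) by exact: total_ge0.
have h1 := hB J (1 + del) S' l1 l2 hS'.
have h2 := hB J (1 + del) (push S g) l1 l2 hP.
have e32 : 0 < e / 32 by rewrite divr_gt0.
have h3 := @localized_dist_le J (1 + del) (e / 32) S S' phi g l0 e32 p01.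
have hD2 : spread J (1 + del) S S' g / (2 * (e / 32)) <= e / 8 * V.
  rewrite ler_pdivrMr; last lra.
  apply: le_trans hD _; rewrite (_ : e / 8 * V * _ = e ^+ 2 / 128 * V)//; field.
  by [].
move: h1 h2; rewrite !ler_norml => /andP[_ h1] /andP[h2 _].
have a1 : e / 16 * total J (1 + del) S' <= e / 16 * (2 * V) by rewrite ler_pM2l// divr_gt0.
have a2 : e / 16 * total J (1 + del) (push S g) <= e / 16 * (2 * V) by rewrite ler_pM2l// divr_gt0.
have a3 : e / 32 * (total J (1 + del) (push S g) + total J (1 + del) S') <= e / 32 * (4 * V).
  by rewrite ler_pM2l//; lra.
have eV : 0 < e * V by rewrite mulr_gt0.
lra.
Qed.

(** The values at each [phi] stay in a compact interval, so they converge along the ultrafilter, and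
    linearity and positivity pass to the limit. The masses need only tend to 1, since averaging
    changes the total energy. *)
Lemma state_limit (F : set_system nat) (FU : UltraFilter F) (th : nat -> (M -> R) -> R) :
  (forall m (a : R) phi psi, continuous phi -> continuous psi ->
    th m (fun x => a * phi x + psi x) = a * th m phi + th m psi) ->
  (forall m phi, continuous phi -> (forall x, 0 <= phi x) -> 0 <= th m phi) ->
  (forall m, th m (fun=> 1) <= 2) -> th m (fun=> 1) @[m --> F] --> (1 : R) ->
  exists2 I, is_state I & forall phi, continuous phi -> th m phi @[m --> F] --> I phi.
Proof.
move=> lin pos le2 th1.
have c0 (c : R) : continuous (fun _ : M => c) by exact: continuous_cst.
have th0 m : th m (fun=> 0) = 0.
  have := lin m (-1) _ _ (c0 0) (c0 0).
  by rewrite mulr0 addr0 mulN1r addNr.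
have thc m (c : R) : th m (fun=> c) = c * th m (fun=> 1).
  have := lin m c _ _ (c0 1) (c0 0); rewrite th0 [RHS]addr0 => <-.
  by congr th; apply/funext => x; rewrite mulr1 addr0.
have thle m phi psi : continuous phi -> continuous psi -> (forall x, phi x <= psi x) ->
    th m phi <= th m psi.
  move=> cp cq pq; rewrite -subr_ge0 addrC -mulN1r -lin//; apply: pos.
    by apply: continuous_add => //; apply: continuous_mul.
  by move=> x; rewrite mulN1r addrC subr_ge0.
have ex phi : exists l : R, continuous phi -> th m phi @[m --> F] --> l.
  have [cp|ncp] := pselect (continuous phi); last by exists 0.
  have [b b0 hb] := continuous_bounded hcpt cp.
  have [|l _ hl] := ultra_map_compact (u := fun m => th m phi) FU (@segment_compact R (- (2 * b)) (2 * b)).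
    move=> m /=; rewrite in_itv/=; have b2 : b * th m (fun=> 1) <= 2 * b by rewrite [leRHS]mulrC ler_pM2l.
    apply/andP; split.
      apply: (@le_trans _ _ (- b * th m (fun=> 1))); first by rewrite mulNr lerN2.
      rewrite -thc; apply: thle => // x; have := hb x; by rewrite ler_norml => /andP[].
    apply: le_trans b2; rewrite -thc; apply: thle => // x.
    by have := hb x; rewrite ler_norml => /andP[].
  by exists l.
have [I hI] := choice ex; exists I; last by [].
have uniq (u : nat -> R) (a b : R) : u m @[m --> F] --> a -> u m @[m --> F] --> b -> a = b.
  by move=> ha hb; exact: (cvg_unique (@norm_hausdorff R R^o) ha hb).
split.
- move=> a p q cp cq; apply: uniq (hI _ _) _.
    by apply: continuous_add => //; apply: continuous_mul.
  under eq_fun do rewrite lin//.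
  by apply: cvgD; [apply: cvgMr|]; exact: hI.
- move=> p cp p0; have := hI p cp; apply: (closed_cvg _ (@closed_ge _ 0)).
  by apply: filterE => m; exact: pos.
- by apply: uniq (hI _ (c0 1)) _.
Qed.

Definition expansion_tails (mu : probability (borel (homeo M)) R) (C1 q : R) :=
  forall t, fine (mu (~` expansion_set ((n + 3)%:R ^+ t))) <= C1 * q ^+ t.

(** A single constant for both the coefficient of [del * V] and the additive term left by
    [mean_total_push], with [u] standing for [C1 * ((1 - x) ^+ 2)^-1]. *)
Let push_const (u : R) := 3 + 4 * u + 4 * (2 * C + 2) + 4 * u * (2 * C + 4).

Let push_const_gt0 u : 0 <= u -> 0 < push_const u.
Proof.
move=> u0; have C0' := ltW C0.
have a : 0 <= 4 * u by rewrite mulr_ge0.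
have b : 0 <= 4 * (2 * C + 2) by rewrite mulr_ge0// addr_ge0// mulr_ge0.
have c : 0 <= 4 * u * (2 * C + 4) by rewrite mulr_ge0// addr_ge0// mulr_ge0.
by do 3! apply: ltr_wpDr => //.
Qed.

Let push_const_le (u V del : R) : 0 <= u -> 0 <= V -> 0 <= del -> del <= 1 ->
  (1 + del) ^+ 2 * (V + 2 * C + 2) + 4 * u * (del * (V + 2 * C) + 4) <=
  V + push_const u * (del * V) + push_const u.
Proof.
move=> u0 V0 d0 d1; rewrite -subr_ge0.
have -> : V + push_const u * (del * V) + push_const u -
    ((1 + del) ^+ 2 * (V + 2 * C + 2) + 4 * u * (del * (V + 2 * C) + 4)) =
  (del * V) * (1 - del) + 3 + 4 * u + (2 * C + 2) * (3 - 2 * del - del ^+ 2) + 8 * (u * C) * (1 - del) +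
    (4 * (2 * C + 2) + 4 * u * (2 * C + 4)) * (del * V) by rewrite /push_const; ring.
have d2 : del ^+ 2 <= 1 by rewrite exprn_ile1.
have C0' := ltW C0.
have t1 : 0 <= del * V * (1 - del) by apply: mulr_ge0; [exact: mulr_ge0|lra].
have t2 : 0 <= 4 * u by apply: mulr_ge0.
have t3 : 0 <= (2 * C + 2) * (3 - 2 * del - del ^+ 2).
  by apply: mulr_ge0; [apply: addr_ge0 => //; exact: mulr_ge0|lra].
have t4 : 0 <= 8 * (u * C) * (1 - del).
  by apply: mulr_ge0; [apply: mulr_ge0 => //; exact: mulr_ge0|lra].
have t5 : 0 <= (4 * (2 * C + 2) + 4 * u * (2 * C + 4)) * (del * V).
  by rewrite !mulr_ge0// addr_ge0// mulr_ge0// ?mulr_ge0// addr_ge0// mulr_ge0.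
by do 4! apply: addr_ge0 => //; apply: addr_ge0.
Qed.

Lemma mean_total_push_le (C1 q : R) : 0 <= q -> q < 1 -> 0 <= C1 ->
  exists E del0 : R, [/\ 0 < E, 0 < del0, del0 <= 1 &
    forall (mu : probability (borel (homeo M)) R) (del : R) J S, expansion_tails mu C1 q ->
    0 < del -> del <= del0 -> is_state S ->
    mean mu (fun f => total J (1 + del) (push S f)) <=
      total J (1 + del) S + E * (del * total J (1 + del) S) + E].
Proof.
move=> q0 q1 C10; pose Q := ((1 - (1 + q) / 2) ^+ 2)^-1.
have Q0 : 0 <= Q by rewrite invr_ge0 sqr_ge0.
have u0 : 0 <= C1 * Q by rewrite mulr_ge0.
(* For [del <= (1 - q) / 2] one has [(1 + del) * q <= q + del <= (1 + q) / 2 < 1], which is the [x]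
   used in [Q]. *)
exists (push_const (C1 * Q)), ((1 - q) / 2); split.
- exact: push_const_gt0.
- lra.
- lra.
move=> mu del J S tail d0 dq hS.
have l1 : 1 <= 1 + del by lra.
have l2 : 1 + del <= 2 by lra.
have lq : (1 + del) * q <= (1 + q) / 2.
  have : del * q <= del * 1 by rewrite ler_wpM2l//; lra.
  lra.
have x1 : (1 + q) / 2 < 1 by lra.
apply: le_trans (mean_total_push J l1 l2 hS q0 lq x1 C10 tail) _.
have V0 : 0 <= total J (1 + del) S by apply: total_ge0; lra.
apply: le_trans (push_const_le u0 V0 (ltW d0) _); last lra.
by rewrite -/Q (_ : 1 + del - 1 = del) 1?addrAC ?subrr ?add0r// lerD2l -!mulrA [Q * _]mulrC.
Qed.

Lemma wtotal_le_add J (lam : R) S phi psi (e : R) : 0 <= lam -> is_state S -> continuous phi ->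
  continuous psi -> (forall x, phi x <= psi x + e) ->
  wtotal J lam S phi <= wtotal J lam S psi + e * total J lam S.
Proof.
move=> l0 hS cp cq h; have c1 := @continuous_cst R M 1.
rewrite addrC -wtotal1 -wtotal_lin//; apply: wtotal_le => //.
  apply: continuous_add => //; apply: continuous_mul; exact: continuous_cst.
by move=> x; rewrite mulr1 addrC.
Qed.

(** The reverse inequality is [transport] for [1 - phi]. It needs the total of [S'] to be at least
    [1 - del] times that of [S], which accounts for the extra [del]. *)
Lemma transport_dist s phi (e : R) : continuous phi -> (forall x, 0 <= phi x <= 1) -> 0 < e ->
  exists eta del0 : R, [/\ 0 < eta, 0 < del0 & forall (del : R) J S S' (g : homeo M),
    0 < del -> del <= del0 -> is_state S -> is_state S' ->
    del^-1 <= total J (1 + del) S ->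
    (1 - del) * total J (1 + del) S <= total J (1 + del) S' ->
    total J (1 + del) S' <= 2 * total J (1 + del) S ->
    expansion_set ((n + 3)%:R ^+ s) g ->
    spread J (1 + del) S S' g <= eta * total J (1 + del) S ->
    `|wtotal J (1 + del) S' phi - wtotal J (1 + del) S (phi \o g)| <= (e + del) * total J (1 + del) S].
Proof.
move=> cp p01 e0; pose psi x := -1 * phi x + 1.
have c1 := @continuous_cst R M 1.
have cpsi : continuous psi by apply: continuous_add => //; apply: continuous_mul => //; exact: continuous_cst.
have psi01 x : 0 <= psi x <= 1.
  by have /andP[a b] := p01 x; rewrite /psi mulN1r; apply/andP; split; lra.
have [eta1 [d1 [eta10 d10 h1]]] := transport s cp p01 e0.
have [eta2 [d2 [eta20 d20 h2]]] := transport s cpsi psi01 e0.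
exists (Num.min eta1 eta2), (Num.min d1 d2); split; rewrite ?lt_min ?eta10 ?d10//.
move=> del J S S' g d0; rewrite le_min => /andP[dd1 dd2] hS hS' V1 V2 V3 hg hD.
have V0 : 0 < total J (1 + del) S by apply: lt_le_trans V1; rewrite invr_gt0.
have {}h1 : wtotal J (1 + del) S' phi <= wtotal J (1 + del) S (phi \o g) + e * total J (1 + del) S.
  apply: h1 => //; apply: le_trans hD _; apply: ler_wpM2r; first exact: ltW.
  by rewrite ge_min lexx.
have : wtotal J (1 + del) S' psi <= wtotal J (1 + del) S (psi \o g) + e * total J (1 + del) S.
  apply: h2 => //; apply: le_trans hD _; apply: ler_wpM2r; first exact: ltW.
  by rewrite ge_min lexx orbT.
rewrite (wtotal_lin J (1 + del) (-1) hS' cp c1) wtotal1.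
have cpg : continuous (phi \o g) by exact: comp_homeo_continuous.
rewrite (wtotal_lin J (1 + del) (-1) hS cpg c1) wtotal1 => {}h2.
have dV : 0 < del * total J (1 + del) S by exact: mulr_gt0.
rewrite ler_norml mulrDl; apply/andP; split; last lra.
move: V2; rewrite mulrBl mul1r; lra.
Qed.

(** * Contraction of the total energy *)

Section LimitConjugacy.
Variables (F : set_system nat) (FU : UltraFilter F).
Variables (mu_ : nat -> probability (borel (homeo M)) R) (S_ : nat -> (M -> R) -> R).
Variables (J_ : nat -> nat) (del_ : nat -> R) (E C1 q : R).
Hypotheses (q0 : 0 <= q) (q1 : q < 1) (E0 : 0 < E).
Hypotheses (del_gt0 : forall m, 0 < del_ m) (del_cvg : del_ m @[m --> F] --> (0 : R)).
Hypothesis hS : forall m, is_state (S_ m).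
Let V m := total (J_ m) (1 + del_ m) (S_ m).
Let S' m := convolve (mu_ m) (S_ m).
Let V' m := total (J_ m) (1 + del_ m) (S' m).
Hypotheses (V_ge : forall m, (del_ m)^-1 <= V m)
  (V'_ge : forall m, (1 - del_ m) * V m <= V' m)
  (V'_le : forall m, V' m <= (1 + E * del_ m) * V m)
  (V'_le2 : forall m, V' m <= 2 * V m).
Hypothesis mean_spread_le : forall m,
  mean (mu_ m) (spread (J_ m) (1 + del_ m) (S_ m) (S' m)) <= E * del_ m * V m.
Hypothesis tails : forall m, expansion_tails (mu_ m) C1 q.
Variable mu : probability (borel (homeo M)) R.
Hypothesis mu_cvg : (mu_ m : weak_star (homeo M) R) @[m --> F] --> (mu : weak_star (homeo M) R).

Let th m phi := wtotal (J_ m) (1 + del_ m) (S_ m) phi / V m.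
Let th' m phi := wtotal (J_ m) (1 + del_ m) (S' m) phi / V m.

Let V_gt0 m : 0 < V m.
Proof. by apply: lt_le_trans (V_ge m); rewrite invr_gt0. Qed.

Let lam0 m : 0 <= 1 + del_ m. Proof. by have := del_gt0 m; lra. Qed.

Let hS' m : is_state (S' m). Proof. exact: convolve_state. Qed.

(* If the equality failed at [f], it would fail by a definite amount for all [g] near
   [f], a set of positive mass; but all [g] outside a set of small mass satisfy
   [transport_dist]. *)
Let conjugate_unit (I1 I2 : (M -> R) -> R) (f : homeo M) phi :
  (forall phi, continuous phi -> th m phi @[m --> F] --> I1 phi) ->
  (forall phi, continuous phi -> th' m phi @[m --> F] --> I2 phi) ->
  msupport mu f -> continuous phi -> (forall x, 0 <= phi x <= 1) -> I1 (phi \o f) = I2 phi.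
Proof.
move=> hI1 hI2 sf cp p01; apply/eqP; rewrite -subr_eq0 -normr_le0 leNgt; apply/negP.
set a := `| _ | => a0.
have cpc (g : homeo M) : continuous (phi \o g) by exact: comp_homeo_continuous.
 have a8 : 0 < a / 8 by rewrite divr_gt0.
have [r r0 hr] := continuous_unif hcpt hcon cp a8.
have [h [ch h01 hclose [r' r'0 hr']]] := homeo_bump hcpt hcon f r0.
have hb g : `|h g| <= 1 by have /andP[? ?] := h01 g; rewrite ger0_norm.
have bh := bdd_measurable_continuous ch hb.
have c0 : 0 < mean mu h.
  have h0 g : 0 <= h g by have /andP[] := h01 g.
  exact: (mean_bump_gt0 hcon sf bh h0 r'0 hr').
set c := mean mu h in c0.
have [s hs] : exists s, C1 * q ^+ s < c / 4.
  have q_cvg : (C1 * q ^+ s) @[s --> \oo] --> C1 * 0.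
    by apply: cvgMr; apply: cvg_expr; rewrite ger0_norm.
  have /(_ _ (cvgr_lt _ q_cvg _ _)) : forall P : set nat, (\forall s \near \oo, P s) -> exists s, P s.
    by move=> P; exact: filter_ex.
  by apply; rewrite mulr0 divr_gt0.
have [eta [del0 [eta0 del00 htr]]] := transport_dist s cp p01 a8.
have Ee : 0 < c / 4 * (eta / E) by rewrite mulr_gt0 ?divr_gt0.
have [m [[n1 n2] [n3 n4]]] : exists m, (`|I1 (phi \o f) - th m (phi \o f)| < a / 8 /\
    `|I2 phi - th' m phi| < a / 8) /\ (`|c - mean (mu_ m) h| < c / 2 /\
     del_ m < Num.min (Num.min del0 (a / 8)) (c / 4 * (eta / E))).
  apply: (@filter_ex _ F); apply: filterI; apply: filterI.
  - by have /cvgrPdist_lt := hI1 _ (cpc f); exact.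
  - by have /cvgrPdist_lt := hI2 _ cp; exact.
  - have hc : mean (mu_ x) h @[x --> F] --> mean mu h by exact: (@weak_star_mean R _ _ F _ mu_ mu h 1).
    by move/cvgrPdist_lt : hc; apply; rewrite divr_gt0.
  - apply: (cvgr_lt _ del_cvg); rewrite !lt_min del00 a8 Ee//.
move: n4; rewrite !lt_min => /andP[/andP[n4 n5] n6].
have V0 := V_gt0 m.
(* Where [h g > 0], [g] is near [f]; if it were also in the expansion set with small spread,
   [I1 (phi \o f)] would be within less than [a] of [I2 phi]. The mean of the right-hand side is
   below [c / 2], a quarter from each term, while that of [h] exceeds [c / 2]. *)
have pt g : h g <= (eta * V m)^-1 * spread (J_ m) (1 + del_ m) (S_ m) (S' m) g +
    \1_(~` expansion_set ((n + 3)%:R ^+ s)) g.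
  have /andP[h0 h1] := h01 g.
  have D0 : 0 <= (eta * V m)^-1 * spread (J_ m) (1 + del_ m) (S_ m) (S' m) g.
    by apply: mulr_ge0; [rewrite invr_ge0 mulr_ge0// ltW|exact: spread_ge0].
  have [gG|ngG] := pselect (expansion_set ((n + 3)%:R ^+ s) g); last first.
    by rewrite [X in _ + X]indicE mem_set//; apply: (le_trans h1); rewrite lerDr.
  rewrite [X in _ + X]indicE memNset ?addr0; last by move=> /(_ gG).
  have [hD|hD] := leP (eta * V m) (spread (J_ m) (1 + del_ m) (S_ m) (S' m) g).
    by apply: (le_trans h1); rewrite mulrC ler_pdivlMr ?mul1r// mulr_gt0.
  apply: le_trans D0; rewrite leNgt; apply/negP => hg0.
  have := htr (del_ m) (J_ m) (S_ m) (S' m) g (del_gt0 m) (ltW n4) (hS m) (hS' m) (V_ge m)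
    (V'_ge m) (V'_le2 m) gG (ltW hD).
  rewrite -/(V m) -ler_pdivrMr//.
  have -> : `|wtotal (J_ m) (1 + del_ m) (S' m) phi - wtotal (J_ m) (1 + del_ m) (S_ m) (phi \o g)| / V m =
    `|th' m phi - th m (phi \o g)|.
    by rewrite /th /th' -mulrBl normrM (gtr0_norm (_ : 0 < (V m)^-1))// invr_gt0.
  have cf := cpc f; have cg := cpc g.
  have fg x : `|phi (f x) - phi (g x)| < a / 8 by apply: hr; exact: hclose.
  have b1 : th m (phi \o f) <= th m (phi \o g) + a / 8.
    rewrite /th ler_pdivrMr// mulrDl divfK ?gt_eqF//; apply: wtotal_le_add => // x.
    by have := fg x; rewrite ltr_norml /= => /andP[]; lra.
  have b2 : th m (phi \o g) <= th m (phi \o f) + a / 8.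
    rewrite /th ler_pdivrMr// mulrDl divfK ?gt_eqF//; apply: wtotal_le_add => // x.
    by have := fg x; rewrite ltr_norml /= => /andP[]; lra.
  rewrite ler_norml => /andP[? ?]; move: n1 n2; rewrite !ltr_norml => /andP[? ?] /andP[? ?].
  have : `|I1 (phi \o f) - I2 phi| < a by rewrite ltr_norml; apply/andP; split; lra.
  by rewrite ltxx.
have bG : bdd_measurable (\1_(~` expansion_set ((n + 3)%:R ^+ s)) : homeo M -> R).
  by apply: bdd_indic; apply: borel_open; exact: expansion_setC_open.
have bD := spread_bdd (J_ m) (1 + del_ m) (S' m) (hS m).
have := mean_le (mu_ m) bh (bdd_lin (eta * V m)^-1 bD bG) pt.
rewrite mean_lin// mean_indic; last by apply: borel_open; exact: expansion_setC_open.
have e1 : (eta * V m)^-1 * mean (mu_ m) (spread (J_ m) (1 + del_ m) (S_ m) (S' m)) <= c / 4.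
  rewrite mulrC ler_pdivrMr ?mulr_gt0//; apply: le_trans (mean_spread_le m) _.
  rewrite mulrA ler_pM2r//; move: n6; rewrite mulrA ltr_pdivlMr// => /ltW; rewrite mulrC; exact.
have := tails m s; move: n3; rewrite ltr_norml => /andP[? ?]; lra.
Qed.

Lemma limit_conjugacy : exists I1 I2 : (M -> R) -> R, [/\ is_state I1, is_state I2 &
  forall (f : homeo M) phi, msupport mu f -> continuous phi -> I1 (phi \o f) = I2 phi].
Proof.
have lin m (S : (M -> R) -> R) (a : R) phi psi : is_state S -> continuous phi -> continuous psi ->
    wtotal (J_ m) (1 + del_ m) S (fun x => a * phi x + psi x) / V m =
    a * (wtotal (J_ m) (1 + del_ m) S phi / V m) + wtotal (J_ m) (1 + del_ m) S psi / V m.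
  by move=> hs cp cq; rewrite wtotal_lin// mulrDl mulrA.
have pos m (S : (M -> R) -> R) phi : is_state S -> continuous phi -> (forall x, 0 <= phi x) ->
    0 <= wtotal (J_ m) (1 + del_ m) S phi / V m.
  move=> hs cp p0; apply: divr_ge0; [exact: wtotal_ge0|exact: ltW].
have [I1 hI1 cI1] : exists2 I, is_state I & forall phi, continuous phi -> th m phi @[m --> F] --> I phi.
  have th1 m : th m (fun=> 1) = 1 by rewrite /th wtotal1 -/(V m) divff// gt_eqF// V_gt0.
  apply: state_limit => //.
  - by move=> m a p r; exact: lin.
  - by move=> m p; exact: pos.
  - by move=> m; rewrite th1; lra.
  - by under eq_fun do rewrite th1; exact: cvg_cst.
have [I2 hI2 cI2] : exists2 I, is_state I & forall phi, continuous phi -> th' m phi @[m --> F] --> I phi.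
  have th1 m : th' m (fun=> 1) = V' m / V m by rewrite /th' wtotal1.
  apply: state_limit => //.
  - by move=> m a p r; exact: lin.
  - by move=> m p; exact: pos.
  - by move=> m; rewrite th1 ler_pdivrMr.
  - under eq_fun do rewrite th1.
    have lo : 1 - del_ m @[m --> F] --> (1 : R).
      by rewrite -[X in _ --> X](subr0 1); apply: cvgB => //; exact: cvg_cst.
    have hi : 1 + E * del_ m @[m --> F] --> (1 : R).
      rewrite -[X in _ --> X](addr0 1); apply: cvgD; first exact: cvg_cst.
      by rewrite -[X in _ --> X](mulr0 E); exact: cvgMr.
    have near m : 1 - del_ m <= V' m / V m <= 1 + E * del_ m.
      by rewrite ler_pdivlMr// ler_pdivrMr// V'_ge V'_le.
    exact: (squeeze_cvgr (filterE _ near) lo hi).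
exists I1, I2; split => // f phi sf cp.
have [b b0 hb] := continuous_bounded hcpt cp.
(* This affine change brings the values from [[-b, b]] into [[0, 1]], and states commute with it. *)
pose psi x := (2 * b)^-1 * phi x + 2^-1.
have b20 : 0 < 2 * b by rewrite mulr_gt0.
have cpsi : continuous psi.
  by apply: continuous_add; [apply: continuous_mul => //; exact: continuous_cst|exact: continuous_cst].
have psi01 x : 0 <= psi x <= 1.
  have := hb x; rewrite ler_norml => /andP[? ?]; rewrite /psi mulrC; apply/andP; split.
    by rewrite -lerBlDr sub0r -[- 2^-1](_ : - b / (2 * b) = _) ?ler_pM2r ?invr_gt0//; field; rewrite gt_eqF.
  by rewrite -lerBrDr (_ : 1 - 2^-1 = b / (2 * b)) ?ler_pM2r ?invr_gt0//; field; rewrite gt_eqF.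
have back (I : (M -> R) -> R) : is_state I -> forall p, continuous p -> I p = 2 * b * I (fun x => (2 * b)^-1 * p x + 2^-1) - b.
  move=> hI p cp'; have [linI _ _] := hI; rewrite linI//; last exact: continuous_cst.
  by rewrite (state_cst hI); field; rewrite gt_eqF.
have cpf : continuous (phi \o f) by exact: comp_homeo_continuous.
rewrite (back I1 hI1 _ cpf) (back I2 hI2 _ cp); congr (_ * _ - _).
exact: (conjugate_unit cI1 cI2 sf cpsi psi01).
Qed.

End LimitConjugacy.

(** The additive term [(del ^+ 2)^-1] makes failures informative: along failures with [del] tending
    to 0 it forces the total energy to be at least [1 / del], so that bounded errors vanish after
    normalisation. *)
Lemma contraction (K : set (probability (borel (homeo M)) R)) (C1 q : R) :
  0 <= q -> q < 1 -> 0 <= C1 -> weak_star_compact K -> (forall mu, K mu -> expansion_tails mu C1 q) ->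
  (forall mu, K mu -> ~ exists m1 m2 : probability (borel M) R,
     {ae mu, forall f : homeo M, forall A : set (borel M), measurable A ->
        pushforward m1 (homeo_fun f : borel M -> borel M) A = m2 A}) ->
  exists del : R, [/\ 0 < del, del <= 1 & forall mu J S, K mu -> is_state S ->
    total J (1 + del) (convolve mu S) <= (1 - del) * total J (1 + del) S + (del ^+ 2)^-1].
Proof.
move=> q0 q1 C10 cK tails h3; apply: contrapT => nex.
have [E [d0 [E0 d00 d01 hE]]] := mean_total_push_le q0 q1 C10.
pose d1 := Num.min d0 (2 * E + 1)^-1.
have d10 : 0 < d1 by rewrite lt_min d00 invr_gt0; lra.
pose del m : R := d1 * m.+1%:R^-1.
have del0 m : 0 < del m by rewrite mulr_gt0 ?invr_gt0 ?ltr0n.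
have deld1 m : del m <= d1.
  by rewrite ler_piMr ?(ltW d10)// invf_le1 ?ltr0n// ler1n.
have dd0 m : del m <= d0 by apply: le_trans (deld1 m) _; rewrite ge_min lexx.
have delE m : del m * (2 * E + 1) <= 1.
  by rewrite -ler_pdivlMr ?mul1r; [apply: le_trans (deld1 m) _; rewrite ge_min lexx orbT|lra].
have del1 m : del m <= 1 by apply: le_trans (dd0 m) d01.
have ex m : exists p : probability (borel (homeo M)) R * nat * ((M -> R) -> R),
    [/\ K p.1.1, is_state p.2 &
    (1 - del m) * total p.1.2 (1 + del m) p.2 + (del m ^+ 2)^-1 <
    total p.1.2 (1 + del m) (convolve p.1.1 p.2)].
  apply: contrapT => nm; apply: nex; exists (del m); split => // mu J S Kmu hS.
  by rewrite leNgt; apply/negP => lt; apply: nm; exists (mu, J, S).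
have [p hp] := choice ex.
pose mu_ m := (p m).1.1; pose J_ m := (p m).1.2; pose S_ m := (p m).2.
have Kmu m : K (mu_ m) by have [] := hp m.
have hS m : is_state (S_ m) by have [] := hp m.
pose V m := total (J_ m) (1 + del m) (S_ m).
pose V' m := total (J_ m) (1 + del m) (convolve (mu_ m) (S_ m)).
have lt m : (1 - del m) * V m + (del m ^+ 2)^-1 < V' m by have [] := hp m.
have lam0 m : 0 <= 1 + del m by have := del0 m; lra.
have V'mean m : V' m <= mean (mu_ m) (fun f => total (J_ m) (1 + del m) (push (S_ m) f)).
  exact: total_convolve_le.
have mean_le m : mean (mu_ m) (fun f => total (J_ m) (1 + del m) (push (S_ m) f)) <=
    V m + E * (del m * V m) + E.
  by apply: hE => //; exact: tails.
have inv2 m : 0 < (del m ^+ 2)^-1 by rewrite invr_gt0 exprn_gt0.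
(* Otherwise the failure and the growth bound give [(del m ^+ 2)^-1 < 2 * E + 1], against the choice
   [del m <= (2 * E + 1)^-1]. *)
have dV m : 1 <= del m * V m.
  rewrite leNgt; apply/negP => lt1.
  have h1 : (del m ^+ 2)^-1 < 2 * E + 1.
    have h2 := lt_le_trans (lt m) (le_trans (V'mean m) (mean_le m)).
    have h4 : E * (del m * V m) <= E * 1 by rewrite ler_pM2l// ltW.
    move: h2; rewrite mulrBl mul1r; lra.
  have h5 : 2 * E + 1 <= (del m)^-1 by rewrite -[leRHS]mul1r ler_pdivlMr// mulrC.
  have h6 : (del m)^-1 <= (del m ^+ 2)^-1.
    by rewrite lef_pV2 ?posrE ?exprn_gt0// expr2 ler_piMr// ltW.
  by have := lt_le_trans h1 (le_trans h5 h6); rewrite ltxx.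
have mean_le' m : mean (mu_ m) (fun f => total (J_ m) (1 + del m) (push (S_ m) f)) <=
    V m + 2 * E * (del m * V m).
  apply: le_trans (mean_le m) _; have : E * 1 <= E * (del m * V m) by rewrite ler_pM2l.
  lra.
have V0 m : 0 < V m.
  by have := lt_le_trans ltr01 (dV m); rewrite pmulr_rgt0.
have [F [FU subF]] := ultraFilterLemma (@eventually_filter).
have del_cvg : del m @[m --> F] --> (0 : R).
  apply: (@cvg_trans _ (del m @[m --> \oo])); first by move=> A; exact: subF.
  have : d1 * harmonic m @[m --> \oo] --> d1 * 0 by apply: cvgMr; exact: cvg_harmonic.
  by rewrite mulr0.
have [mu Kmu' mu_cvg] := ultra_map_compact (T := weak_star (homeo M) R) (u := mu_) FU cK Kmu.
have [I1 [I2 [hI1 hI2 conj]]] : exists I1 I2 : (M -> R) -> R, [/\ is_state I1, is_state I2 &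
    forall (f : homeo M) phi, msupport mu f -> continuous phi -> I1 (phi \o f) = I2 phi].
  have dEV m : del m * V m * (2 * E + 1) <= V m.
    by rewrite mulrAC ler_piMl// ltW.
  have E2 : 0 < 2 * E + 1 by lra.
  apply: (@limit_conjugacy F FU mu_ S_ J_ del (2 * E + 1) C1 q q0 q1 E2 del0 del_cvg hS _ _ _ _ _
     (fun m => tails _ (Kmu m)) mu mu_cvg) => m; rewrite -/(V m) -?/(V' m).
  - by rewrite -[leLHS]mulr1 ler_pdivrMl.
  - by have := lt m; have := inv2 m; lra.
  - have := le_trans (V'mean m) (mean_le' m); have := dV m; lra.
  - have := le_trans (V'mean m) (mean_le' m); have := dEV m; have := dV m; lra.
  (* The failure bounds [V'] below by [(1 - del) * V], the growth bounds the mean above by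
     [(1 + 2 * E * del) * V]; the variance is at most the difference, whence the constant
     [2 * E + 1]. *)
  - rewrite mean_spread// -/(V' m); have := mean_le' m; have := lt m; have := inv2 m; lra.
have [m1 hm1] := state_borel hcpt hcon hI1.
have [m2 hm2] := state_borel hcpt hcon hI2.
apply: (h3 mu Kmu'); exists m1, m2.
have [mS S0] := msupportC_null hcpt hcon mu.
exists (~` msupport mu); split => // f /= nf sf; apply: nf => A mA.
rewrite /pushforward hm1 hm2; apply: outer_transport => phi cp; exact: conj.
Qed.

(** * Decay of the mass of balls *)

Fixpoint state_iter (mu : nat -> probability (borel (homeo M)) R) (S : (M -> R) -> R) (k : nat) :=
  if k is k'.+1 then convolve (mu k) (state_iter mu S k') else S.

Lemma state_iter_state mu S k : is_state S -> is_state (state_iter mu S k).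
Proof. by move=> hS; elim: k => [|k IH] //; exact: convolve_state. Qed.

Lemma iter_conv_ge0 mu (nu0 : probability (borel M) R) k (A : set (borel M)) :
  (0 <= iter_conv mu nu0 k A)%E.
Proof.
elim: k A => [|k IH] A; first exact: measure_ge0.
by apply: integral_ge0 => f _; exact: IH.
Qed.

(** The integrand in [conv] is not known to be measurable, so monotonicity of the integral is
    applied with the measurable majorants from [state_iter]. Working with open sets keeps the
    preimages open down to the initial measure. *)
Lemma iter_conv_le mu (nu0 : probability (borel M) R) k (A : set M) phi : open A -> continuous phi ->
  (forall x, \1_A x <= phi x) ->
  (iter_conv mu nu0 k A <= (state_iter mu (mean nu0) k phi)%:E)%E.
Proof.
elim: k A phi => [|k IH] A phi oA cp h.
  have bp : bdd_measurable phi.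
    by have [b b0 hb] := continuous_bounded hcpt cp; exact: bdd_measurable_continuous cp hb.
  have mA := borel_open oA.
  have := mean_le nu0 (bdd_indic R mA) bp h; rewrite mean_indic// -lee_fin fineK//.
  exact: fin_num_measure.
have hS := state_iter_state mu k (state_of_measure hcpt nu0).
rewrite /= /convolve mean_EFin; last exact: state_homeo_bdd.
apply: le_integral_nonneg => f; first exact: iter_conv_ge0.
apply: IH.
- by apply: open_comp => // x _; exact: homeo_cont.
- exact: comp_homeo_continuous.
- by move=> x; have := h (f x); rewrite !indicE; congr (_%:R <= _); apply/idP/idP => /set_mem ?; exact/mem_set.
Qed.

Lemma total_le_pow (del : R) J S : 0 < del -> is_state S -> total J (1 + del) S <= (1 + del) ^+ J / del.
Proof.
move=> d0 hS; have l0 : 0 <= 1 + del by lra.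
apply: (@le_trans _ _ (((1 + del) ^+ J - 1) / del)); last first.
  by rewrite ler_pM2r ?invr_gt0// gerBl.
rewrite ler_pdivlMr//; elim: J => [|J IH]; first by rewrite /total big_ord0 mul0r expr0 subrr.
rewrite /total big_ord_recr /= mulrDl exprS.
have : (1 + del) ^+ J * energy J S <= (1 + del) ^+ J * 1.
  by rewrite ler_wpM2l ?exprn_ge0// energy_le1.
rewrite -(ler_pM2r d0) mulr1; move: IH; rewrite -/(total J (1 + del) S); lra.
Qed.

Lemma total_iter_le (del : R) mu S J k : 0 < del -> del <= 1 -> is_state S ->
  (forall i J S, (0 < i)%N -> is_state S ->
    total J (1 + del) (convolve (mu i) S) <= (1 - del) * total J (1 + del) S + (del ^+ 2)^-1) ->
  total J (1 + del) (state_iter mu S k) <= (1 - del) ^+ k * total J (1 + del) S + (del ^+ 3)^-1.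
Proof.
move=> d0 d1 hS hc; have i0 : 0 < (del ^+ 3)^-1 by rewrite invr_gt0 exprn_gt0.
elim: k => [|k IH]; first by rewrite expr0 mul1r /= lerDl ltW.
apply: le_trans (hc k.+1 J _ (ltn0Sn k) (state_iter_state mu k hS)) _.
apply: (@le_trans _ _ ((1 - del) * ((1 - del) ^+ k * total J (1 + del) S + (del ^+ 3)^-1) + (del ^+ 2)^-1)).
  by rewrite lerD2r ler_wpM2l//; lra.
rewrite le_eqVlt; apply/orP; left; apply/eqP; rewrite (exprS _ k); field.
by rewrite gt_eqF.
Qed.

(** With cutoff [j.+1] the initial total is at most [(1 + del) ^+ j.+1 / del], and [k >= j]
    contractions multiply it by at most [(1 - del) ^+ j]; the product is at most [2 / del] as
    [(1 - del) * (1 + del) <= 1]. *)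
Lemma energy_iter_le (del : R) mu S j k : 0 < del -> del <= 1 -> is_state S -> (j <= k)%N ->
  (forall i J S, (0 < i)%N -> is_state S ->
    total J (1 + del) (convolve (mu i) S) <= (1 - del) * total J (1 + del) S + (del ^+ 2)^-1) ->
  (1 + del) ^+ j * energy j (state_iter mu S k) <= 2 / del + (del ^+ 3)^-1.
Proof.
move=> d0 d1 hS jk hc; have l0 : 0 <= 1 + del by lra.
apply: (@le_trans _ _ (total j.+1 (1 + del) (state_iter mu S k))).
  by rewrite /total big_ord_recr /= lerDr; exact: total_ge0.
apply: le_trans (total_iter_le j.+1 k d0 d1 hS hc) _; rewrite lerD2r.
have m0 : 0 <= 1 - del by lra.
apply: (@le_trans _ _ ((1 - del) ^+ j * ((1 + del) ^+ j.+1 / del))).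
  apply: ler_pM; [exact: exprn_ge0|exact: total_ge0| |exact: total_le_pow].
  by apply: ler_wiXn2l => //; lra.
rewrite exprS mulrA mulrCA -exprMn ler_pM2r ?invr_gt0//.
have : ((1 - del) * (1 + del)) ^+ j <= 1 by apply: exprn_ile1; nra.
have : 0 <= ((1 - del) * (1 + del)) ^+ j by rewrite exprn_ge0// mulr_ge0.
move: (_ ^+ j) => u; nra.
Qed.

Lemma tent (x0 : M) (r : R) : 0 < r -> exists phi : M -> R, [/\ continuous phi,
  forall x, 0 <= phi x <= 1, forall x, phi x != 0 -> d x0 x < 2 * r & forall x, d x0 x < r -> phi x = 1].
Proof.
move=> r0; exists (fun x => Num.max 0 (Num.min 1 (2 - r^-1 * d x0 x))); split.
- have cd : continuous (fun x => 2 - r^-1 * d x0 x).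
    apply: continuous_sub; first exact: continuous_cst.
    by apply: continuous_mul; [exact: continuous_cst|exact: rdist_continuous].
  have c1 : continuous (fun x => Num.min 1 (2 - r^-1 * d x0 x)).
    by move=> x; apply: (@continuous_min _ _ (fun=> 1) (fun x => 2 - r^-1 * d x0 x)); [exact: cvg_cst|exact: cd].
  by move=> x; apply: (@continuous_max _ _ (fun=> 0) (fun x => Num.min 1 (2 - r^-1 * d x0 x))); [exact: cvg_cst|exact: c1].
- by move=> x; rewrite le_max lexx /= ge_max ler01 ge_min lexx.
- move=> x; apply: contraNT; rewrite -leNgt => h; apply/eqP/max_l.
  rewrite ge_min; apply/orP; right; by rewrite subr_le0 mulrC ler_pdivlMr.
- move=> x h; have h1 : r^-1 * d x0 x < 1 by rewrite mulrC ltr_pdivrMr// mul1r.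
  by rewrite min_l ?max_r//; lra.
Qed.

Lemma ball_decay (K : set (probability (borel (homeo M)) R)) (C1 q : R) :
  0 <= q -> q < 1 -> 0 <= C1 -> weak_star_compact K -> (forall mu, K mu -> expansion_tails mu C1 q) ->
  (forall mu, K mu -> ~ exists m1 m2 : probability (borel M) R,
     {ae mu, forall f : homeo M, forall A : set (borel M), measurable A ->
        pushforward m1 (homeo_fun f : borel M -> borel M) A = m2 A}) ->
  exists alpha C kappa : R, [/\ 0 < alpha, 1 < kappa &
    forall (nu0 : probability (borel M) R) (mu : nat -> probability (borel (homeo M)) R),
      (forall i : nat, (0 < i)%N -> K (mu i)) ->
      forall (k : nat) (x : M) (r : R), expR (- kappa ^+ k) < r -> r < 1 ->
        (iter_conv mu nu0 k (rball x r) < (C * `|ln r| `^ (- alpha))%:E)%E].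
Proof.
move=> q0 q1 C10 cK tails h3.
have [del [d0 d1 hc]] := contraction q0 q1 C10 cK tails h3.
pose A : R := (n + 3)%:R; have A3 : 3 <= A by exact: base_ge3.
have A1 : 1 < A by lra.
have A0 : 0 < A by lra.
have lam1 : 1 < 1 + del by lra.
have lam0 : 0 < 1 + del by lra.
have lnA : 0 < ln A by rewrite ln_gt0.
pose alpha := ln (1 + del) / (2 * ln A).
have al0 : 0 < alpha by rewrite divr_gt0 ?mulr_gt0// ln_gt0.
have [W WE W2] : exists2 W : R, W = 2 / del + (del ^+ 3)^-1 & 2 <= W.
  exists (2 / del + (del ^+ 3)^-1) => //.
  have a1 : 2 * 1 <= 2 / del by rewrite ler_pM2l// -[leRHS]mul1r ler_pdivlMr// mul1r.
  have a2 : 0 < (del ^+ 3)^-1 by rewrite invr_gt0 exprn_gt0.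
  lra.
have C0' := ltW C0.
(* The factor 8 bounds [(1 + del) ^+ 3], the price of using the energy of index [m - 3]; [16 <= D]
   makes the bound trivial when [l < A ^+ 2], where [P >= 2^-1]. *)
have [D DE D16] : exists2 D : R, D = 8 * (W + C) & 16 <= D by exists (8 * (W + C)) => //; lra.
have powA m : (A ^+ m) `^ (- alpha) ^+ 2 = ((1 + del) ^+ m)^-1 by exact: powR_log_ratio.
(* [D + 1] instead of [D] makes the inequality strict; the ratio [A = n + 3] of the exponents of the
   scales serves as [kappa]. *)
exists alpha, (D + 1), A; split => // nu0 mu Kmu k x r kr r1.
have r0 : 0 < r by apply: lt_trans kr; exact: expR_gt0.
have lr0 : ln r < 0 by rewrite ln_lt0// r0.
set l := `|ln r|; have lE : l = - ln r by rewrite /l ltr0_norm.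
have l0 : 0 < l by rewrite lE oppr_gt0.
have lk : l < A ^+ k.
  rewrite lE ltrNl -ltr_expR lnK ?posrE//.
have rE : r = expR (- l) by rewrite lE opprK lnK ?posrE.
set P := l `^ (- alpha); have P0 : 0 < P by exact: powR_gt0.
have lP m : l < A ^+ m -> ((1 + del) ^+ m)^-1 <= P ^+ 2.
  move=> lm; rewrite -powA; apply: lerXn2r; rewrite ?nnegrE ?powR_ge0//.
  rewrite /P !powRN lef_pV2 ?posrE ?powR_gt0 ?exprn_gt0//.
  by apply: ge0_ler_powR; rewrite ?nnegrE ?ltW// exprn_gt0.
have hS := state_iter_state mu k (state_of_measure hcpt nu0).
have oB s : open (rball x s).
  rewrite openE => y /= yB; rewrite /interior; rewrite /rball /= in yB.
  have s0 : 0 < s - d x y by rewrite subr_gt0.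
  apply: filterS (rdist_near y s0) => u hu.
  rewrite /rball /=; have := rdist_tri hcon x y u; lra.
suff main : exists phi : M -> R, [/\ continuous phi, forall y, \1_(rball x r) y <= phi y &
    state_iter mu (mean nu0) k phi <= D * P].
  have [phi [cp hp le]] := main.
  apply: le_lt_trans (iter_conv_le mu nu0 k (oB r) cp hp) _.
  by rewrite lte_fin; apply: le_lt_trans le _; rewrite ltr_pM2r// ltrDl.
have [lA|lA] := ltP l (A ^+ 2).
  exists (fun=> 1); split; first exact: continuous_cst.
    by move=> y; rewrite indicE; case: (_ \in _).
  rewrite (state_cst hS); have := lP 2%N lA.
  have : 4^-1 <= ((1 + del) ^+ 2)^-1 by rewrite lef_pV2 ?posrE ?exprn_gt0// expr2; nra.
  move=> h1 h2; have h3' := le_trans h1 h2.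
  have P2 : 2^-1 <= P by rewrite leNgt; apply/negP => lt; move: h3'; rewrite expr2; nra.
  nra.
(* The least such [m] is at most [k] because [expR (- A ^+ k) < r]. With [m = j.+3], minimality
   gives [A ^+ j.+2 <= l], that is [r <= scale j.+2], so the ball fits under a tent of radius
   [scale j.+1 / 4], as [small_ball_energy] at [j] requires. *)
have exm : exists m, l < A ^+ m by exists k.
case: (ex_minnP exm) => m lm mmin.
have mk : (m <= k)%N by exact: mmin.
have m3 : (2 < m)%N.
  rewrite ltnNge; apply/negP => m2; move: lm; rewrite ltNge => /negP; apply.
  by apply: le_trans lA; apply: ler_weXn2l => //; exact: ltW.
pose j := (m - 3)%N; have mE : m = j.+3 by rewrite /j -addn3 subnK.
have jl : A ^+ j.+2 <= l.
  by rewrite leNgt; apply/negP => /mmin; rewrite mE ltnn.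
have sc : 0 < scale j.+1 / 4 by rewrite divr_gt0// scale_gt0.
have [phi [cp p01 psupp p1]] := tent x sc.
exists phi; split => //.
  move=> y; rewrite indicE; case: (boolP (y \in _)) => [/set_mem yB|_]; last by have /andP[] := p01 y.
  rewrite p1//; apply: lt_le_trans yB _.
  have : r <= scale j.+2 by rewrite rE /scale ler_expR lerN2.
  by have := @scale_succ R n j.+1; lra.
have p0 : 0 <= state_iter mu (mean nu0) k phi by apply: (state_ge0 hS) => // y; have /andP[] := p01 y.
have e1 : state_iter mu (mean nu0) k phi ^+ 2 <=
    energy j (state_iter mu (mean nu0) k) + C * (4^-1) ^+ j.
  apply: (small_ball_energy (x0 := x) hS cp p01) => y /psupp; lra.
have jk : (j <= k)%N by apply: leq_trans mk; rewrite mE -addn3 leq_addr.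
have e2 := energy_iter_le d0 d1 (state_of_measure hcpt nu0) jk (fun i J S i0 hS => hc _ J S (Kmu i i0) hS).
rewrite -WE in e2.
have e3 : (1 + del) ^+ j * (C * (4^-1) ^+ j) <= C.
  rewrite mulrCA -exprMn ler_piMr ?(ltW C0)//; apply: exprn_ile1; lra.
have e4 : state_iter mu (mean nu0) k phi ^+ 2 <= D * P ^+ 2.
  have pj : 0 < (1 + del) ^+ j by rewrite exprn_gt0.
  apply: (@le_trans _ _ (D * ((1 + del) ^+ j.+3)^-1)); last first.
    by rewrite ler_wpM2l//; [lra|rewrite -mE; exact: lP].
  have -> : ((1 + del) ^+ j.+3)^-1 = ((1 + del) ^+ 3)^-1 / (1 + del) ^+ j.
    by rewrite -addn3 exprD invfM mulrC.
  rewrite mulrA ler_pdivlMr//; apply: (@le_trans _ _ (W + C)).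
    rewrite mulrC; apply: le_trans (_ : _ <= (1 + del) ^+ j * (energy j (state_iter mu (mean nu0) k) + C * (4^-1) ^+ j)) _.
      by rewrite ler_pM2l.
    rewrite mulrDr; exact: lerD.
  have : (1 + del) ^+ 3 <= 2 ^+ 3 by apply: lerXn2r; rewrite ?nnegrE; lra.
  rewrite -[X in _ <= X]natrX.
  move=> h8; rewrite ler_pdivlMr ?exprn_gt0// DE mulrC ler_wpM2r//; lra.
have D0 : 0 <= D by lra.
have DP0 : 0 <= D * P by rewrite mulr_ge0// ltW.
rewrite -(ler_pXn2r (ltn0Sn 1)) ?nnegrE//; apply: le_trans e4 _.
by rewrite exprMn ler_wpM2r ?sqr_ge0// expr2 ler_peMr//; lra.
Qed.

End Energy.

(** Along the powers of [n + 3] the power law of [expansion_tail] becomes geometric in the exponent.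
    [Num.min c 1] appears because [Hol_lower_bound] asks for [c <= 1]. *)
Lemma expansion_tails_le (R : realType) (n : nat) (M : riemannian_manifold R n)
    (hcpt : compact [set: M]) (hcon : connected [set: M]) (x0 y0 : M)
    (mu : probability (borel (homeo M)) R) (beta C0 c : R) :
  x0 <> y0 -> msupport mu `<=` @Hol R n M -> 0 < beta -> 0 < c ->
  (\int[mu]_(f in @Hol R n M) (holder_Lambda f `^ beta)%:E < C0%:E)%E ->
  {ae mu, forall f, c <= 1 + ln (holder_L f)} ->
  expansion_tails mu (`|C0| * Num.min c 1 `^ (- beta)) ((n + 3)%:R `^ (- beta)).
Proof.
move=> xy sH b0 c0 hI hae t.
have A0 : 0 < (n + 3)%:R :> R by rewrite ltr0n addn3.
have m0 : 0 < Num.min c 1 by rewrite lt_min c0 ltr01.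
have m1 : Num.min c 1 <= 1 by rewrite ge_min lexx orbT.
have t0 : 0 < (n + 3)%:R ^+ t :> R by rewrite exprn_gt0.
have hae' : {ae mu, forall f, Num.min c 1 <= 1 + ln (holder_L f)}.
  have [N [mN N0 sub]] := hae; exists N; split => // f nf; apply: sub => /= h; apply: nf.
  by apply: le_trans h; rewrite ge_min lexx.
apply: le_trans (expansion_tail hcpt hcon xy sH b0 m0 m1 t0 hI hae') _.
rewrite powRM ?(ltW m0) ?(ltW t0)//.
have -> : ((n + 3)%:R ^+ t) `^ (- beta) = (n + 3)%:R `^ (- beta) ^+ t :> R.
  by rewrite -!powR_mulrn ?powR_ge0 ?(ltW A0)// -!powRrM mulrC.
rewrite mulrA; apply: ler_wpM2r; first by rewrite exprn_ge0// powR_ge0.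
by apply: ler_wpM2r; [exact: powR_ge0|exact: ler_norm].
Qed.

Theorem theorem2p1p4 (R : realType) (n : nat) (M : riemannian_manifold R n)
  (hcpt : compact [set: M]) (hcon : connected [set: M])
  (K : set (probability (borel (homeo M)) R))
  (hK : weak_star_compact K)
  (h1 : forall mu, K mu -> msupport mu `<=` @Hol R n M)
  (h2 : exists beta C0 : R, 0 < beta /\ forall mu, K mu ->
     (\int[mu]_(f in @Hol R n M) (holder_Lambda f `^ beta)%:E < C0%:E)%E)
  (hpos : exists2 c : R, 0 < c & forall mu, K mu ->
     {ae mu, forall f, c <= 1 + ln (holder_L f)})
  (h3 : forall mu, K mu ->
     ~ exists m1 m2 : probability (borel M) R,
         {ae mu, forall f : homeo M, forall A : set (borel M), measurable A ->
            pushforward m1 (homeo_fun f : borel M -> borel M) A = m2 A}) :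
  exists alpha C kappa : R, [/\ 0 < alpha, 1 < kappa &
    forall (nu0 : probability (borel M) R)
           (mu : nat -> probability (borel (homeo M)) R),
      (forall i : nat, (0 < i)%N -> K (mu i)) ->
      forall (k : nat) (x : M) (r : R),
        expR (- kappa ^+ k) < r -> r < 1 ->
        (iter_conv mu nu0 k (rball x r) < (C * `|ln r| `^ (- alpha))%:E)%E].
Proof.
have [one|[x0 [y0 xy]]] : (forall x y : M, x = y) \/ exists x y : M, x <> y.
  have [h|h] := pselect (exists x y : M, x <> y); [by right|left => x y].
  by apply: contrapT => xy; apply: h; exists x, y.
  (* On a one-point [M] every [f] is the identity, so [nu0] is transported to itself and [h3] is
     contradicted; the constants are arbitrary. *)
  exists 1, 1, 2; split => // [|nu0 mu Kmu]; first by rewrite ltr1n.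
  exfalso; apply: (h3 _ (Kmu 1%N isT)); exists nu0, nu0; apply: aeW => f A _.
  rewrite /pushforward; congr (nu0 _); apply/seteqP.
  by split => x /=; rewrite (one (f x) x).
have [beta [C0 [b0 hI]]] := h2; have [c c0 hc] := hpos.
have [C [N [z [U [[C0' cU0] U1 Usupp Uclose]]]]] := features hcpt hcon.
have A1 : 1 < (n + 3)%:R :> R by rewrite ltr1n addn3.
apply: (@ball_decay R n M hcpt hcon C N z U C0' cU0.1 cU0.2 U1 Usupp Uclose K
  (`|C0| * Num.min c 1 `^ (- beta)) ((n + 3)%:R `^ (- beta))) => //.
- have A0 : 0 < (n + 3)%:R :> R by lra.
  rewrite powRN invf_lt1 ?powR_gt0// -[X in X < _](congr1 (fun h => h beta) (@powR1 R)).
  by apply: gt0_ltr_powR; rewrite // nnegrE ltW.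
- by rewrite mulr_ge0// powR_ge0.
- by move=> mu Kmu; apply: (expansion_tails_le hcpt hcon xy) => //; [exact: h1|exact: hI|exact: hc].
Qed.
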